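(* Let $W$ be a finite complex reflection group acting irreducibly on a complex vector space $V$ of finite dimension $n$, and suppose that $W$ is a duality group. Let $d=d_n$ be the highest degree of $W$. Then $\mathrm{Hom}_W(V,A)_d$ is one dimensional, and the duality pairing $$\mathrm{Hom}_W(V,A)\otimes_{\mathbb{C}}\mathrm{Hom}_W(V^*,A)\longrightarrow \mathrm{Hom}_W(V,A)_d$$ is perfect.
   Context: A complex reflection group is a finite subgroup of $GL(V)$ generated by elements whose fixed space is a hyperplane. $S=\mathbb{C}[V]=\mathrm{Sym}_{\mathbb{C}}(V^* )$ is graded with $V^*$ in degree $1$ (and $V$ in degree $-1$); $S^W$ is the algebra of invariants, $S^W_+$ its part of positive degree, $I=S\cdot S^W_+$, and $A=S/I$ is the algebra of coinvariants. $H\subseteq S$ is the space of harmonic polynomials: those killed by every invariant constant-coefficient differential operator without constant term, i.e. by $\mathrm{Sym}_{\mathbb{C}}(V)^W_+$. The composite $H\hookrightarrow S\twoheadrightarrow A$ is an isomorphism of graded $W$-representations, and is used to identify $H$ with $A$. $\mathrm{Hom}_W(V,H)$ is graded so that a $W$-map $V\to H$ with image in polynomial degree $e$ has degree $e+1$; $\mathrm{Hom}_W(V^*,H)$ is graded so that a $W$-map $V^*\to H$ with image in polynomial degree $e$ has degree $e-1$. Both have total dimension $n$. The degrees $d_1\le\cdots\le d_n$ of $W$ are the degrees (with multiplicity) in which $\mathrm{Hom}_W(V,H)$ is nonzero; the codegrees $d_1^*\ge\cdots\ge d_n^*$ are the degrees (with multiplicity) in which $\mathrm{Hom}_W(V^*,H)$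 is nonzero. Write $d=d_n$. $W$ is a duality group if $d_i+d_i^*=d$ for all $i$. Let $(v_i)$ be a basis of $V$ with dual basis $(v_i^* )$. For $\sigma\in\mathrm{Hom}_W(V,H)$ put $\tilde\sigma=\sum_i v_i^*\sigma(v_i)\in S^W$. By the Chevalley–Shephard–Todd theorem, $\sigma\mapsto\tilde\sigma$ extends to an isomorphism of graded algebras $\mathrm{Sym}_{\mathbb{C}}(\mathrm{Hom}_W(V,H))\cong S^W$. Let $p:S^W\cong\mathrm{Sym}_{\mathbb{C}}(\mathrm{Hom}_W(V,H))\twoheadrightarrow \mathrm{Hom}_W(V,H)\twoheadrightarrow\mathrm{Hom}_W(V,H)_d$ be the projection onto symmetric degree one followed by projection onto the graded component of degree $d$. The duality pairing sends $\sigma\otimes\varphi$, with $\sigma\in \mathrm{Hom}_W(V,H)$ and $\varphi\in\mathrm{Hom}_W(V^*,H)$, to $p\big(\sum_i\sigma(v_i)\varphi(v_i^* )\big)$ (the sum is $W$-invariant). *)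

(* Defs.v *)
From HB Require Import structures.
From mathcomp Require Import all_boot all_order all_algebra all_fingroup.
From mathcomp Require Import mxrepresentation generic_quotient ring_quotient.
From mathcomp Require Import boolp classical_sets functions reals.
From mathcomp Require Import complex mpoly.

Set Implicit Arguments.
Unset Strict Implicit.
Unset Printing Implicit Defensive.

Import Order.TTheory GRing.Theory Num.Theory.
Local Open Scope ring_scope.
Local Open Scope classical_set_scope.
Local Open Scope quotient_scope.
Local Open Scope complex_scope.

Section Subspaces.
Variable K : fieldType.

Definition is_basis (M : lmodType K) (U : set M) m (b : 'I_m -> M) : Prop :=
  (forall i, U (b i)) /\
  (forall u, U u -> exists! c : 'rV[K]_m, u = \sum_i c 0 i *: b i).

Definition has_dim (M : lmodType K) (U : set M) m : Prop :=
  exists b : 'I_m -> M, is_basis U b.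

Definition linear_on (M L : lmodType K) (U : set M) (T : set L) (f : M -> L) :
    Prop :=
  (forall u, U u -> T (f u)) /\
  (forall (a : K) u v, U u -> U v -> f (a *: u + v) = a *: f u + f v).

(* A bilinear map U * V -> T is perfect when both induced maps
   U -> Hom(V, T) and V -> Hom(U, T) are bijective. *)
Definition perfect_pairing (M N L : lmodType K)
    (U : set M) (V : set N) (T : set L) (B : M -> N -> L) : Prop :=
  [/\ forall u, U u -> linear_on V T (B u),
      forall v, V v -> linear_on U T (B^~ v),
      forall f : N -> L, linear_on V T f ->
        exists! u, U u /\ forall w, V w -> B u w = f w
    & forall f : M -> L, linear_on U T f ->
        exists! v, V v /\ forall w, U w -> B w v = f w].

End Subspaces.

Section ReflectionGroups.
Variables (R : realType) (gT : finGroupType) (G : {group gT}) (n : nat).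
Local Notation C := (R[i]).
(* The group W acts on V = 'rV[C]_n from the right, by v |-> v *m rG g.  All
   the actions below are right actions, so that equivariance is unambiguous. *)
Variable rG : mx_representation C G n.

(* S = C[V], with 'X_i the i-th coordinate function; the same type is used for
   Sym(V), with 'X_i standing for the i-th standard basis vector of V. *)
Local Notation S := {mpoly C[n]}.
(* V^* is the space of column vectors l, acting on V by v |-> v *m l. *)
Local Notation V := 'rV[C]_n.
Local Notation Vdual := 'cV[C]_n.

Definition is_reflection (g : gT) : bool :=
  (\rank (eigenspace (rG g) 1)).+1 == n.

(* W = rG @: G is a finite subgroup of GL(V) generated by reflections. *)
Definition reflection_group : Prop :=
  mx_faithful rG /\
  <<[set g in G | is_reflection g]%SET>>%g = G :> {set gT}.

Definition dual_act (g : gT) (l : Vdual) : Vdual := rG g^-1%g *m l.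

Definition lin_subst (M : 'M[C]_n) (f : S) : S :=
  f \mPo [tuple \sum_j M i j *: 'X_j | i < n].

(* f |-> (v |-> f (v *m rG g^-1)) *)
Definition actS (g : gT) (f : S) : S := lin_subst (rG g^-1%g)^T f.

Definition actSymV (g : gT) (q : S) : S := lin_subst (rG g) q.

Definition invariantS (f : S) : Prop := forall g, g \in G -> actS g f = f.

Definition invariantSymV (q : S) : Prop := forall g, g \in G -> actSymV g q = q.

(* The constant coefficient differential operator q(d/dx) applied to f. *)
Definition diff_op (q f : S) : S :=
  \sum_(m <- msupp q) q@_m *: mderivm m f.

Definition harmonic : set S :=
  [set f | forall q, invariantSymV q -> q@_0%MM = 0 -> diff_op q f = 0].

Definition coinv_ideal_prop (f : S) : Prop :=
  exists s : seq (S * S),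
    (forall x, x \in s -> invariantS x.2 /\ x.2@_0%MM = 0) /\
    f = \sum_(x <- s) x.1 * x.2.

Definition coinv_ideal (f : S) : bool := `[< coinv_ideal_prop f >].

Lemma coinv_ideal_closed : idealr_closed (coinv_ideal : {pred S}).
Proof.
split.
- by apply/asboolP; exists [::]; rewrite big_nil; split.
- apply/negP => /asboolP [s [hs e]].
  have : (1 : S)@_0%MM = 0.
    rewrite e raddf_sum big_seq big1 // => x /hs [_ x0].
    by rewrite /= (mcoeff0_is_multiplicative n C).1 x0 mulr0.
  by rewrite mcoeff1 eqxx => /eqP; rewrite oner_eq0.
- move=> a u v /asboolP [s [hs ->]] /asboolP [t [ht ->]]; apply/asboolP.
  exists ([seq (a * x.1, x.2) | x <- s] ++ t); split.
    by move=> x; rewrite mem_cat => /orP [/mapP [y /hs ? ->]|/ht].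
  rewrite big_cat big_map mulr_sumr; congr (_ + _).
  by apply: eq_bigr => x _; rewrite mulrA.
Qed.

HB.instance Definition _ := isIdealr.Build S coinv_ideal coinv_ideal_closed.

Definition coinv_idealr : idealr S := coinv_ideal.

Definition coinv : Type := {ideal_quot coinv_idealr}.

HB.instance Definition _ := GRing.ComNzRing.on coinv.

Definition coinv_pi (f : S) : coinv := \pi_{ideal_quot coinv_idealr} f.

Definition coinv_repr (a : coinv) : S := repr (a : {ideal_quot coinv_idealr}).

Lemma coinv_piM f g : coinv_pi (f * g) = coinv_pi f * coinv_pi g.
Proof. exact: (@Quotient.pi_mul S coinv_idealr). Qed.

Lemma coinv_piD f g : coinv_pi (f + g) = coinv_pi f + coinv_pi g.
Proof. exact: (@Quotient.pi_add S coinv_idealr). Qed.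

Lemma coinv_pi1 : coinv_pi 1 = 1.
Proof. by rewrite /coinv_pi; rewrite !piE. Qed.

Definition coinv_scale (c : C) (a : coinv) : coinv := coinv_pi c%:MP * a.

Lemma coinv_scaleA c c' a :
  coinv_scale c (coinv_scale c' a) = coinv_scale (c * c') a.
Proof. by rewrite /coinv_scale mulrA -coinv_piM mpolyCM. Qed.

Lemma coinv_scale1 : left_id 1 coinv_scale.
Proof. by move=> a; rewrite /coinv_scale mpolyC1 coinv_pi1 mul1r. Qed.

Lemma coinv_scaleDr : right_distributive coinv_scale +%R.
Proof. by move=> c a b; rewrite /coinv_scale mulrDr. Qed.

Lemma coinv_scaleDl a : {morph coinv_scale^~ a : c c' / c + c'}.
Proof. by move=> c c'; rewrite /coinv_scale mpolyCD coinv_piD mulrDl. Qed.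

HB.instance Definition _ := GRing.Zmodule_isLmodule.Build C coinv
  coinv_scaleA coinv_scale1 coinv_scaleDr coinv_scaleDl.

(* The ideal being W-stable, the choice of representative is irrelevant. *)
Definition act_coinv (g : gT) (a : coinv) : coinv :=
  coinv_pi (actS g (coinv_repr a)).

(* Gradings are over the integers, the components of negative degree being 0. *)

Definition S_deg (k : int) : set S :=
  [set f | if k is Posz e then f \is e.-homog else f = 0].

Definition S_proj (k : int) (f : S) : S :=
  if k is Posz e then pihomog mdeg e f else 0.

Definition coinv_deg (k : int) : set coinv := coinv_pi @` S_deg k.

Definition HomV_H : set (V -> S) :=
  [set s | [/\ linear s, forall v, harmonic (s v)
    & forall g, g \in G -> forall v, s (v *m rG g) = actS g (s v)]].

Definition HomVdual_H : set (Vdual -> S) :=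
  [set p | [/\ linear p, forall l, harmonic (p l)
    & forall g, g \in G -> forall l, p (dual_act g l) = actS g (p l)]].

Definition HomV_A : set (V -> coinv) :=
  [set s | linear s /\
    forall g, g \in G -> forall v, s (v *m rG g) = act_coinv g (s v)].

Definition HomVdual_A : set (Vdual -> coinv) :=
  [set p | linear p /\
    forall g, g \in G -> forall l, p (dual_act g l) = act_coinv g (p l)].

(* V has degree -1 and V^* has degree 1. *)
Definition HomV_H_deg (k : int) : set (V -> S) :=
  HomV_H `&` [set s | forall v, S_deg (k - 1) (s v)].

Definition HomVdual_H_deg (k : int) : set (Vdual -> S) :=
  HomVdual_H `&` [set p | forall l, S_deg (k + 1) (p l)].

Definition HomV_A_deg (k : int) : set (V -> coinv) :=
  HomV_A `&` [set s | forall v, coinv_deg (k - 1) (s v)].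

Definition is_degrees (ds : n.-tuple int) : Prop :=
  sorted <=%O ds /\ forall k, has_dim (HomV_H_deg k) (count_mem k ds).

Definition is_codegrees (cs : n.-tuple int) : Prop :=
  sorted >=%O cs /\ forall k, has_dim (HomVdual_H_deg k) (count_mem k cs).

Definition highest_degree (ds : n.-tuple int) : int := last 0 ds.

Definition duality_group (ds cs : n.-tuple int) : Prop :=
  [/\ is_degrees ds, is_codegrees cs
    & forall i, tnth ds i + tnth cs i = highest_degree ds].

Definition tilde (s : V -> S) : S := \sum_i 'X_i * s (delta_mx 0 i).

(* Sym(Hom_W(V,H)) is the polynomial ring on a basis b of Hom_W(V,H);
   cst_map b : Sym(Hom_W(V,H)) -> S extends s |-> tilde s, and by the
   Chevalley-Shephard-Todd theorem it is injective with image S^W. *)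
Definition cst_map (b : 'I_n -> (V -> S)) (q : {mpoly C[n]}) : S :=
  q \mPo [tuple tilde (b i) | i < n].

Definition cst_inv (b : 'I_n -> (V -> S)) (f : S) : {mpoly C[n]} :=
  xget 0 [set q | cst_map b q = f].

Definition sym1_proj (b : 'I_n -> (V -> S)) (q : {mpoly C[n]}) : V -> S :=
  \sum_i q@_U_(i)%MM *: b i.

(* The projection p : S^W -> Hom_W(V,H)_d. *)
Definition duality_proj (b : 'I_n -> (V -> S)) (d : int) (f : S) : V -> S :=
  fun v => S_proj (d - 1) (sym1_proj b (cst_inv b f) v).

(* Inverse of the isomorphism H -> A. *)
Definition harmonic_lift (a : coinv) : S :=
  xget 0 [set h | harmonic h /\ coinv_pi h = a].

Definition duality_pairing (b : 'I_n -> (V -> S)) (d : int)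
    (s : V -> coinv) (p : Vdual -> coinv) : V -> coinv :=
  fun v => coinv_pi (duality_proj b d
    (\sum_i harmonic_lift (s (delta_mx 0 i)) *
            harmonic_lift (p (delta_mx i 0))) v).

End ReflectionGroups.

Arguments HomV_A {R gT G n} rG.
Arguments HomVdual_A {R gT G n} rG.
Arguments HomV_A_deg {R gT G n} rG k.
Arguments duality_pairing {R gT G n} rG b d s p.

(* Main.v *)
(* Let d be the highest degree.  In a duality group the degree d occurs once, because by
   Schur's lemma the codegree 0 does; so the degree d component of a basis element b_k of
   Hom_W(V, H) is lam_k * beta for a fixed beta.  Averaging and harmonic projection show that
   the invariants tilde b_k generate S^W, and a Jacobian argument that they are independent;
   by integrality there is a vector v with (tilde b_k)(v) = lam_k for all k.  An invariant
   f = q(tilde b) then satisfies f(x v) = q(x^d lam), so that homogeneous invariants of degree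
   not divisible by d vanish at v and, when f only involves degrees strictly between 0 and 2d,
   p(f) = f(v) beta.  The duality pairing of s and phi is therefore the dot product of their
   values at v, times beta, and it remains to see that evaluation at v is bijective on both
   Hom spaces, which holds as soon as v has trivial stabiliser.

   For the latter, let D be the projection along the vectors fixed by the stabiliser of v.
   There is an equivariant vector field F, of degrees congruent to 1 modulo d, with F(v) = 0
   and derivative N D at v, N > 0.  Expand F over the harmonic ones, whose degrees lie in
   [1, d], those of degree 1 being multiples of the Euler field: the coefficients of the others
   have degrees not divisible by d, so they vanish at v, and their derivatives at v vanish on
   the image of D.  Thus F and its derivative at v on the image of D are given by one scalar A;
   from F(v) = 0 one gets A = 0, and D = 0. *)

Require Import Defs.
From HB Require Import structures.
From mathcomp Require Import all_boot all_order all_algebra all_fingroup.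
From mathcomp Require Import cyclic separable cyclotomic.
From mathcomp Require Import mxrepresentation.
From mathcomp Require Import boolp classical_sets functions reals.
From mathcomp Require Import complex ssrcomplements mpoly ring zify.

Set Implicit Arguments.
Unset Strict Implicit.
Unset Printing Implicit Defensive.

Import Order.TTheory GRing.Theory Num.Theory.
Local Open Scope ring_scope.

(** * Linear substitutions and directional derivatives *)

(** Read [Hom_W(V, S)] as the space of invariant 1-forms on V and [Hom_W(V^*, S)] as that of
    invariant polynomial vector fields: the duality pairing is then contraction, and [tilde] is
    contraction with the Euler field. The given basis of Hom_W(V, H) need not be homogeneous, so
    there is no single basic invariant of degree d to work with; the vector of top coefficients lam
    takes its place. The relation d_i + d_i^* = d confines harmonic vector fields to d consecutive
    polynomial degrees, in which 1 is the only representative of its class modulo d: this is why, at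
    v, an equivariant vector field with degrees in that class looks like the Euler field. The same
    relation keeps the contractions below degree 2d, so that in f(x v) = q(x^d lam) the quadratic
    and higher terms of q cannot interfere with the linear part that p extracts. The harmonic
    polynomials are handled throughout as the orthogonal complement of the coinvariant ideal for a
    definite form. *)

Section LinearSubstitution.
Variable K : comNzRingType.

(** Suited to identities between linear maps whose behaviour under multiplication by one variable is
    known: ring morphisms and derivations are then compared on the variables only. *)
Lemma mpoly_ind_linX n (P : {mpoly K[n]} -> Prop) :
    P 1 -> (forall c p q, P p -> P q -> P (c *: p + q)) ->
    (forall i p, P p -> P ('X_i * p)) ->
  forall p, P p.
Proof.
move=> P1 PD PX p.
have P0 : P 0 by rewrite -(addNr 1) -scaleN1r; apply: PD.
have PXm m : P 'X_[m].
  have [k] := ubnP (mdeg m); elim: k m => // k IHk m.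
  have [->|m0] := eqVneq m 0%MM; first by rewrite mpolyX0.
  have [i mi] : exists i, m i != 0%N.
    apply/existsP; apply: contraR m0 => /existsPn mi; apply/eqP/mnmP => i.
    by rewrite mnm0E; apply/eqP/negPn/mi.
  rewrite -(@submK _ U_(i) m) ?lep1mP // addmC mpolyXD => mk; apply/PX/IHk.
  move: mk; rewrite mdegD mdeg1 ltnS; exact: leq_trans.
elim/mpolyind: p => // c m p _ _; exact: PD.
Qed.

Definition lsub n m (A : 'M[K]_(n, m)) (f : {mpoly K[n]}) : {mpoly K[m]} :=
  f \mPo [tuple \sum_j A i j *: 'X_j | i < n].

Section Lsub.
Variables (n m : nat) (A : 'M[K]_(n, m)).
Implicit Types (f g : {mpoly K[n]}).

Lemma lsubX i : lsub A 'X_i = \sum_j A i j *: 'X_j.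
Proof. by rewrite /lsub comp_mpolyXU -tnth_nth tnth_mktuple. Qed.

Lemma lsub_is_linear c f g : lsub A (c *: f + g) = c *: lsub A f + lsub A g.
Proof. by rewrite /lsub raddfD /= comp_mpolyZ. Qed.

HB.instance Definition _ := GRing.isLinear.Build K {mpoly K[n]} {mpoly K[m]} _
  (lsub A) lsub_is_linear.

Fact lsub_monoid_morphism : monoid_morphism (lsub A).
Proof. by split; [exact: comp_mpoly1|move=> f g; exact: rmorphM]. Qed.

HB.instance Definition _ := GRing.isMonoidMorphism.Build _ _ (lsub A)
  lsub_monoid_morphism.

End Lsub.

Lemma lsub_comp n m p (A : 'M[K]_(n, m)) (B : 'M_(m, p)) f :
  lsub B (lsub A f) = lsub (A *m B) f.
Proof.
elim/mpoly_ind_linX: f => [|c f g fE gE|i f fE]; first by rewrite !rmorph1.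
  by rewrite !linearP /= fE gE.
rewrite !rmorphM /= fE; congr (_ * _); rewrite !lsubX linear_sum /=.
under eq_bigr => j _ do rewrite linearZ /= lsubX scaler_sumr.
rewrite exchange_big; apply: eq_bigr => k _ /=.
by rewrite mxE scaler_suml; apply: eq_bigr => j _; rewrite scalerA.
Qed.

Lemma lsub1 n (f : {mpoly K[n]}) : lsub 1%:M f = f.
Proof.
rewrite -[RHS]comp_mpoly_id; congr (_ \mPo _); apply: eq_mktuple => i.
rewrite (bigD1 i) //= big1 ?mxE ?eqxx ?scale1r ?addr0 // => j ji.
by rewrite mxE eq_sym (negPf ji) scale0r.
Qed.

Definition ev n (v : 'rV[K]_n) (f : {mpoly K[n]}) : K := f.@[v 0].

HB.instance Definition _ n (v : 'rV[K]_n) :=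
  GRing.RMorphism.copy (ev v) (meval (v 0)).

Lemma evZ n (v : 'rV_n) c f : ev v (c *: f) = c * ev v f.
Proof. exact: mevalZ. Qed.

Lemma evX n (v : 'rV_n) i : ev v 'X_i = v 0 i.
Proof. exact: mevalXU. Qed.

Lemma evC n (v : 'rV_n) c : ev v c%:MP = c.
Proof. exact: mevalC. Qed.

Lemma ev_lsub n m (A : 'M_(n, m)) v f : ev v (lsub A f) = ev (v *m A^T) f.
Proof.
rewrite /ev /lsub comp_mpoly_meval; apply: meval_eq => i.
rewrite tnth_mktuple raddf_sum mxE /=; apply: eq_bigr => j _.
by rewrite mevalZ mevalXU mxE mulrC.
Qed.

Lemma mderivXU n (i j : 'I_n) : ('X_i : {mpoly K[n]})^`M(j) = (i == j)%:R.
Proof.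
rewrite mderivX mnm1E; case: eqVneq => [->|_]; last by rewrite scale0r.
by rewrite -{1}[U_(j)%MM]add0m addmK mpolyX0 scale1r.
Qed.

Lemma mderiv_comp n m (t : m.-tuple {mpoly K[n]}) (q : {mpoly K[m]}) i :
  (q \mPo t)^`M(i) = \sum_k (q^`M(k) \mPo t) * (tnth t k)^`M(i).
Proof.
elim/mpoly_ind_linX: q => [|c f g fE gE|j f fE].
- rewrite comp_mpoly1 -mpolyC1 mderivC big1 // => k _.
  by rewrite mderivC comp_mpoly0 mul0r.
- rewrite comp_mpolyD comp_mpolyZ mderivD mderivZ fE gE scaler_sumr -big_split.
  apply: eq_bigr => k _ /=; rewrite mderivD mderivZ comp_mpolyD comp_mpolyZ.
  by rewrite mulrDl scalerAl.
rewrite rmorphM /= mderivM fE comp_mpolyXU -tnth_nth mulr_sumr.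
rewrite [RHS](eq_bigr (fun k => (j == k)%:R * ((f \mPo t) * (tnth t k)^`M(i)) +
    tnth t j * ((f^`M(k) \mPo t) * (tnth t k)^`M(i)))); last first.
  move=> k _; rewrite mderivM rmorphD !rmorphM /= mderivXU comp_mpolyXU.
  by rewrite -tnth_nth rmorph_nat mulrDl !mulrA.
rewrite big_split /=; congr (_ + _).
rewrite (bigD1 j) //= eqxx mul1r big1 ?addr0 1?mulrC // => k kj.
by rewrite eq_sym (negPf kj) mul0r.
Qed.

Lemma mderiv_linform n (c : 'I_n -> K) i :
  (\sum_j c j *: 'X_j : {mpoly K[n]})^`M(i) = (c i)%:MP.
Proof.
rewrite raddf_sum (bigD1 i) //= mderivZ mderivXU eqxx alg_mpolyC.
by rewrite big1 ?addr0 // => j ji; rewrite mderivZ mderivXU (negPf ji) scaler0.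
Qed.

Lemma mderiv_lsub n m (A : 'M[K]_(n, m)) f i :
  (lsub A f)^`M(i) = \sum_k A k i *: lsub A f^`M(k).
Proof.
rewrite mderiv_comp; apply: eq_bigr => k _.
by rewrite tnth_mktuple mderiv_linform mulrC mul_mpolyC.
Qed.

Definition dd n (v y : 'rV[K]_n) (f : {mpoly K[n]}) : K :=
  \sum_i y 0 i * ev v f^`M(i).

Lemma dd_is_linear n (v y : 'rV_n) : scalar (dd v y).
Proof.
move=> c f g; rewrite /dd mulr_sumr -big_split; apply: eq_bigr => i _ /=.
by rewrite mderivD mderivZ rmorphD /= evZ mulrDr mulrCA.
Qed.

HB.instance Definition _ n (v y : 'rV_n) :=
  GRing.isLinear.Build K {mpoly K[n]} K _ (dd v y) (@dd_is_linear n v y).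

Lemma ddM n (v y : 'rV_n) f g :
  dd v y (f * g) = dd v y f * ev v g + ev v f * dd v y g.
Proof.
rewrite /dd mulr_suml mulr_sumr -big_split; apply: eq_bigr => i _ /=.
by rewrite mderivM rmorphD !rmorphM /= mulrDr mulrA [in X in _ + X]mulrCA.
Qed.

Lemma ddX n (v y : 'rV_n) i : dd v y 'X_i = y 0 i.
Proof.
rewrite /dd (bigD1 i) //= mderivXU eqxx rmorph1 mulr1 big1 ?addr0 // => j ji.
by rewrite mderivXU eq_sym (negPf ji) rmorph0 mulr0.
Qed.

Lemma ddD n (v y z : 'rV_n) f : dd v (y + z) f = dd v y f + dd v z f.
Proof. by rewrite /dd -big_split; apply: eq_bigr => i _; rewrite mxE mulrDl. Qed.

Lemma ddZ n (v y : 'rV_n) c f : dd v (c *: y) f = c * dd v y f.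
Proof.
by rewrite /dd mulr_sumr; apply: eq_bigr => i _; rewrite mxE mulrA.
Qed.

Lemma dd1 n (v y : 'rV_n) : dd v y 1 = 0.
Proof.
apply: (@addrI _ (dd v y 1)).
by rewrite -[in RHS](mulr1 1) ddM rmorph1 !mul1r mulr1 addr0.
Qed.

Lemma dd_lsub n m (A : 'M_(n, m)) v y f :
  dd v y (lsub A f) = dd (v *m A^T) (y *m A^T) f.
Proof.
elim/mpoly_ind_linX: f => [|c f g fE gE|i f fE].
- by rewrite rmorph1 !dd1.
- by rewrite !linearP /= fE gE.
rewrite rmorphM /= !ddM fE lsubX ddX !linear_sum /= ev_lsub evX !mxE.
congr (_ * _ + _ * _); rewrite ?raddf_sum; apply: eq_bigr => j _; rewrite mxE.
  by rewrite linearZ /= ddX mulrC.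
by rewrite [LHS]evZ evX mulrC.
Qed.

End LinearSubstitution.

Section Homogeneous.
Variable K : comNzRingType.

Lemma pihomogM n d e (p q : {mpoly K[n]}) : p \is d.-homog ->
  pihomog mdeg (d + e) (p * q) = p * pihomog mdeg e q.
Proof.
move=> pd; have [k qk] : exists k, (msize q <= k)%N by exists (msize q).
have qk' : (msize q <= maxn k e.+1)%N by rewrite leq_max qk.
rewrite {1}(pihomog_partitionE qk') mulr_sumr raddf_sum /=.
have eK : (e < maxn k e.+1)%N by rewrite leq_max ltnSn orbT.
rewrite (bigD1 (Ordinal eK)) //= big1 ?addr0.
  by rewrite pihomog_dE //; apply: dhomogM => //; apply: pihomogP.
move=> i ie; apply: (@pihomog_ne0 _ _ _ (d + i)).
  by rewrite eqn_add2l; apply: contra ie => /eqP ie; apply/eqP/val_inj.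
by apply: dhomogM => //; apply: pihomogP.
Qed.

Lemma pihomogM_lt n d e (p q : {mpoly K[n]}) : p \is d.-homog -> (e < d)%N ->
  pihomog mdeg e (p * q) = 0.
Proof.
move=> pd ed; rewrite {1}(pihomog_partitionE (leqnn (msize q))).
rewrite mulr_sumr raddf_sum /= big1 // => i _.
apply: (@pihomog_ne0 _ _ _ (d + i)).
  by rewrite neq_ltn (leq_trans ed (leq_addr _ _)) orbT.
by apply: dhomogM => //; apply: pihomogP.
Qed.

Lemma homog0P n (p : {mpoly K[n]}) : p \is 0.-homog -> p = (p@_0%MM)%:MP.
Proof.
move=> p0; apply/mpolyP => m; rewrite mcoeffC; case: eqVneq => [->|m0].
  by rewrite mulr1.
by rewrite mulr0; apply: (dhomog_nemf_coeff p0); rewrite /= mdeg_eq0.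
Qed.

Lemma linform_homog n (c : 'I_n -> K) :
  \sum_j c j *: 'X_j \is [in K[n], 1.-homog].
Proof. by apply: rpred_sum => j _; rewrite rpredZ // dhomogX /= mdeg1. Qed.

Lemma pihomog_lsub n m (A : 'M_(n, m)) d (f : {mpoly K[n]}) :
  pihomog mdeg d (lsub A f) = lsub A (pihomog mdeg d f).
Proof.
elim/mpoly_ind_linX: f d => [|c f g fE gE|i f fE] d.
- rewrite rmorph1 -!mpolyX0 !pihomogX /= !mdeg0.
  by case: eqP; rewrite ?rmorph0 // !mpolyX0 rmorph1.
- by rewrite !linearP /= fE gE.
have hX : ('X_i : {mpoly K[n]}) \is 1.-homog by rewrite dhomogX /= mdeg1.
have hA : lsub A 'X_i \is 1.-homog by rewrite lsubX linform_homog.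
rewrite rmorphM; case: d => [|d]; first by rewrite !(@pihomogM_lt _ 1) ?rmorph0.
by rewrite -[d.+1]add1n !pihomogM // rmorphM fE.
Qed.

Lemma lsub_homog n m (A : 'M_(n, m)) d (f : {mpoly K[n]}) :
  f \is d.-homog -> lsub A f \is d.-homog.
Proof. by move=> fd; rewrite -(pihomog_dE fd) -pihomog_lsub pihomogP. Qed.

Lemma mderiv_homog n i d (f : {mpoly K[n]}) :
  f \is d.+1.-homog -> f^`M(i) \is d.-homog.
Proof.
move=> /dhomogP fd; apply/dhomogP => m; rewrite mcoeff_msupp mcoeff_deriv.
move=> nz; have /fd : (m + U_(i))%MM \in msupp f.
  by rewrite mcoeff_msupp; apply: contra nz => /eqP ->; rewrite mul0rn.
by rewrite /= mdegD mdeg1 addn1 => -[].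
Qed.

Lemma euler_identity n d (f : {mpoly K[n]}) : f \is d.-homog ->
  \sum_i 'X_i * f^`M(i) = f *+ d.
Proof.
move=> /dhomogP fd.
have -> : f *+ d = \sum_(m <- msupp f) (f@_m *: 'X_[m]) *+ d.
  by rewrite {1}[f]mpolyE sumrMnl.
under eq_bigr => i _.
  rewrite {1}[f]mpolyE raddf_sum mulr_sumr /=.
  under eq_bigr => m _ do
    rewrite mderivZ mderivX -scalerAr -scalerAr scaler_nat -mpolyXD.
  over.
rewrite exchange_big big_seq [RHS]big_seq; apply: eq_bigr => m mf /=.
rewrite -scaler_sumr scalerMnr -(fd _ mf) /= mdegE; congr (_ *: _).
rewrite -sumrMnr; apply: eq_bigr => i _; case mi: (m i) => [|k] //.
by congr (_ *+ _); congr mpolyX; rewrite addmC submK // lep1mP mi.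
Qed.

End Homogeneous.

(** * The apolar pairing between differential operators and polynomials *)

Section Pairing.
Variable K : comNzRingType.

Definition dop n (q f : {mpoly K[n]}) := \sum_(m <- msupp q) q@_m *: f^`M[m].

Lemma dopwE n k (q f : {mpoly K[n]}) : (msize q <= k)%N ->
  dop q f = \sum_(m : 'X_{1..n < k}) q@_m *: f^`M[m].
Proof.
move=> qk; rewrite /dop (big_mksub 'X_{1..n < k}) //=; first last.
- by move=> m /msize_mdeg_lt/leq_trans; apply.
- exact: msupp_uniq.
by rewrite big_rmcond //= => m /memN_msupp_eq0 ->; rewrite scale0r.
Qed.

Lemma dop_linear_l n (f : {mpoly K[n]}) : linear (fun q => dop q f).
Proof.
move=> c p q; pose k := maxn (msize (c *: p + q)) (maxn (msize p) (msize q)).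
rewrite !(@dopwE _ k) ?leq_max ?leqnn ?orbT // scaler_sumr -big_split /=.
by apply: eq_bigr => m _; rewrite mcoeffD mcoeffZ scalerDl scalerA.
Qed.

Lemma dop_linear_r n (q : {mpoly K[n]}) : linear (dop q).
Proof.
move=> c f g; rewrite /dop scaler_sumr -big_split; apply: eq_bigr => m _ /=.
by rewrite mderivmD mderivmZ scalerDr !scalerA mulrC.
Qed.

HB.instance Definition _ n (q : {mpoly K[n]}) :=
  GRing.isLinear.Build K {mpoly K[n]} {mpoly K[n]} _ (dop q) (dop_linear_r q).

Lemma dopDl n (p q f : {mpoly K[n]}) : dop (p + q) f = dop p f + dop q f.
Proof. by have := dop_linear_l f 1 p q; rewrite !scale1r. Qed.

Lemma dop0l n (f : {mpoly K[n]}) : dop 0 f = 0.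
Proof. by rewrite /dop msupp0 big_nil. Qed.

Lemma dopZl n c (q f : {mpoly K[n]}) : dop (c *: q) f = c *: dop q f.
Proof. by have := dop_linear_l f c q 0; rewrite !addr0 dop0l addr0. Qed.

Lemma dopX n m (f : {mpoly K[n]}) : dop 'X_[m] f = f^`M[m].
Proof. by rewrite /dop msuppX big_seq1 mcoeffX eqxx scale1r. Qed.

Lemma dop1 n (f : {mpoly K[n]}) : dop 1 f = f.
Proof. by rewrite -mpolyX0 dopX mderivm0m. Qed.

Lemma dop_mulX n i (q f : {mpoly K[n]}) : dop ('X_i * q) f = dop q f^`M(i).
Proof.
elim/mpolyind: q => [|c m q _ _ qE]; first by rewrite mulr0 !dop0l.
rewrite mulrDr !dopDl qE -scalerAr -mpolyXD !dopZl !dopX mderivmDm.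
by rewrite mderivmU1m.
Qed.

Lemma dopM n (p q f : {mpoly K[n]}) : dop (p * q) f = dop p (dop q f).
Proof.
elim/mpoly_ind_linX: p f => [|c p r pE rE|i p pE] f.
- by rewrite mul1r dop1.
- by rewrite mulrDl !dopDl -scalerAl !dopZl pE rE.
rewrite -mulrA !dop_mulX pE; congr (dop p _); clear pE.
elim/mpoly_ind_linX: q f => [|c q r qE rE|j q qE] f.
- by rewrite !dop1.
- by rewrite !dopDl !dopZl qE rE mderivD mderivZ.
by rewrite !dop_mulX -qE mderiv_comm.
Qed.

(** The apolar pairing: distinct monomials are orthogonal, and multiplication by q on the left is
    adjoint to [dop q] on the right. *)
Definition pairing n (q f : {mpoly K[n]}) : K := (dop q f)@_0%MM.

Lemma pairing_linear_l n (f : {mpoly K[n]}) : scalar (fun q => pairing q f).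
Proof. by move=> c p q; rewrite /pairing dopDl dopZl mcoeffD mcoeffZ. Qed.

Lemma pairing_linear_r n (q : {mpoly K[n]}) : scalar (pairing q).
Proof. by move=> c f g; rewrite /pairing linearP mcoeffD mcoeffZ. Qed.

HB.instance Definition _ n (q : {mpoly K[n]}) :=
  GRing.isLinear.Build K {mpoly K[n]} K _ (pairing q) (pairing_linear_r q).

(** The pairing with its arguments exchanged, so that linearity in the operator can be registered as
    well. *)
Definition pairingl n (f q : {mpoly K[n]}) := pairing q f.

HB.instance Definition _ n (f : {mpoly K[n]}) :=
  GRing.isLinear.Build K {mpoly K[n]} K _ (pairingl f) (pairing_linear_l f).

Lemma pairing0l n (f : {mpoly K[n]}) : pairing 0 f = 0.
Proof. by rewrite -/(pairingl f 0) linear0. Qed.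

Lemma pairingM n (p q f : {mpoly K[n]}) : pairing (p * q) f = pairing p (dop q f).
Proof. by rewrite /pairing dopM. Qed.

Lemma pairing_mulX n i (q f : {mpoly K[n]}) :
  pairing ('X_i * q) f = pairing q f^`M(i).
Proof. by rewrite /pairing dop_mulX. Qed.

Lemma pairingX n m (f : {mpoly K[n]}) :
  pairing 'X_[m] f = f@_m *+ (\prod_i (m i)`!).
Proof.
rewrite /pairing dopX mcoeff_mderivm addm0; congr (_ *+ _).
by apply: eq_bigr => i _; rewrite ffactnn.
Qed.

Lemma pairingE n (q f : {mpoly K[n]}) :
  pairing q f = \sum_(m <- msupp q) q@_m * f@_m *+ (\prod_i (m i)`!).
Proof.
rewrite -/(pairingl f q) {1}[q]mpolyE linear_sum; apply: eq_bigr => m _ /=.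
by rewrite linearZ /= /pairingl pairingX mulrnAr.
Qed.

Lemma pairing_lsub n m (A : 'M_(n, m)) q f :
  pairing (lsub A q) f = pairing q (lsub A^T f).
Proof.
elim/mpoly_ind_linX: q f => [|c p q pE qE|i q qE] f.
- rewrite rmorph1 /pairing !dop1; elim/mpoly_ind_linX: f => [|c f g fE gE|i f _].
  + by rewrite !rmorph1.
  + by rewrite !linearP /= fE gE.
  rewrite !rmorphM /= lsubX raddf_sum /=.
  rewrite mcoeffX mnm1_eq0 mul0r big1 ?mul0r // => j _.
  by rewrite mcoeffZ mcoeffX mnm1_eq0 mulr0.
- by rewrite linearP /= !pairing_linear_l pE qE.
rewrite rmorphM /= lsubX mulr_suml -/(pairingl f _) linear_sum /=.
under eq_bigr => j _.
  rewrite -scalerAl linearZ /= /pairingl pairing_mulX qE.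
  over.
rewrite pairing_mulX mderiv_lsub linear_sum; apply: eq_bigr => j _.
by rewrite linearZ mxE.
Qed.

End Pairing.

Section Positivity.
Variable C : numClosedFieldType.

Definition mconj n (f : {mpoly C[n]}) : {mpoly C[n]} := map_mpoly Num.conj f.

HB.instance Definition _ n := GRing.RMorphism.copy (@mconj n) (map_mpoly Num.conj).

Lemma mconjK n : involutive (@mconj n).
Proof. by move=> f; apply/mpolyP => m; rewrite !mcoeff_map_mpoly /= conjCK. Qed.

Lemma mconjZ n c (f : {mpoly C[n]}) : mconj (c *: f) = c^* *: mconj f.
Proof. exact: map_mpolyZ. Qed.

Lemma mconj_lsub n m (A : 'M_(n, m)) f :
  mconj (lsub A f) = lsub (map_mx Num.conj A) (mconj f).
Proof.
elim/mpoly_ind_linX: f => [|c f g fE gE|i f fE].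
- by rewrite !rmorph1.
- by rewrite linearP !rmorphD /= !mconjZ linearZ /= fE gE.
rewrite !rmorphM /= fE; congr (_ * _).
rewrite [mconj 'X_i]map_mpolyX !lsubX raddf_sum /=; apply: eq_bigr => j _.
by rewrite mconjZ mxE [mconj _]map_mpolyX.
Qed.

(** The pairing is a sum of squared moduli of the coefficients, weighted by products of
    factorials. *)
Lemma pairing_mconj_eq0 n (f : {mpoly C[n]}) : pairing (mconj f) f = 0 -> f = 0.
Proof.
rewrite pairingE (perm_big (msupp f)) /=; last first.
  by apply: msupp_map_mpoly; apply: fmorph_inj.
move/eqP; rewrite psumr_eq0 => [/allP f0|m _]; last first.
  by rewrite mulrn_wge0 // mcoeff_map_mpoly mulrC mul_conjC_ge0.
apply/mpolyP => m; rewrite mcoeff0; have [/f0|/memN_msupp_eq0 //] := boolP (m \in msupp f).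
rewrite mcoeff_map_mpoly mulrn_eq0 => /orP[|]; last first.
  by rewrite mulrC mul_conjC_eq0 => /eqP.
by rewrite -leqn0 leqNgt prodn_gt0 // => i; rewrite fact_gt0.
Qed.

End Positivity.

(* No symmetry is asked of [form]: definiteness alone gives an orthogonal projection. *)
Lemma orthogonal_projection (K : fieldType) (M : lmodType K) (T : eqType)
    (u : T -> M) (form : M -> M -> K) (sg : K -> K) :
    (forall x y z, form (x + y) z = form x z + form y z) ->
    (forall c x z, form (c *: x) z = sg c * form x z) ->
    (forall x, scalar (form x)) -> (forall x, form x x = 0 -> x = 0) ->
  forall s : seq T, uniq s -> forall f, exists c : T -> K,
    forall t, t \in s -> form (u t) (f - \sum_(t <- s) c t *: u t) = 0.
Proof.
move=> formD formZ formL form0.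
have formBr x y z : form x (y - z) = form x y - form x z.
  by have := formL x (-1) z y; rewrite scaleN1r mulN1r !(addrC (- _)).
have form0l z : form 0 z = 0.
  by apply: (@addrI _ (form 0 z)); rewrite -formD !addr0.
have formsum (s : seq T) (c : T -> K) z : (forall t, t \in s -> form (u t) z = 0) ->
    form (\sum_(t <- s) c t *: u t) z = 0.
  elim: s => [|t s IHs] sz; first by rewrite big_nil form0l.
  rewrite big_cons formD formZ sz ?mem_head // mulr0 add0r IHs // => x xs.
  by apply: sz; rewrite in_cons xs orbT.
elim=> [|t s IHs] /=; first by move=> _ f; exists (fun=> 0).
case/andP=> ts us f; have [c cE] := IHs us f; have [e eE] := IHs us (u t).
set f1 := f - _ in cE; set u1 := u t - _ in eE.
(* Gram-Schmidt: [u1] is what is left of [u t] after projection along s. No independence is assumed;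
   when [u1] is 0, every value of r would do. *)
pose r := form u1 f1 / form u1 u1.
pose c' x := if x == t then r else c x - r * e x; exists c'.
have -> : f - \sum_(x <- t :: s) c' x *: u x = f1 - r *: u1.
  have -> : \sum_(x <- t :: s) c' x *: u x =
      r *: u t + (\sum_(x <- s) c x *: u x - r *: \sum_(x <- s) e x *: u x).
    rewrite big_cons /c' eqxx; congr (_ + _); rewrite scaler_sumr -sumrB.
    rewrite !big_seq; apply: eq_bigr => x xs.
    have -> : (x == t) = false by apply: contraNF ts => /eqP <-.
    by rewrite scalerBl scalerA.
  by rewrite /f1 /u1 scalerBr !opprD !opprK !addrA [f - r *: _ - _]addrAC.
have formr0 y : form y 0 = 0 by rewrite -(subrr 0) formBr subrr.
have formr y z : form y (r *: z) = r * form y z.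
  by rewrite -[r *: z]addr0 formL formr0 addr0.
have orth x : x \in s -> form (u x) (f1 - r *: u1) = 0.
  by move=> xs; rewrite formBr formr cE // eE // mulr0 subr0.
move=> x; rewrite in_cons => /orP[/eqP ->|]; last exact: orth.
rewrite -[u t](subrK (\sum_(x <- s) e x *: u x)) -/u1 formD formsum // addr0.
rewrite formBr formr /r; have [/form0 ->|nz] := eqVneq (form u1 u1) 0.
  by rewrite !form0l mul0r mulr0 subrr.
by rewrite divfK // subrr.
Qed.

(** * Invariants and equivariant maps *)

Section Action.
Variables (C : numClosedFieldType) (gT : finGroupType) (G : {group gT}) (n : nat).
Variable rG : mx_representation C G n.
Local Notation S := {mpoly C[n]}.

Definition act (g : gT) (f : S) : S := lsub (rG g^-1%g)^T f.

Definition inv (f : S) : Prop := forall g, g \in G -> act g f = f.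

HB.instance Definition _ g := GRing.RMorphism.copy (act g) (lsub (rG g^-1%g)^T).
HB.instance Definition _ g := GRing.Linear.copy (act g) (lsub (rG g^-1%g)^T).

Lemma actZ g c f : act g (c *: f) = c *: act g f.
Proof. exact: linearZ_LR. Qed.

Lemma actD g f f' : act g (f + f') = act g f + act g f'.
Proof. exact: raddfD. Qed.

Lemma actB g f f' : act g (f - f') = act g f - act g f'.
Proof. exact: raddfB. Qed.

Lemma actMr g f f' : act g (f * f') = act g f * act g f'.
Proof. exact: rmorphM. Qed.

Lemma act1 g : act g 1 = 1.
Proof. exact: rmorph1. Qed.

Lemma act_sum g (I : Type) (s : seq I) (P : pred I) (F : I -> S) :
  act g (\sum_(i <- s | P i) F i) = \sum_(i <- s | P i) act g (F i).
Proof. exact: raddf_sum. Qed.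

Lemma actE g f : act g f = lsub (rG g^-1%g)^T f.
Proof. by []. Qed.

Lemma actM g h f : g \in G -> h \in G ->
  act g (act h f) = act (h * g)%g f.
Proof.
move=> Gg Gh; have [Vg Vh] : g^-1%g \in G /\ h^-1%g \in G by rewrite !groupV.
by rewrite !actE lsub_comp -trmx_mul -(repr_mxM rG Vg Vh) -invMg.
Qed.

Lemma ev_act v g f : ev v (act g f) = ev (v *m rG g^-1%g) f.
Proof. by rewrite actE ev_lsub trmxK. Qed.

Lemma dd_act v y g f :
  dd v y (act g f) = dd (v *m rG g^-1%g) (y *m rG g^-1%g) f.
Proof. by rewrite actE dd_lsub trmxK. Qed.

Lemma pihomog_act d g f : pihomog mdeg d (act g f) = act g (pihomog mdeg d f).
Proof. by rewrite !actE pihomog_lsub. Qed.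

Lemma act_homog d g f : f \is d.-homog -> act g f \is d.-homog.
Proof. by rewrite actE; exact: lsub_homog. Qed.

Definition reynolds (f : S) : S := #|G|%:R^-1 *: \sum_(g in G) act g f.

Lemma cardG_unit : (#|G|%:R : C) != 0.
Proof. by rewrite pnatr_eq0 -lt0n cardG_gt0. Qed.

Lemma card_reynolds f : #|G|%:R *: reynolds f = \sum_(g in G) act g f.
Proof. by rewrite scalerA mulfV ?scale1r // cardG_unit. Qed.

Lemma reynolds_inv f : inv (reynolds f).
Proof.
move=> h Gh; rewrite /reynolds actZ act_sum; apply: (congr1 (GRing.scale _)).
rewrite [RHS](reindex_inj (mulIg h)); apply: eq_big => g; first by rewrite groupMr.
by move=> Gg; rewrite (actM _ Gh Gg).
Qed.

Lemma reynolds_linear : linear reynolds.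
Proof.
move=> c f g; rewrite /reynolds.
under eq_bigr => h _ do rewrite actD actZ.
by rewrite big_split /= -scaler_sumr scalerDr !scalerA [c * _]mulrC.
Qed.

HB.instance Definition _ := GRing.isLinear.Build C S S _ reynolds reynolds_linear.

Lemma reynoldsM p f : inv p -> reynolds (f * p) = reynolds f * p.
Proof.
move=> ip; rewrite /reynolds -scalerAl mulr_suml; apply: (congr1 (GRing.scale _)).
by apply: eq_bigr => g Gg; rewrite actMr (ip g).
Qed.

Lemma reynolds1 : reynolds 1 = 1.
Proof.
rewrite /reynolds (eq_bigr (fun=> 1)); last by move=> g _; rewrite act1.
by rewrite sumr_const -scaler_nat scalerA mulVf ?scale1r // cardG_unit.
Qed.

Lemma inv1 : inv 1.
Proof. by move=> g Gg; rewrite act1. Qed.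

Lemma inv_id p : inv p -> reynolds p = p.
Proof. by move=> ip; rewrite -{1}[p]mul1r reynoldsM // reynolds1 mul1r. Qed.

Lemma reynolds_homog d f : f \is d.-homog -> reynolds f \is d.-homog.
Proof.
by move=> fd; rewrite /reynolds rpredZ // rpred_sum // => g _; apply: act_homog.
Qed.

Lemma invP c f g : inv f -> inv g -> inv (c *: f + g).
Proof. by move=> fi gi h Gh; rewrite actD actZ fi // gi. Qed.

Lemma invM f g : inv f -> inv g -> inv (f * g).
Proof. by move=> fi gi h Gh; rewrite actMr fi // gi. Qed.

Lemma inv_pihomog d f : inv f -> inv (pihomog mdeg d f).
Proof. by move=> fi g Gg; rewrite -pihomog_act fi. Qed.

Lemma inv_dd v y g f : g \in G -> inv f -> dd (v *m rG g) (y *m rG g) f = dd v y f.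
Proof. by move=> Gg fi; rewrite -{1}(fi g Gg) dd_act !repr_mxK. Qed.

Section Equivariant.
Variables (m : nat) (rho : mx_representation C G m).

(** A W-map from the space of [rho] to S, recorded by its values on the standard basis: a 1-form for
    [rG], a vector field for [dual_rep rG]. *)
Definition equivariant (F : 'I_m -> S) :=
  forall g, g \in G -> forall i, act g (F i) = \sum_j rho g i j *: F j.

(** The projection of arbitrary tuples onto equivariant ones, linear over the invariants; [reynolds]
    is the case of the trivial representation. *)
Definition average (F : 'I_m -> S) (i : 'I_m) : S :=
  #|G|%:R^-1 *: \sum_(g in G) \sum_j rho g^-1%g i j *: act g (F j).

Lemma card_average F i :
  #|G|%:R *: average F i = \sum_(g in G) \sum_j rho g^-1%g i j *: act g (F j).
Proof. by rewrite scalerA mulfV ?scale1r // cardG_unit. Qed.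

Lemma average_equiv F : equivariant (average F).
Proof.
move=> h Gh i; rewrite /average actZ act_sum.
under [RHS]eq_bigr => k _ do rewrite scalerA mulrC -scalerA scaler_sumr.
rewrite -scaler_sumr exchange_big; apply: (congr1 (GRing.scale _)).
rewrite [RHS](reindex_inj (mulIg h)); apply: eq_big => g; first by rewrite groupMr.
move=> Gg; under eq_bigr => k _ do rewrite scaler_sumr.
rewrite exchange_big /= act_sum; apply: eq_bigr => j _.
rewrite actZ actM // -[g in rho g^-1%g](mulgK h) invMg invgK.
rewrite repr_mxM ?groupV ?groupM // mxE scaler_suml.
by apply: eq_bigr => k _; rewrite scalerA.
Qed.

Lemma average_id F : equivariant F -> average F = F.
Proof.
move=> eF; apply/funext => i; rewrite /average.
rewrite (eq_bigr (fun=> F i)); last first.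
  move=> g Gg; under eq_bigr => j _ do rewrite eF // scaler_sumr.
  have E k : \sum_j rho g^-1%g i j * rho g j k = (i == k)%:R.
    have := repr_mxKV rho Gg (1%:M : 'M_m); rewrite mul1mx => /matrixP /(_ i k).
    by rewrite !mxE.
  rewrite exchange_big (eq_bigr (fun k => (i == k)%:R *: F k)) /=; last first.
    move=> k _; rewrite -E scaler_suml; apply: eq_bigr => j _.
    by rewrite scalerA.
  rewrite (bigD1 i) //= eqxx scale1r big1 ?addr0 // => k ki.
  by rewrite eq_sym (negPf ki) scale0r.
by rewrite sumr_const -scaler_nat scalerA mulVf ?scale1r // cardG_unit.
Qed.

Lemma averageD F F' : average (fun i => F i + F' i) = fun i => average F i + average F' i.
Proof.
apply/funext => i; rewrite /average -scalerDr -big_split; apply: (congr1 (GRing.scale _)).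
apply: eq_bigr => g _ /=; rewrite -big_split; apply: eq_bigr => j _ /=.
by rewrite actD scalerDr.
Qed.

Lemma averageM p F : inv p -> average (fun i => F i * p) = fun i => average F i * p.
Proof.
move=> ip; apply/funext => i; rewrite /average -scalerAl mulr_suml.
apply: (congr1 (GRing.scale _)).
apply: eq_bigr => g Gg; rewrite mulr_suml; apply: eq_bigr => j _.
by rewrite actMr ip // scalerAl.
Qed.

Lemma average_homog d F : (forall i, F i \is d.-homog) ->
  forall i, average F i \is d.-homog.
Proof.
move=> Fd i; rewrite /average rpredZ // rpred_sum // => g _; rewrite rpred_sum // => j _.
by rewrite rpredZ // act_homog.
Qed.

End Equivariant.
End Action.

Lemma mcoeff0_ev (K : comNzRingType) n (f : {mpoly K[n]}) : f@_0%MM = ev 0 f.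
Proof.
elim/mpoly_ind_linX: f => [|c f g fE gE|i f _].
- by rewrite !rmorph1.
- by rewrite linearP rmorphD /= evZ fE gE.
by rewrite !rmorphM /= evX mxE mul0r mcoeffX mnm1_eq0 mul0r.
Qed.

Lemma mcoeff0_lsub (K : comNzRingType) n m (A : 'M[K]_(n, m)) (f : {mpoly K[n]}) :
  (lsub A f)@_0%MM = f@_0%MM.
Proof. by rewrite !mcoeff0_ev ev_lsub mul0mx. Qed.

Lemma pairing_pihomog (K : comNzRingType) n d (q f : {mpoly K[n]}) :
  pairing q (pihomog mdeg d f) = pairing (pihomog mdeg d q) f.
Proof.
have XX m m' : pairing 'X_[m] ('X_[m'] : {mpoly K[n]}) = 0 \/ m = m'.
  rewrite pairingX mcoeffX; case: eqVneq => [->|_]; [by right|left].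
  by rewrite mul0rn.
elim/mpolyind: q => [|c m q _ _ qE].
  by rewrite linear0 !pairing0l.
rewrite linearP /= !pairing_linear_l qE; congr (_ * _ + _); clear qE.
rewrite pihomogX; elim/mpolyind: f => [|a m' f _ _ fE].
  by rewrite !linear0.
rewrite linearP /= !pairing_linear_r fE; congr (_ * _ + _).
rewrite pihomogX; have [] := XX m m'.
  case: ifP => _ E; case: ifP => _; rewrite ?E ?linear0 //.
    by rewrite pairing0l.
  by rewrite pairing0l.
move=> <-; case: ifP => _; rewrite ?linear0 //.
by rewrite pairing0l.
Qed.

(** * Harmonic polynomials *)

Section Harmonic.
Variables (C : numClosedFieldType) (gT : finGroupType) (G : {group gT}) (n : nat).
Variable rG : mx_representation C G n.
Local Notation S := {mpoly C[n]}.
Local Notation inv := (inv rG).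

Definition invSymV (q : S) : Prop := forall g, g \in G -> lsub (rG g) q = q.

Definition harm (f : S) : Prop :=
  forall q, invSymV q -> q@_0%MM = 0 -> dop q f = 0.

Lemma dop0_pairing (f : S) : (forall m, pairing 'X_[m] f = 0) -> f = 0.
Proof.
move=> f0; apply/mpolyP => m; have /eqP := f0 m.
rewrite pairingX mulrn_eq0 => /orP[|/eqP -> //]; last by rewrite mcoeff0.
by rewrite -leqn0 leqNgt prodn_gt0 // => i; rewrite fact_gt0.
Qed.

(** A polynomial all of whose derivatives vanish at 0 is 0, so harmonicity is orthogonality, for the
    pairing, to the ideal of Sym(V) generated by the invariants without constant term. *)
Lemma harmonicP (f : S) : harm f <->
  forall r q, invSymV q -> q@_0%MM = 0 -> pairing (r * q) f = 0.
Proof.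
split=> [hf r q qi q0|hf q qi q0].
  by rewrite pairingM (_ : dop q f = 0) ?linear0 //; apply: hf.
by apply: dop0_pairing => m; rewrite -pairingM; apply: hf.
Qed.

Lemma harmonic_lin c f g : harm f -> harm g -> harm (c *: f + g).
Proof.
move=> /harmonicP hf /harmonicP hg; apply/harmonicP => r q qi q0.
by rewrite linearP /= hf // hg // mulr0 addr0.
Qed.

Lemma harmonic0 : harm 0.
Proof. by apply/harmonicP => r q _ _; rewrite linear0. Qed.

Lemma harmonicZ c f : harm f -> harm (c *: f).
Proof. by move=> hf; rewrite -[_ *: _]addr0; apply: harmonic_lin => //; apply: harmonic0. Qed.

Lemma harmonic_sum (I : Type) (s : seq I) (P : pred I) (F : I -> S) :
  (forall i, P i -> harm (F i)) -> harm (\sum_(i <- s | P i) F i).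
Proof.
move=> hF; elim/big_rec: _ => [|i x Pi hx]; first exact: harmonic0.
by rewrite -[F i]scale1r; apply: harmonic_lin => //; apply: hF.
Qed.

Lemma harmonic_act g f : g \in G -> harm f -> harm (act rG g f).
Proof.
move=> Gg /harmonicP hf; apply/harmonicP => r q qi q0.
rewrite actE -pairing_lsub rmorphM; apply: hf => /=; last by rewrite mcoeff0_lsub.
by rewrite qi ?groupV.
Qed.

(** The homogeneous components of an invariant operator without constant term are again such
    operators. *)
Lemma harmonic_pihomog d f : harm f -> harm (pihomog mdeg d f).
Proof.
move=> /harmonicP hf; apply/harmonicP => r q qi q0.
elim/mpolyind: r => [|c m r _ _ rE].
  by rewrite mul0r pairing0l.
rewrite mulrDl -scalerAl pairing_linear_l rE addr0 pairing_pihomog.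
have Xm : ('X_[m] : S) \is (mdeg m).-homog by rewrite dhomogX.
have [dm|dm] := ltnP d (mdeg m).
  by rewrite (pihomogM_lt _ Xm) // pairing0l mulr0.
rewrite -(subnKC dm) (pihomogM _ _ Xm) hf ?mulr0 //.
  by move=> g Gg; rewrite -pihomog_lsub qi.
rewrite /= pihomogE raddf_sum big1 // => m' _.
rewrite /= mcoeffZ mcoeffX; case: eqP => [->|_]; first by rewrite q0 mul0r.
by rewrite mulr0.
Qed.

Local Notation "A ^*t" := (map_mx Num.conj A)^T (at level 2, format "A ^*t").

Lemma ctM p q r (A : 'M[C]_(p, q)) (B : 'M_(q, r)) : (A *m B)^*t = B^*t *m A^*t.
Proof. by rewrite map_mxM trmx_mul. Qed.

(** The standard hermitian form on column vectors, that is on V^*, summed over W; [gram_inv]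
    expresses its invariance. *)
Definition gram : 'M[C]_n := \sum_(g in G) (rG g)^*t *m rG g.

(** K stacks all the matrices [rG g]; its block at the neutral element is the identity, which
    provides the left inverse B. This is the form in which the definiteness of [gram] is used. *)
Lemma gram_factor : exists N (K : 'M[C]_(N, n)) (B : 'M_(n, N)),
  gram = K^*t *m K /\ B *m K = 1%:M.
Proof.
have fact (s : seq gT) : exists N (K : 'M[C]_(N, n)),
    \sum_(g <- s) (rG g)^*t *m rG g = K^*t *m K.
  elim: s => [|g s [N [K KE]]].
    by exists 0, 0; rewrite big_nil mulmx0.
  exists (n + N), (col_mx (rG g) K); rewrite big_cons KE.
  by rewrite map_col_mx tr_col_mx mul_row_col.
have [N [K KE]] := fact [seq g <- enum G | g != 1%g].
exists (n + N), (col_mx 1%:M K), (row_mx 1%:M 0).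
rewrite mul_row_col mul1mx mul0mx addr0; split=> //.
rewrite map_col_mx tr_col_mx mul_row_col map_mx1 trmx1 mulmx1 -KE.
rewrite big_filter big_enum_cond /= /gram (bigD1 1%g) //=; congr (_ + _).
by rewrite repr_mx1 map_mx1 trmx1 mulmx1.
Qed.

Lemma gram_unit : gram \in unitmx.
Proof.
have [N [K [B [gE BK]]]] := gram_factor.
rewrite -row_free_unit; apply: inj_row_free => v vg.
pose w := v *m K^*t.
have w0 : w *m w^*t = 0.
  rewrite ctM [X in w *m (X *m _)](_ : _ = K); last first.
    by apply/matrixP => i j; rewrite !mxE conjCK.
  by rewrite mulmxA /w -(mulmxA v) -gE vg mul0mx.
have w00 : w = 0.
  apply/rowP => j; have := congr1 (fun A : 'M_1 => A 0 0) w0.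
  rewrite !mxE => /eqP; rewrite psumr_eq0; last first.
    by move=> k _; rewrite !mxE mul_conjC_ge0.
  move=> /allP /(_ j); rewrite mem_index_enum => /(_ isT).
  by rewrite !mxE mul_conjC_eq0 => /eqP.
rewrite -[v]mulmx1 -[1%:M](_ : K^*t *m B^*t = _); last first.
  by rewrite -ctM BK map_mx1 trmx1.
by rewrite mulmxA -/w w00 mul0mx.
Qed.

Lemma gram_inv g : g \in G -> gram *m rG g = (rG g^-1%g)^*t *m gram.
Proof.
move=> Gg; rewrite /gram mulmx_suml mulmx_sumr [RHS](reindex_inj (mulIg g)) /=.
apply: eq_big => h; first by rewrite groupMr.
move=> Gh; rewrite !mulmxA -ctM -repr_mxM ?groupM ?groupV // mulgK -mulmxA.
by rewrite -repr_mxM.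
Qed.

(* The antilinear ring isomorphism S -> Sym(V) given by the invariant hermitian form [gram]. *)
Definition toSymV (f : S) : S := lsub gram (mconj f).

HB.instance Definition _ := GRing.RMorphism.copy toSymV (lsub gram \o @mconj C n).

Lemma toSymVZ c f : toSymV (c *: f) = c^* *: toSymV f.
Proof. by rewrite /toSymV mconjZ linearZ. Qed.

Lemma mconj_act g f : mconj (act rG g f) = lsub (rG g^-1%g)^*t (mconj f).
Proof. by rewrite actE mconj_lsub map_trmx. Qed.

Lemma toSymV_inv f : inv f -> invSymV (toSymV f).
Proof.
move=> fi g Gg.
have fE : lsub (rG g^-1%g)^*t (mconj f) = mconj f by rewrite -mconj_act fi.
by rewrite /toSymV lsub_comp (gram_inv Gg) -[RHS](congr1 _ fE) lsub_comp.
Qed.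

Lemma mcoeff0_toSymV f : (toSymV f)@_0%MM = (f@_0%MM)^*.
Proof. by rewrite mcoeff0_lsub mcoeff_map_mpoly. Qed.

Definition ofSymV (q : S) : S := mconj (lsub (invmx gram) q).

Lemma ofSymVK q : toSymV (ofSymV q) = q.
Proof.
by rewrite /toSymV /ofSymV mconjK lsub_comp mulVmx ?gram_unit // lsub1.
Qed.

Lemma ofSymV_inv q : invSymV q -> inv (ofSymV q).
Proof.
move=> qi g Gg; apply: (can_inj (@mconjK C n)).
rewrite mconj_act /ofSymV mconjK -{2}(qi g Gg) !lsub_comp.
congr (lsub _ q); apply: (can_inj (mulKmx gram_unit)).
rewrite !mulmxA mulmxV ?gram_unit // mul1mx gram_inv //.
by rewrite -mulmxA mulmxV ?gram_unit // mulmx1.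
Qed.

(** Since [toSymV] carries the coinvariant ideal onto the ideal of Sym(V) that defines harmonicity,
    H is the orthogonal complement of the coinvariant ideal for this form. *)
Definition hform (f g : S) : C := pairing (toSymV f) g.

Lemma hformD x y z : hform (x + y) z = hform x z + hform y z.
Proof. by rewrite /hform rmorphD -/(pairingl z _) linearD. Qed.

Lemma hformZ c x z : hform (c *: x) z = c^* * hform x z.
Proof. by rewrite /hform toSymVZ -/(pairingl z _) linearZ. Qed.

Lemma hform_linear x : scalar (hform x).
Proof. exact: pairing_linear_r. Qed.

(** With [gram] factored as [K^*t *m K], the form becomes [pairing (mconj y) y] for y =
    [lsub K^T x], and B recovers x from y. *)
Lemma hform_eq0 x : hform x x = 0 -> x = 0.
Proof.
have [N [K [B [gE BK]]]] := gram_factor.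
rewrite /hform /toSymV gE -lsub_comp pairing_lsub.
have -> : lsub K^*t (mconj x) = mconj (lsub K^T x) by rewrite mconj_lsub map_trmx.
move/pairing_mconj_eq0 => x0.
by rewrite -[x]lsub1 -trmx1 -BK trmx_mul -lsub_comp x0 linear0.
Qed.

Lemma orth_harmonic h :
  (forall a p, inv p -> p@_0%MM = 0 -> hform (a * p) h = 0) -> harm h.
Proof.
move=> hh; apply/harmonicP => r q qi q0.
rewrite -[r]ofSymVK -[q]ofSymVK -rmorphM; apply: hh; first exact: ofSymV_inv.
rewrite mcoeff_map_mpoly mcoeff0_lsub q0. exact: rmorph0.
Qed.

Lemma harmonic_orth h a p : harm h -> inv p -> p@_0%MM = 0 ->
  hform (a * p) h = 0.
Proof.
move=> /harmonicP hh pi p0; rewrite /hform rmorphM; apply: hh.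
  exact: toSymV_inv.
by rewrite mcoeff0_toSymV p0 rmorph0.
Qed.

Lemma harmonic_inv_ideal f : harm f -> (exists s : seq (S * S),
    (forall x, x \in s -> inv x.2 /\ x.2@_0%MM = 0) /\
    f = \sum_(x <- s) x.1 * x.2) -> f = 0.
Proof.
move=> hf [s [sP fE]]; apply: hform_eq0; rewrite {1}fE.
rewrite /hform rmorph_sum -/(pairingl f _) linear_sum big_seq big1 // => x /sP[xi x0].
exact: harmonic_orth.
Qed.

Lemma hform_homog d e x y : x \is d.-homog -> y \is e.-homog -> d != e ->
  hform x y = 0.
Proof.
move=> xd ye de; rewrite /hform -(pihomog_dE ye) pairing_pihomog pihomog_lsub.
have -> : pihomog mdeg e (mconj x) = 0.
  apply/mpolyP => m; rewrite pihomogE raddf_sum mcoeff0 big1 // => m' /eqP m'e.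
  rewrite /= mcoeffZ mcoeff_map_mpoly (dhomog_nemf_coeff xd) ?raddf0 ?mul0r //.
  by rewrite /= m'e eq_sym.
by rewrite linear0 pairing0l.
Qed.

(* The products [mixed t], t in [mixed_index e], span the degree e part of the coinvariant ideal;
   being finitely many, they can be projected upon. *)
Definition mixed_index e : seq ('X_{1..n} * 'X_{1..n}) :=
  [seq t <- [seq (val x, val y) | x <- enum {: 'X_{1..n < e.+1}},
                                  y <- enum {: 'X_{1..n < e.+1}}]
    | (mdeg t.1 + mdeg t.2 == e)%N && (t.2 != 0%MM)].

Lemma mixed_indexP e t : t \in mixed_index e = (mdeg t.1 + mdeg t.2 == e)%N && (t.2 != 0%MM).
Proof.
rewrite mem_filter andb_idr //; case: t => t1 t2 /= /andP[/eqP te _].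
have lt1 : (mdeg t1 < e.+1)%N by rewrite ltnS -te leq_addr.
have lt2 : (mdeg t2 < e.+1)%N by rewrite ltnS -te leq_addl.
by apply/allpairsP; exists (BMultinom lt1, BMultinom lt2); rewrite !mem_enum.
Qed.

Definition mixed (t : 'X_{1..n} * 'X_{1..n}) : S := 'X_[t.1] * reynolds rG 'X_[t.2].

Lemma mixed_homog t : mixed t \is (mdeg t.1 + mdeg t.2).-homog.
Proof. by apply: dhomogM; [|apply: reynolds_homog]; rewrite dhomogX. Qed.

(** The remainder of the projection is orthogonal to the products [mixed t] of degree e by
    construction, and to the others by degree. An invariant without constant term is its own image
    under [reynolds], so these products span the coinvariant ideal. *)
Lemma harmonic_decomposition e f : f \is e.-homog -> exists c,
  harm (f - \sum_(t <- mixed_index e) c t *: mixed t).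
Proof.
move=> fe; have Us : uniq (mixed_index e).
  rewrite filter_uniq // allpairs_uniq ?enum_uniq // => -[a b] [c d'] _ _ /= [ac bd].
  by congr (_, _); apply: val_inj.
have [c cP] := @orthogonal_projection C S _ mixed hform (@Num.conj C)
  hformD hformZ hform_linear hform_eq0 _ Us f.
exists c; set h := f - _ in cP *.
have he : h \is e.-homog.
  rewrite rpredB // big_seq rpred_sum // => t; rewrite mixed_indexP => /andP[/eqP <- _].
  by rewrite rpredZ // mixed_homog.
have orth t : t.2 != 0%MM -> hform (mixed t) h = 0.
  move=> t2; have [te|te] := eqVneq (mdeg t.1 + mdeg t.2)%N e.
    by apply: cP; rewrite mixed_indexP te eqxx.
  exact: hform_homog (mixed_homog t) he te.
have h0 : hform 0 h = 0 by rewrite -(scale0r 0) hformZ rmorph0 mul0r.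
have hsum (I : Type) (s : seq I) (F : I -> S) :
    (forall i, hform (F i) h = 0) -> hform (\sum_(i <- s) F i) h = 0.
  by move=> Fh; elim/big_rec: _ => [|i x _ xh]; [exact: h0|rewrite hformD Fh xh addr0].
apply: orth_harmonic => a p pi p0; rewrite -(inv_id pi) [a]mpolyE [p]mpolyE.
rewrite linear_sum mulr_sumr; apply/hsum => m'; rewrite mulr_suml; apply/hsum => m.
rewrite linearZ /= -scalerAl -scalerAr !hformZ.
have [->|m'0] := eqVneq m' 0%MM; first by rewrite p0 rmorph0 mul0r mulr0.
by have /= := orth (m, m') m'0; rewrite /mixed /= => ->; rewrite !mulr0.
Qed.

Lemma average_harm m (rho : mx_representation C G m) F :
  (forall i, harm (F i)) -> forall i, harm (average rG rho F i).
Proof.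
move=> hF i; apply: harmonicZ; apply: harmonic_sum => g Gg.
by apply: harmonic_sum => j _; apply/harmonicZ/harmonic_act.
Qed.

End Harmonic.

(* Left transparent, these sums over G get unfolded during unification. *)
Local Opaque reynolds average.

(** * Bump polynomials and the Jacobian criterion *)

Section Polynomials.
Variable K : fieldType.

Lemma interpolation n (v : 'rV[K]_n) (ws : seq 'rV[K]_n) : v \notin ws ->
  exists h : {mpoly K[n]}, ev v h = 1 /\ forall w, w \in ws -> ev w h = 0.
Proof.
elim: ws => [|w ws IHws] /=; first by exists 1; rewrite rmorph1.
rewrite in_cons negb_or => /andP[vw /IHws [h [hv hws]]].
have [i vwi] : exists i, v 0 i != w 0 i.
  apply/existsP; apply: contraR vw => /existsPn vw; apply/eqP/rowP => i.
  exact/eqP/negPn/vw.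
exists (h * ((v 0 i - w 0 i)^-1 *: ('X_i - (w 0 i)%:MP))); split=> [|x].
  by rewrite rmorphM /= hv evZ rmorphB /= evX evC mul1r mulVf ?subr_eq0.
rewrite in_cons rmorphM /= evZ rmorphB /= evX evC.
by case/orP=> [/eqP ->|/hws ->]; rewrite ?mul0r // subrr !mulr0.
Qed.

(** Induction on the size of a relation q. By the chain rule the partial derivatives of q, taken at
    t, form a row killed by the Jacobian matrix, hence zero; they are thus smaller relations, so
    they vanish, and q is a constant. *)
Lemma jacobian_criterion n (t : n.-tuple {mpoly K[n]}) (v : 'rV[K]_n) :
    [pchar K] =i pred0 ->
    \det (\matrix_(k, i) ev v (tnth t k)^`M(i)) != 0 ->
  forall q : {mpoly K[n]}, q \mPo t = 0 -> q = 0.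
Proof.
move=> ch0 detv q; have [N] := ubnP (msize q); elim: N q => // N IHN q qN qt0.
have [//|qnz] := eqVneq q 0.
pose J : 'M[{mpoly K[n]}]_n := \matrix_(k, i) (tnth t k)^`M(i).
have detJ : \det J != 0.
  apply: contraNneq detv => J0; have := congr1 (ev v) J0.
  rewrite rmorph0 -det_map_mx => E; rewrite -[X in _ == X]E; apply/eqP.
  by congr (\det _); apply/matrixP => k i; rewrite !mxE.
pose u := \row_k (q^`M(k) \mPo t).
have uJ : u *m J = 0.
  apply/rowP => i; rewrite !mxE; have := mderiv_comp t q i.
  rewrite qt0 mderiv0 => E; rewrite [RHS]E; apply: eq_bigr => k _.
  by rewrite !mxE.
have u0 : u = 0.
  have : u *m J *m \adj J = 0 by rewrite uJ mul0mx.
  rewrite -mulmxA mul_mx_adj mul_mx_scalar => /matrixP E; apply/rowP => k.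
  have := E 0 k; rewrite !mxE => /eqP; rewrite mulf_eq0 (negPf detJ) /=.
  by move/eqP.
have q0 k : q^`M(k) = 0.
  apply: IHN; last by have /rowP /(_ k) := u0; rewrite !mxE.
  have [->|nz] := eqVneq q^`M(k) 0; last first.
    rewrite -(mlead_deg nz); rewrite ltnS in qN; apply: leq_trans qN.
    have : (mlead q^`M(k) + U_(k))%MM \in msupp q.
      rewrite mcoeff_msupp; apply: contraTneq (mlead_supp nz) => E.
      by rewrite mcoeff_msupp mcoeff_deriv E mul0rn eqxx.
    by move/msize_mdeg_lt; rewrite mdegD mdeg1 addn1.
  by rewrite mmeasure0 -ltnS (leq_trans _ qN) // ltnS lt0n msize_poly_eq0.
have qC : q = (q@_0%MM)%:MP.
  apply/mpolyP => m; rewrite mcoeffC; have [->|m0] := eqVneq m 0%MM; first by rewrite mulr1.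
  have [k mk] : exists k, m k != 0%N.
    apply/existsP; apply: contraR m0 => /existsPn mi; apply/eqP/mnmP => i.
    by rewrite mnm0E; apply/eqP/negPn/mi.
  have := congr1 (fun p => p@_(m - U_(k))%MM) (q0 k).
  rewrite mcoeff_deriv submK ?lep1mP // mcoeff0 mulr0 => /eqP.
  by rewrite -mulr_natr mulf_eq0 (iffLR (pcharf0P K) ch0) orbF => /eqP.
by move: qt0; rewrite qC comp_mpolyC => /eqP; rewrite mpolyC_eq0 => /eqP ->.
Qed.

End Polynomials.

(** * Invariants and equivariant maps generated by the harmonic ones *)

Section Spanning.
Variables (C : numClosedFieldType) (gT : finGroupType) (G : {group gT}) (n : nat).
Variable rG : mx_representation C G n.
Local Notation S := {mpoly C[n]}.
Local Notation inv := (inv rG).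
Local Notation harm := (harm rG).

Section Rep.
Variables (m : nat) (rho : mx_representation C G m).
Local Notation equivariant := (equivariant rG rho).
Local Notation avg := (average rG rho).

(* Equivariant maps are spanned over the invariants by the harmonic ones. *)
Lemma equivariant_ind (P : nat -> ('I_m -> S) -> Prop) :
    (forall e F F', P e F -> P e F' -> P e (fun i => F i + F' i)) ->
    (forall d e c h, inv c -> c \is d.-homog -> equivariant h ->
      (forall i, harm (h i)) -> (forall i, h i \is e.-homog) ->
      P (e + d)%N (fun i => h i * c)) ->
  forall e F, equivariant F -> (forall i, F i \is e.-homog) -> P e F.
Proof.
(* An invariant factor p is carried along: in the induction on e, the invariants split off from F
   are moved into p. *)
move=> PD PM; suff H e F k p : equivariant F -> (forall i, F i \is e.-homog) ->
    inv p -> p \is k.-homog -> P (e + k)%N (fun i => F i * p).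
  move=> e F eF Fe; have := H e F 0%N 1 eF Fe (@inv1 _ _ _ _ _) (dhomog1 _ _).
  by rewrite addn0 (_ : (fun i => F i * 1) = F) //; apply/funext => i; rewrite mulr1.
have [N] := ubnP e; elim: N e F k p => // N IHN e F k p eN eF Fe ip pk.
have [c cP] : exists c : 'I_m -> _ -> C, forall i,
    harm (F i - \sum_(t <- mixed_index n e) c i t *: mixed rG t).
  have [c cP] := choice (fun i => harmonic_decomposition rG (Fe i)).
  by exists c.
pose h i := F i - \sum_(t <- mixed_index n e) c i t *: mixed rG t.
pose A t i := c i t *: ('X_[t.1] : S).
have he i : h i \is e.-homog.
  rewrite rpredB // big_seq rpred_sum // => t; rewrite mixed_indexP => /andP[/eqP <- _].
  by rewrite rpredZ // mixed_homog.
(* F is its own average and averaging is linear over the invariants: the term of t becomes an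
   equivariant map of degree e - [mdeg t.2] < e times an invariant, and h becomes equivariant while
   remaining harmonic. *)
have FE : F = avg (fun i => h i + \sum_(t <- mixed_index n e) A t i * reynolds rG 'X_[t.2]).
  rewrite -{1}(average_id eF); congr (avg _); apply/funext => i.
  rewrite /h -addrA [X in _ + X]addrC -sumrB big1 ?addr0 // => t _.
  by rewrite /A -scalerAl subrr.
rewrite FE; have : all (fun t => t \in mixed_index n e) (mixed_index n e) by apply/allP.
elim: {2 3}(mixed_index n e) => [|t s IHs] /=.
  move=> _; apply: PM => //.
  - exact: average_equiv.
  - by move=> i; apply: average_harm => j; rewrite big_nil addr0; apply: cP.
  by move=> i; apply: average_homog => j; rewrite big_nil addr0.
case/andP; rewrite mixed_indexP => /andP[/eqP te t2] /IHs Ps.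
set F' := fun i => h i + \sum_(t <- s) A t i * reynolds rG 'X_[t.2].
have -> : (fun i => h i + \sum_(t <- t :: s) A t i * reynolds rG 'X_[t.2])
   = fun i => A t i * reynolds rG 'X_[t.2] + F' i.
  by apply/funext => i; rewrite /F' big_cons addrCA.
rewrite averageD averageM; last exact: reynolds_inv.
have -> : (fun i => (avg (A t) i * reynolds rG 'X_[t.2] + avg F' i) * p)
   = fun i => avg (A t) i * (reynolds rG 'X_[t.2] * p) + avg F' i * p.
  by apply/funext => i; rewrite mulrDl -[in LHS]mulrA.
apply: PD => //; rewrite -te -addnA; apply: IHN.
- rewrite ltnS in eN; apply: leq_trans eN; rewrite -te -[X in (X < _)%N]addn0.
  by rewrite ltn_add2l lt0n mdeg_eq0.
- exact: average_equiv.
- by apply: average_homog => i; rewrite rpredZ // dhomogX.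
- by apply: invM => //; apply: reynolds_inv.
by apply: dhomogM => //; apply: reynolds_homog; rewrite dhomogX.
Qed.

End Rep.
End Spanning.

Section Invariants.
Variables (C : numClosedFieldType) (gT : finGroupType) (G : {group gT}) (n : nat).
Variable rG : mx_representation C G n.
Local Notation S := {mpoly C[n]}.
Local Notation inv := (inv rG).
Local Notation harm := (harm rG).
Local Notation act := (act rG).

Fact dual_mx_repr : mx_repr G (fun g => (rG g^-1%g)^T).
Proof.
split=> [|g h Gg Gh]; first by rewrite invg1 repr_mx1 trmx1.
have [Vg Vh] : g^-1%g \in G /\ h^-1%g \in G by rewrite !groupV.
by rewrite invMg (repr_mxM rG Vh Vg) trmx_mul.
Qed.

Definition dual_rep := MxRepresentation dual_mx_repr.

Lemma actX g i : act g 'X_i = \sum_j dual_rep g i j *: 'X_j.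
Proof. exact: lsubX. Qed.

Lemma contraction_inv (s p : 'I_n -> S) :
  equivariant rG rG s -> equivariant rG dual_rep p -> inv (\sum_i s i * p i).
Proof.
move=> es ep g Gg; rewrite act_sum.
have E j k : \sum_i rG g i j * dual_rep g i k = (k == j)%:R.
  have /matrixP /(_ k j) := repr_mxKV rG Gg (1%:M : 'M_n).
  rewrite mul1mx !mxE => <-; apply: eq_bigr => i _.
  by rewrite mxE mulrC.
have -> : \sum_i act g (s i * p i) =
    \sum_i \sum_j \sum_k (rG g i j * dual_rep g i k) *: (s j * p k).
  apply: eq_bigr => i _; rewrite actMr es // ep // mulr_suml.
  apply: eq_bigr => j _; rewrite mulr_sumr; apply: eq_bigr => k _.
  by rewrite -scalerAl -scalerAr scalerA.
rewrite exchange_big; apply: eq_bigr => j _ /=.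
rewrite exchange_big (bigD1 j) //= [X in _ + X]big1 ?addr0.
  by rewrite -scaler_suml E eqxx scale1r.
by move=> k kj; rewrite -scaler_suml E (negPf kj) scale0r.
Qed.

Definition contractX (s : 'I_n -> S) : S := \sum_i s i * 'X_i.

Lemma contractX_inv s : equivariant rG rG s -> inv (contractX s).
Proof. by move=> es; apply: contraction_inv => // g _ i; apply: actX. Qed.

Lemma gradient_equiv f : inv f -> equivariant rG rG (fun i => f^`M(i)).
Proof.
move=> fi g Gg l; apply/esym.
have E k : \sum_i rG g l i * (rG g^-1%g) i k = (l == k)%:R.
  have /matrixP /(_ l k) := repr_mxK rG Gg (1%:M : 'M_n).
  by rewrite mul1mx !mxE.
have -> : \sum_i rG g l i *: f^`M(i) =
    \sum_i \sum_k (rG g l i * (rG g^-1%g) i k) *: act g f^`M(k).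
  apply: eq_bigr => i _; rewrite -{1}(fi g Gg) actE mderiv_lsub scaler_sumr.
  by apply: eq_bigr => k _; rewrite scalerA mxE.
rewrite exchange_big (bigD1 l) //= [X in _ + X]big1 ?addr0.
  by rewrite -scaler_suml E eqxx scale1r.
by move=> k kl; rewrite -scaler_suml E eq_sym (negPf kl) scale0r.
Qed.

Lemma free_orbit_bump v : (forall g, g \in G -> v *m rG g = v -> g = 1%g) ->
  exists h : S, ev v h = 1 /\
    forall g, g \in G -> g != 1%g -> ev (v *m rG g^-1%g) h = 0.
Proof.
move=> fv; pose ws := [seq v *m rG g^-1%g | g <- enum [set g in G | g != 1%g]].
have [|h [hv hws]] := @interpolation _ _ v ws.
  apply/negP => /mapP[g]; rewrite mem_enum inE => /andP[Gg g1] vE.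
  move: g1; rewrite -(inj_eq invg_inj) invg1 => /eqP; apply; apply: fv => //.
  by rewrite groupV.
exists h; split=> // g Gg g1; apply: hws; apply/mapP; exists g => //.
by rewrite mem_enum inE Gg.
Qed.

Lemma inv_differential v (l : 'I_n -> C) :
    (forall g, g \in G -> v *m rG g = v -> g = 1%g) ->
  exists2 f, inv f & forall y, dd v y f = \sum_i y 0 i * l i.
Proof.
move=> /free_orbit_bump[h [hv h0]].
(* The square of h makes F vanish to second order at the other points of the orbit of v, so that in
   the sum over W only the neutral element contributes to the derivative at v. *)
pose L := \sum_i l i *: ('X_i : S); pose F := h * h * (L - (ev v L)%:MP).
exists (#|G|%:R *: reynolds rG F).
  by move=> g Gg; rewrite actZ reynolds_inv.
move=> y; rewrite card_reynolds linear_sum (bigD1 1%g) //= [X in _ + X]big1 ?addr0.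
  rewrite dd_act invg1 repr_mx1 !mulmx1 ddM rmorphB /= evC subrr mulr0 add0r.
  rewrite rmorphM /= hv !mul1r linearB /= -[_%:MP]alg_mpolyC linearZ /= dd1.
  rewrite mulr0 subr0 linear_sum; apply: eq_bigr => i _.
  by rewrite linearZ /= ddX mulrC.
move=> g /andP[Gg g1]; rewrite dd_act ddM rmorphM /= h0 // ddM.
by rewrite h0 // !(mulr0, mul0r, addr0).
Qed.

Lemma equivariant_value m (rho : mx_representation C G m) v (u : 'I_m -> C) :
    (forall g, g \in G -> v *m rG g = v -> g = 1%g) ->
  exists2 F, equivariant rG rho F & forall i, ev v (F i) = u i.
Proof.
move=> /free_orbit_bump[h [hv h0]].
exists (fun i => #|G|%:R *: average rG rho (fun j => u j *: h) i).
  move=> g Gg i; rewrite actZ average_equiv // scaler_sumr.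
  by apply: eq_bigr => j _; rewrite scalerA mulrC -scalerA.
move=> i; rewrite card_average rmorph_sum (bigD1 1%g) //=.
rewrite [X in _ + X]big1 ?addr0.
  rewrite invg1 rmorph_sum (bigD1 i) //= big1 ?addr0.
    by rewrite evZ ev_act evZ invg1 !repr_mx1 mulmx1 mxE eqxx hv mul1r mulr1.
  by move=> j ji; rewrite repr_mx1 mxE eq_sym (negPf ji) scale0r rmorph0.
move=> g /andP[Gg g1]; rewrite rmorph_sum big1 // => j _ /=.
by rewrite evZ ev_act evZ h0 // !mulr0.
Qed.

(** For g other than 1, some column of [rG g - 1%:M] is nonzero; read along the moment curve [v t]
    it is a nonzero polynomial in t, which has t as a root as soon as g fixes [v t]. Some t is a
    root of none of these polynomials. *)
Lemma generic_point : mx_faithful rG ->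
  exists v : 'rV[C]_n, forall g, g \in G -> v *m rG g = v -> g = 1%g.
Proof.
move=> faith; pose v t := \row_(i < n) (t ^+ i : C).
have H g : exists p : {poly C}, g \in G -> g != 1%g ->
    p != 0 /\ forall t, v t *m rG g = v t -> root p t.
  have [Gg|] := boolP (g \in G); last by exists 0.
  have [->|g1] := eqVneq g 1%g; first by exists 0.
  have : rG g - 1%:M != 0.
    apply: contra g1; rewrite subr_eq0 => /eqP g1; have : g \in rker rG.
      by apply/rkerP.
    by rewrite (trivgP faith) inE.
  move=> Dg; have [[i j] Dij] : exists ij, (rG g - 1%:M) ij.1 ij.2 != 0.
    apply/existsP; apply: contraR Dg => /existsPn D0; apply/eqP/matrixP => i j.
    by have /eqP := negbNE (D0 (i, j)) => ->; rewrite mxE.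
  exists (rVpoly (row j (rG g - 1%:M)^T)) => _ _; split.
    apply: contraNneq Dij => p0; have := coef_rVpoly_ord (row j (rG g - 1%:M)^T) i.
    by rewrite p0 coef0 mxE [RHS]mxE => <-.
  move=> t vt; rewrite /root (horner_coef_wide _ (size_poly _ _)).
  have : v t *m (rG g - 1%:M) = 0 by rewrite mulmxBr mulmx1 vt subrr.
  move/rowP/(_ j); rewrite mxE [RHS]mxE => E; apply/eqP; rewrite -[RHS]E.
  apply: eq_bigr => k _; rewrite coef_rVpoly_ord mulrC [v t]lock !mxE -lock.
  by rewrite [v t _ _]mxE.
have [p pP] := choice H.
have : \prod_(g in G | g != 1%g) p g != 0.
  by apply/prodf_neq0 => g /andP[Gg g1]; have [] := pP g Gg g1.
case/closed_nonrootP => t nt; exists (v t) => g Gg vg.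
apply/eqP; apply: contraNT nt => g1; rewrite /root horner_prod.
rewrite (bigD1 g) ?Gg //= mulf_eq0; apply/orP; left.
by have [_] := pP g Gg g1; apply.
Qed.

Section Basis.
Variable be : 'I_n -> 'I_n -> S.
Hypothesis be_equiv : forall k, equivariant rG rG (be k).
Hypothesis be_span : forall h, equivariant rG rG h -> (forall i, harm (h i)) ->
  exists t : 'I_n -> C, forall i, h i = \sum_k t k *: be k i.

Definition basic_invariants := [tuple contractX (be k) | k < n].

Lemma contractX_sum (t : 'I_n -> C) h : (forall i, h i = \sum_k t k *: be k i) ->
  contractX h = \sum_k t k *: contractX (be k).
Proof.
move=> hE; rewrite /contractX; under eq_bigr => i _ do rewrite hE mulr_suml.
rewrite exchange_big; apply: eq_bigr => k _; rewrite scaler_sumr.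
by apply: eq_bigr => i _; rewrite scalerAl.
Qed.

(** The gradient of f is equivariant, hence a sum of harmonic maps times invariants c of lower
    degree. Contracting with the variables gives a multiple of f by Euler's identity, turns the
    harmonic maps into combinations of the basic invariants, and leaves c to the induction. *)
Lemma inv_homog_generated e f : inv f -> f \is e.-homog ->
  exists q, f = q \mPo basic_invariants.
Proof.
have [N] := ubnP e; elim: N e f => // N IHN e f eN fi fe.
case: e => [|e] in eN fe *.
  by exists (f@_0%MM)%:MP; rewrite comp_mpolyC -homog0P.
have : (e < e.+1)%N -> exists q, contractX (fun i => f^`M(i)) = q \mPo basic_invariants.
  apply: (@equivariant_ind _ _ _ _ rG _ rG
    (fun e' F => (e' < e.+1)%N -> exists q, contractX F = q \mPo basic_invariants)).
  - move=> e' F F' IF IF' /[dup] /IF [q qE] /IF' [q' qE'].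
    exists (q + q'); rewrite comp_mpolyD -qE -qE' /contractX -big_split.
    by apply: eq_bigr => i _ /=; rewrite mulrDl.
  - move=> d e' c h ci cd he hh _ lt_e.
    have [|q qE] := IHN d c _ ci cd.
      rewrite ltnS in eN; apply: leq_trans (leq_trans lt_e eN).
      by rewrite ltnS leq_addl.
    have [t tE] := be_span he hh.
    exists ((\sum_k t k *: 'X_k) * q); rewrite rmorphM /= -qE raddf_sum /=.
    transitivity (contractX h * c).
      by rewrite /contractX mulr_suml; apply: eq_bigr => i _; rewrite mulrAC.
    rewrite (contractX_sum tE); congr (_ * _); apply: eq_bigr => k _.
    by rewrite comp_mpolyZ comp_mpolyXU -tnth_nth tnth_mktuple.
  - exact: gradient_equiv.
  by move=> i; apply: mderiv_homog.
case=> // q qE; exists (e.+1%:R^-1 *: q); rewrite comp_mpolyZ -qE.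
have -> : contractX (fun i => f^`M(i)) = f *+ e.+1.
  by rewrite -(euler_identity fe); apply: eq_bigr => i _; rewrite mulrC.
by rewrite -scaler_nat scalerA mulVf ?scale1r // pnatr_eq0.
Qed.

Lemma inv_generated f : inv f -> exists q, f = q \mPo basic_invariants.
Proof.
move=> fi; rewrite (pihomog_partitionE (leqnn (msize f))).
elim/big_rec: _ => [|i x _ [q ->]]; first by exists 0; rewrite comp_mpoly0.
have [q' qE] := inv_homog_generated (inv_pihomog i fi) (pihomogP mdeg i f).
by exists (q' + q); rewrite comp_mpolyD -qE.
Qed.

(** At a point with trivial stabiliser every linear form is the differential of an invariant, that
    is, of a polynomial in the basic invariants; the n differentials of the latter therefore span,
    and the Jacobian matrix is invertible there. *)
Lemma alg_independent : mx_faithful rG -> forall q, q \mPo basic_invariants = 0 -> q = 0.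
Proof.
case/generic_point => v fv q; apply: (jacobian_criterion (v := v)).
  exact: pchar_num.
rewrite -unitfE -unitmxE.
have H i : exists X : 'I_n -> C, forall j,
    \sum_k X k * ev v (tnth basic_invariants k)^`M(j) = (i == j)%:R.
  have [f /inv_generated[q' fE] fd] := @inv_differential v (fun j => (i == j)%:R) fv.
  exists (fun k => ev v (q'^`M(k) \mPo basic_invariants)) => j.
  have := fd (delta_mx 0 j); rewrite /dd (bigD1 j) //= [in LHS]big1 ?addr0.
    rewrite fE mderiv_comp rmorph_sum mxE !eqxx mul1r => E.
    transitivity (\sum_i0 (delta_mx 0 j : 'rV[C]_n) 0 i0 * (i == i0)%:R).
      by rewrite -E; apply: eq_bigr => k _; rewrite rmorphM.
    rewrite (bigD1 j) //= mxE !eqxx mul1r big1 ?addr0 // => k kj.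
    by rewrite mxE (negPf kj) andbF mul0r.
  by move=> k kj; rewrite mxE (negPf kj) andbF mul0r.
have [X XE] := choice H.
suff : (\matrix_(i, k) X i k) *m (\matrix_(k, i) ev v (tnth basic_invariants k)^`M(i)) = 1%:M.
  by case/mulmx1_unit.
apply/matrixP => i j; rewrite !mxE -XE; apply: eq_bigr => k _.
by rewrite !mxE.
Qed.

End Basis.

End Invariants.

(** * Points with prescribed values of the basic invariants *)

Section ProperIdeal.
Variables (C : fieldType) (n : nat).
Local Notation S := {mpoly C[n]}.

Definition proper_ideal (I : S -> Prop) :=
  [/\ I 0, forall a b, I a -> I b -> I (a + b), forall c a, I a -> I (c * a) & ~ I 1].

(** If 1 belonged to I + (x - r) for every r, multiplying these relations over [rs] would put 1 in
    I. *)
Lemma proper_ideal_root I (x : S) rs : proper_ideal I ->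
    I (\prod_(r <- rs) (x - r%:MP)) ->
  exists r I', [/\ proper_ideal I', forall f, I f -> I' f & I' (x - r%:MP)].
Proof.
move=> [I0 ID IM I1] Irs.
pose E r f := exists a, I (f - a * (x - r%:MP)).
have [Er|] := EM (exists r, ~ E r 1).
  case: Er => r Er1; exists r, (E r); split.
  - split=> // [|a b [p Ip] [q Iq]|c a [p Ip]].
    - by exists 0; rewrite mul0r subr0.
    - by exists (p + q); rewrite mulrDl opprD addrACA; apply: ID.
    by exists (c * p); rewrite -mulrA -mulrBr; apply: IM.
  - by move=> f If; exists 0; rewrite mul0r subr0.
  by exists 1; rewrite mul1r subrr.
move=> Eall; case: I1.
have E1 r : E r 1 by apply: contrapT => nE; apply: Eall; exists r.
suff [b Ib] : exists b, I (1 - b * \prod_(r <- rs) (x - r%:MP)).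
  by rewrite -[1](subrK (b * \prod_(r <- rs) (x - r%:MP))); apply: ID => //; apply: IM.
elim: rs {Irs} => [|r rs [b Ib]].
  by exists 1; rewrite big_nil mul1r subrr.
have [a Ia] := E1 r; exists (a * b); rewrite big_cons.
have -> : 1 - a * b * ((x - r%:MP) * \prod_(r <- rs) (x - r%:MP)) =
    (1 - a * (x - r%:MP)) + a * (x - r%:MP) * (1 - b * \prod_(r <- rs) (x - r%:MP)).
  by ring.
by apply: ID => //; apply: IM.
Qed.

(* The Nullstellensatz for an ideal containing a split polynomial in each variable. *)
Lemma proper_ideal_point I : proper_ideal I ->
    (forall j : 'I_n, exists rs, I (\prod_(r <- rs) ('X_j - r%:MP))) ->
  exists v : 'rV_n, forall f, I f -> ev v f = 0.
Proof.
move=> pI Irs.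
have H (s : seq 'I_n) : exists (v : 'I_n -> C) I', [/\ proper_ideal I',
    forall f, I f -> I' f & forall j, j \in s -> I' ('X_j - (v j)%:MP)].
  elim: s => [|j s [v [I' [pI' II' sI']]]]; first by exists (fun=> 0), I.
  have [rs /II' rsI'] := Irs j.
  have [r [I'' [pI'' I'I'' rI'']]] := proper_ideal_root pI' rsI'.
  exists (fun i => if i == j then r else v i), I''; split=> //.
    by move=> f /II' /I'I''.
  move=> i; rewrite in_cons; case: eqVneq => [-> //|_] /=.
  by move=> /sI' /I'I''.
have [v [I' [[I0 ID IM I1] II' vI']]] := H (enum 'I_n).
exists (\row_j v j) => f /II' If.
have fv p : I' (p - (ev (\row_j v j) p)%:MP).
  elim/mpoly_ind_linX: p => [|c p q pE qE|i p pE].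
  - by rewrite rmorph1 mpolyC1 subrr.
  - rewrite rmorphD /= evZ mpolyCD mpolyCM mul_mpolyC opprD addrACA -scalerBr.
    by apply: ID => //; rewrite -mul_mpolyC; apply: IM.
  rewrite rmorphM /= evX mxE mpolyCM.
  have -> : 'X_i * p - (v i)%:MP * (ev (\row_j v j) p)%:MP =
    p * ('X_i - (v i)%:MP) + (v i)%:MP * (p - (ev (\row_j v j) p)%:MP).
    by rewrite !mulrBr addrA ![p * _]mulrC subrK.
  by apply: ID; apply: IM => //; apply: vI'; rewrite mem_enum.
apply: contrapT => /eqP fnz; apply: I1.
set c := ev _ f in fnz.
have -> : (1 : S) = c^-1%:MP * f + (- c^-1%:MP) * (f - c%:MP).
  rewrite mulrBr !mulNr opprK addNKr -mpolyCM mulVf //; exact/eqP.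
by apply: ID; apply: IM.
Qed.

End ProperIdeal.

Section LyingOver.
Variables (C : numClosedFieldType) (gT : finGroupType) (G : {group gT}) (n : nat).
Variable rG : mx_representation C G n.
Local Notation S := {mpoly C[n]}.
Local Notation inv := (inv rG).
Local Notation act := (act rG).

(** The roots are the translates of x under W: S is integral over its invariants. *)
Lemma orbit_polynomial (x : S) : exists p : {poly S},
  [/\ p \is monic, root p x & forall i, inv p`_i].
Proof.
exists (\prod_(g in G) ('X - (act g x)%:P)); split.
- exact: monic_prod_XsubC.
- have E : act 1%g x = x by rewrite actE invg1 repr_mx1 trmx1 lsub1.
  by rewrite /root (bigD1 1%g (group1 G)) /= hornerM hornerXsubC E subrr mul0r eqxx.
move=> i h Gh; rewrite -coef_map rmorph_prod.
apply: (congr1 (fun p : {poly S} => p`_i)).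
rewrite [RHS](reindex_inj (mulIg h)); apply: eq_big => g; first by rewrite groupMr.
by move=> Gg; rewrite /= rmorphB /= map_polyX map_polyC /= (actM rG _ Gh Gg).
Qed.

Variable be : 'I_n -> 'I_n -> S.
Hypothesis be_equiv : forall k, equivariant rG rG (be k).
Hypothesis be_generate : forall f, inv f -> exists q, f = q \mPo basic_invariants be.
Hypothesis be_independent : forall q, q \mPo basic_invariants be = 0 -> q = 0.

(** I is the ideal generated by the polynomials in the basic invariants that vanish at t. If it
    contained 1, the Reynolds operator would give such a relation with invariant coefficients,
    hence, by independence, a relation between polynomials that is absurd at t. *)
Lemma lying_over (t : 'rV[C]_n) :
  exists v : 'rV_n, forall q, ev v (q \mPo basic_invariants be) = ev t q.
Proof.
pose I f := exists s : seq (S * S), (forall x, x \in s -> ev t x.2 = 0) /\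
  f = \sum_(x <- s) x.1 * (x.2 \mPo basic_invariants be).
have tlb_inv q : inv (q \mPo basic_invariants be).
  elim/mpoly_ind_linX: q => [|c p q pE qE|i p pE].
  - by rewrite comp_mpoly1; apply: inv1.
  - by rewrite comp_mpolyD comp_mpolyZ; apply: invP.
  rewrite rmorphM /= comp_mpolyXU -tnth_nth tnth_mktuple; apply: invM => //.
  exact: contractX_inv.
have pI : proper_ideal I.
  split.
  - by exists [::]; rewrite big_nil.
  - move=> _ _ [s [sP ->]] [s' [sP' ->]]; exists (s ++ s'); rewrite big_cat.
    by split=> // x; rewrite mem_cat => /orP[/sP|/sP'].
  - move=> c _ [s [sP ->]]; exists [seq (c * x.1, x.2) | x <- s]; split.
      by move=> x /mapP[y ys ->]; exact: (sP _ ys).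
    by rewrite big_map mulr_sumr; apply: eq_bigr => x _; rewrite mulrA.
  case=> s [sP E1].
  have [q qE] := choice (fun x : S * S => be_generate (@reynolds_inv _ _ _ _ rG x.1)).
  suff : \sum_(x <- s) q x * x.2 = 1.
    move/(congr1 (ev t)); rewrite rmorph1 rmorph_sum big_seq big1.
      by move/eqP; rewrite eq_sym oner_eq0.
    by move=> x xs; rewrite rmorphM /= sP // mulr0.
  apply/eqP; rewrite -subr_eq0; apply/eqP/be_independent.
  rewrite rmorphB /= rmorph1 rmorph_sum -(reynolds1 rG) E1 linear_sum.
  apply/eqP; rewrite subr_eq0; apply/eqP/eq_bigr => x _.
  by rewrite rmorphM /= -qE reynoldsM.
have tlbI q : I (q \mPo basic_invariants be - (ev t q)%:MP).
  exists [:: (1, q - (ev t q)%:MP)]; split.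
    by move=> x; rewrite inE => /eqP -> /=; rewrite rmorphB /= evC subrr.
  by rewrite big_seq1 mul1r rmorphB /= comp_mpolyC.
(* Modulo I every invariant is a constant; [chi] chooses one, with 0 as a dummy for polynomials that
   are not invariant. *)
have H f : exists c, inv f -> I (f - c%:MP).
  have [/be_generate[q ->]|] := EM (inv f); last by exists 0.
  by exists (ev t q).
have [chi chiP] := choice H; case: (pI) => I0 ID IM I1.
(* [chi] is a mere choice and is not shown to send 1 to 1. Being nonzero is enough for [chi 1],
   which will be the leading coefficient of P. *)
have chi1 : chi 1 != 0.
  apply/eqP => c0; apply: I1; rewrite -[1]subr0 -mpolyC0 -c0.
  by apply/chiP/inv1.
have Iprod j : exists rs, I (\prod_(r <- rs) ('X_j - r%:MP)).
  have [p [pm px pi]] := orbit_polynomial 'X_j.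
  (* The orbit polynomial with its coefficients reduced modulo I: a polynomial over the complex
     numbers, so it splits. *)
  pose P := \poly_(i < size p) chi p`_i.
  have Plead : P`_(size p).-1 = chi 1.
    rewrite coef_poly prednK ?leqnn ?lt0n ?size_poly_eq0 ?monic_neq0 //.
    by move: pm; rewrite monicE => /eqP <-.
  have Pnz : lead_coef P != 0.
    rewrite lead_coef_eq0; apply: contraNneq chi1 => P0.
    by rewrite -Plead P0 coef0.
  have [rs PE] := closed_field_poly_normal P.
  have IP : I (map_poly (@mpolyC n C) P).[('X_j : S)].
    have -> : map_poly (@mpolyC n C) P = \poly_(i < size p) (chi p`_i)%:MP.
      apply/polyP => i; rewrite coef_map !coef_poly /=.
      by case: ifP => // _; rewrite mpolyC0.
    have /rootP p0 := px; rewrite horner_coef in p0.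
    rewrite horner_poly -[X in I X]subr0 -[X in I (_ - X)]p0 -sumrB.
    apply: big_ind => // i _; rewrite -mulrBl -opprB -mulrN1 -mulrA mulrC.
    by apply/IM/chiP/pi.
  exists rs; rewrite PE map_polyZ hornerZ /= rmorph_prod horner_prod in IP.
  have := IM (lead_coef P)^-1%:MP _ IP; rewrite mulrA -mpolyCM mulVf // mul1r.
  by under eq_bigr => r _ do rewrite rmorphB /= map_polyX map_polyC /= hornerXsubC.
have [v vP] := proper_ideal_point pI Iprod.
exists v => q; have /vP := tlbI q; rewrite rmorphB /= evC => /eqP.
by rewrite subr_eq0 => /eqP.
Qed.

End LyingOver.

Lemma prim_root_exists (C : numClosedFieldType) d : (0 < d)%N ->
  exists z : C, d.-primitive_root z.
Proof.
move=> d0; have [rs E] := closed_field_poly_normal ('X^d - 1 : {poly C}).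
rewrite (monicP (monicXnsubC 1 d0)) scale1r in E.
have Urs : uniq rs.
  by rewrite -separable_prod_XsubC -E separable_Xn_sub_1 // pnatr_eq0 -lt0n.
have szrs : size rs = d.
  have := congr1 (fun p : {poly C} => size p) E.
  by rewrite size_XnsubC // size_prod_XsubC => -[].
have /hasP[z _ zp] : has d.-primitive_root rs.
  apply: has_prim_root => //; last by rewrite szrs.
  by apply/allP => z; rewrite -root_prod_XsubC -E.
by exists z.
Qed.

Lemma polyP_horner (C : closedFieldType) (p q : {poly C}) :
  (forall x, p.[x] = q.[x]) -> p = q.
Proof.
move=> pq; apply/eqP; rewrite -subr_eq0; apply/negPn/negP => /closed_nonrootP[x].
by rewrite /root hornerD hornerN pq subrr eqxx.
Qed.

Section HomogeneousCoefficients.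
Variable K : comNzRingType.

Lemma mcoeff_pihomog n d (p : {mpoly K[n]}) m :
  (pihomog mdeg d p)@_m = if mdeg m == d then p@_m else 0.
Proof.
elim/mpolyind: p => [|c m' p _ _ pE]; first by rewrite linear0 mcoeff0 if_same.
rewrite linearP /= !mcoeffD !mcoeffZ pE pihomogX.
have [<-|] := eqVneq m' m; first by case: ifP => _; rewrite ?mcoeff0 ?mulr0 ?addr0.
case: (mdeg m' == d); rewrite ?mcoeff0 mcoeffX => /negPf ->; rewrite mulr0 add0r;
  by case: ifP => _; rewrite ?add0r.
Qed.

Lemma homog1E n (p : {mpoly K[n]}) : p \is 1.-homog ->
  p = \sum_k p@_U_(k)%MM *: 'X_k.
Proof.
move=> p1; apply/mpolyP => m; rewrite raddf_sum /=.
have [/mdeg1P[k /eqP ->]|m1] := boolP (mdeg m == 1%N).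
  rewrite (bigD1 k) //= mcoeffZ mcoeffX eqxx mulr1 big1 ?addr0 // => j jk.
  by rewrite mcoeffZ mcoeffX eq_mnm1 (negPf jk) mulr0.
rewrite (dhomog_nemf_coeff p1 m1) big1 // => k _; rewrite mcoeffZ mcoeffX.
case: eqP => [E|_]; last by rewrite mulr0.
by move: m1; rewrite -E mdeg1.
Qed.

Lemma ev_scale n e x (v : 'rV[K]_n) (f : {mpoly K[n]}) : f \is e.-homog ->
  ev (x *: v) f = x ^+ e * ev v f.
Proof.
move=> /dhomogP fe; rewrite [f]mpolyE !rmorph_sum big_seq [in RHS]big_seq mulr_sumr.
apply: eq_bigr => m /fe mE; rewrite /= !evZ mulrCA; congr (_ * _).
rewrite /ev !mevalX -[in RHS]mE /= mdegE -prodrXr -big_split.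
by apply: eq_bigr => i _; rewrite mxE exprMn.
Qed.

End HomogeneousCoefficients.

(** * The vector v and its stabiliser *)

Section SpecialPoint.
Variables (C : numClosedFieldType) (gT : finGroupType) (G : {group gT}) (n : nat).
Variable rG : mx_representation C G n.
Local Notation S := {mpoly C[n]}.
Local Notation inv := (inv rG).
Local Notation harm := (harm rG).

Lemma equivariant_pihomog m (rho : mx_representation C G m) F e :
  equivariant rG rho F -> equivariant rG rho (fun i => pihomog mdeg e (F i)).
Proof.
move=> eF g Gg i; rewrite -pihomog_act eF // linear_sum.
by apply: eq_bigr => j _; rewrite linearZ.
Qed.

Variable be : 'I_n -> 'I_n -> S.
Hypothesis be_equiv : forall k, equivariant rG rG (be k).
Hypothesis be_harm : forall k i, harm (be k i).
Hypothesis be_span : forall h, equivariant rG rG h -> (forall i, harm (h i)) ->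
  exists t : 'I_n -> C, forall i, h i = \sum_k t k *: be k i.
Variables (d : nat) (bs : 'I_n -> S) (lam : 'rV[C]_n) (v : 'rV[C]_n).
Hypothesis d_gt0 : (0 < d)%N.
Hypothesis bs_neq0 : exists i, bs i != 0.
Hypothesis be_top : forall k i, pihomog mdeg d.-1 (be k i) = lam 0 k *: bs i.
Hypothesis v_over : forall q, ev v (q \mPo basic_invariants be) = ev lam q.

(** Both sides are linear in h, and they agree on each [be k] by the choice of v. *)
Lemma top_component h i : equivariant rG rG h -> (forall i, harm (h i)) ->
  pihomog mdeg d.-1 (h i) = ev v (contractX h) *: bs i.
Proof.
move=> eh hh; have [t tE] := be_span eh hh.
rewrite (contractX_sum tE) tE linear_sum rmorph_sum scaler_suml; apply: eq_bigr => k _.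
rewrite linearZ /= be_top scalerA evZ; congr (_ * _ *: _).
by have := v_over 'X_k; rewrite comp_mpolyXU -tnth_nth tnth_mktuple evX.
Qed.

Lemma ev_contractX_homog e h : equivariant rG rG h -> (forall i, harm (h i)) ->
  (forall i, h i \is e.-homog) -> e != d.-1 -> ev v (contractX h) = 0.
Proof.
move=> eh hh he ed; have [i bi] := bs_neq0; apply/eqP.
have /esym/eqP := top_component i eh hh.
by rewrite (pihomog_ne0 ed (he i)) scaler_eq0 (negPf bi) orbF.
Qed.

Lemma contractX_homog e (h : 'I_n -> S) : (forall i, h i \is e.-homog) ->
  contractX h \is e.+1.-homog.
Proof.
move=> he; apply: rpred_sum => i _; rewrite -addn1; apply: dhomogM => //.
by rewrite dhomogX /= mdeg1.
Qed.

(** Although [be k] may mix degrees, [ev_contractX_homog] shows that only its component of degree d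
    - 1 contributes on the line of v; contraction raises that degree by one. *)
Lemma ev_scale_contractX x k : ev (x *: v) (contractX (be k)) = x ^+ d * lam 0 k.
Proof.
pose N := maxn (\max_i msize (be k i)) d.
have -> : contractX (be k) = \sum_(e < N) contractX (fun i => pihomog mdeg e (be k i)).
  rewrite /contractX exchange_big; apply: eq_bigr => i _ /=; rewrite -mulr_suml.
  by rewrite -pihomog_partitionE // leq_max (leq_bigmax (F := fun i => msize (be k i)) i).
have dN : (d.-1 < N)%N by rewrite prednK // leq_maxr.
have comp e : equivariant rG rG (fun i => pihomog mdeg e (be k i)) /\
    forall i, harm (pihomog mdeg e (be k i)).
  by split=> [|i]; [apply: equivariant_pihomog|apply: harmonic_pihomog].
rewrite rmorph_sum (bigD1 (Ordinal dN)) //= big1 ?addr0.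
  rewrite (ev_scale _ _ (contractX_homog (fun i => pihomogP _ _ _))) prednK //.
  congr (_ * _); have [i bi] := bs_neq0; have [ec hc] := comp d.-1.
  apply/eqP; rewrite -subr_eq0 -[_ == 0]orbF -(negPf bi) -scaler_eq0 scalerBl.
  by rewrite -(top_component i ec hc) pihomog_id be_top subrr.
move=> e ed; have [ec hc] := comp e.
rewrite (ev_scale _ _ (contractX_homog (fun i => pihomogP _ _ _))).
by rewrite (@ev_contractX_homog e _ ec hc (fun i => pihomogP _ _ _)) ?mulr0.
Qed.

Lemma ev_scale_over x q : ev (x *: v) (q \mPo basic_invariants be) = ev (x ^+ d *: lam) q.
Proof.
rewrite /ev comp_mpoly_meval; apply: meval_eq => k.
by rewrite tnth_mktuple -[LHS]/(ev _ _) ev_scale_contractX mxE.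
Qed.

(** Scaling v by a primitive d-th root of unity z multiplies the value of f by [z ^+ e], yet leaves
    it unchanged, since the basic invariants only see [z ^+ d]. *)
Lemma ev_inv_homog0 e f : inv f -> f \is e.-homog -> ~~ (d %| e)%N -> ev v f = 0.
Proof.
move=> /(inv_generated be_span)[q fE] fe de; have [z zd] := prim_root_exists C d_gt0.
have := ev_scale_over z q; rewrite prim_expr_order // scale1r -v_over -fE.
rewrite (ev_scale _ _ fe) => /eqP; rewrite -subr_eq0 -{2}[ev v f]mul1r -mulrBl.
rewrite mulf_eq0 subr_eq0 => /orP[|/eqP //].
by rewrite -(prim_order_dvd zd) (negPf de).
Qed.

(** The coefficients of x^d in f(x v) = q(x^d lam) are, on the left, the value at v of the degree d
    component of f and, on the right, the value at lam of the linear part of q. No other component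
    of f is nonzero at v, the only multiple of d strictly between 0 and 2d being d. *)
Lemma ev_linear_part f q : inv f -> f = q \mPo basic_invariants be ->
    (forall e, (e == 0%N) || (d.*2 <= e)%N -> pihomog mdeg e f = 0) ->
  ev v f = \sum_k q@_U_(k)%MM * lam 0 k.
Proof.
move=> fi fE fhom.
(* The bounds are enlarged so that the indices d and 1 occur in the two sums. *)
pose N := maxn (msize f) d.+1; pose M := maxn (msize q) 2.
pose P1 := \sum_(e < N) ev v (pihomog mdeg e f) *: 'X^e : {poly C}.
pose P2 := \sum_(j < M) ev lam (pihomog mdeg j q) *: 'X^(d * j) : {poly C}.
have fN : f = \sum_(e < N) pihomog mdeg e f by rewrite -pihomog_partitionE // leq_maxl.
have qM : q = \sum_(e < M) pihomog mdeg e q by rewrite -pihomog_partitionE // leq_maxl.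
have P12 : P1 = P2.
  apply: polyP_horner => x; rewrite !horner_sum.
  transitivity (ev (x *: v) f).
    rewrite [in RHS]fN rmorph_sum; apply: eq_bigr => e _.
    by rewrite hornerZ hornerXn /= (ev_scale _ _ (pihomogP _ _ _)) mulrC.
  rewrite {1}fE ev_scale_over [in LHS]qM rmorph_sum; apply: eq_bigr => j _.
  by rewrite hornerZ hornerXn /= (ev_scale _ _ (pihomogP _ _ _)) mulrC exprM.
have dN : (d < N)%N by rewrite leq_maxr.
have M1 : (1 < M)%N by rewrite leq_maxr.
have P1d : P1`_d = ev v (pihomog mdeg d f).
  rewrite coef_sum (bigD1 (Ordinal dN)) //= coefZ coefXn eqxx mulr1 big1 ?addr0 //.
  move=> e ed; rewrite coefZ coefXn (_ : (d == e) = false) ?mulr0 //.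
  by apply: contraNF ed => /eqP ed; apply/eqP/val_inj.
have P2d : P2`_d = ev lam (pihomog mdeg 1 q).
  rewrite coef_sum (bigD1 (Ordinal M1)) //= coefZ coefXn muln1 eqxx mulr1.
  rewrite big1 ?addr0 // => j j1; rewrite coefZ coefXn.
  rewrite (_ : (d == d * j)%N = false) ?mulr0 //; apply: contraNF j1.
  by rewrite -{1}[d]muln1 eqn_pmul2l // => /eqP j1; apply/eqP/val_inj.
transitivity (ev v (pihomog mdeg d f)).
  rewrite {1}fN rmorph_sum (bigD1 (Ordinal dN)) //= big1 ?addr0 // => e ed.
  have [/dvdnP[[|[|k]] ek]|de] := boolP (d %| e)%N; last first.
  - by rewrite (ev_inv_homog0 (inv_pihomog _ fi) (pihomogP _ _ _) de).
  - by rewrite fhom ?rmorph0 // ek -mul2n leq_mul2r orbT orbT.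
  - by move: ed; rewrite -(inj_eq val_inj) /= ek mul1n eqxx.
  by rewrite fhom ?rmorph0 // ek.
rewrite -P1d P12 P2d (homog1E (pihomogP mdeg 1 q)) rmorph_sum.
by apply: eq_bigr => k _; rewrite /= evZ evX mcoeff_pihomog /= mdeg1 eqxx.
Qed.

End SpecialPoint.

Section Stabiliser.
Variables (C : numClosedFieldType) (gT : finGroupType) (G : {group gT}) (n : nat).
Variable rG : mx_representation C G n.
Local Notation inv := (inv rG).
Variable v : 'rV[C]_n.

Definition stab := [set u in G | v *m rG u == v].

Definition stab_proj : 'M[C]_n := #|stab|%:R^-1 *: \sum_(u in stab) rG u.

Lemma stabP u : reflect (u \in G /\ v *m rG u = v) (u \in stab).
Proof. by rewrite inE; apply: (iffP andP) => -[Gu /eqP]. Qed.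

Lemma stabM u w : u \in stab -> w \in stab -> (u * w)%g \in stab.
Proof.
move=> /stabP[Gu vu] /stabP[Gw vw]; apply/stabP; rewrite groupM //; split=> //.
by rewrite (repr_mxM rG Gu Gw) mulmxA vu.
Qed.

Lemma stabV u : u \in stab -> u^-1%g \in stab.
Proof.
move=> /stabP[Gu vu]; apply/stabP; rewrite groupV; split=> //.
by rewrite -{1}vu (repr_mxK rG Gu).
Qed.

Lemma stab_card : (#|stab|%:R : C) != 0.
Proof.
rewrite pnatr_eq0 -lt0n; apply/card_gt0P; exists 1%g; apply/stabP.
by rewrite group1 repr_mx1 mulmx1.
Qed.

Lemma stab_projr u : u \in stab -> stab_proj *m rG u = stab_proj.
Proof.
move=> su; have /stabP[Gu _] := su; rewrite /stab_proj -scalemxAl mulmx_suml.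
congr (_ *: _); rewrite [RHS](reindex_inj (mulIg u)); apply: eq_big => w.
  by apply/idP/idP => [sw|/stabM/(_ (stabV su))]; rewrite ?mulgK //; apply: stabM.
by move=> /stabP[Gw _]; rewrite (repr_mxM rG Gw Gu).
Qed.

Lemma mul_stab_proj (x : 'rV[C]_n) :
  (forall u, u \in stab -> x *m rG u = x) -> x *m stab_proj = x.
Proof.
move=> xs; rewrite /stab_proj -scalemxAr mulmx_sumr (eq_bigr (fun=> x)) //.
by rewrite sumr_const -scaler_nat scalerA mulVf ?scale1r // stab_card.
Qed.

Lemma stab_proj_idem : stab_proj *m stab_proj = stab_proj.
Proof.
rewrite {2}/stab_proj -scalemxAr mulmx_sumr (eq_bigr (fun=> stab_proj)).
  by rewrite sumr_const -scaler_nat scalerA mulVf ?scale1r // stab_card.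
exact: stab_projr.
Qed.

Lemma v_stab_proj : v *m stab_proj = v.
Proof. by apply: mul_stab_proj => u /stabP[]. Qed.

(** An element that sends v to a nonzero multiple of v normalises the stabiliser of v. *)
Lemma stab_projJ w c : w \in G -> c != 0 -> v *m rG w = c *: v ->
  rG w^-1%g *m stab_proj *m rG w = stab_proj.
Proof.
move=> Gw c0 vw; have Vw : w^-1%g \in G by rewrite groupV.
have vV : v *m rG w^-1%g = c^-1 *: v.
  by rewrite -[v in RHS](repr_mxK rG Gw) vw -scalemxAl scalerA mulVf // scale1r.
have rGJ u : u \in G -> rG (u ^ w)%g = rG w^-1%g *m rG u *m rG w.
  move=> Gu; rewrite conjgE (repr_mxM rG Vw (groupM Gu Gw)) (repr_mxM rG Gu Gw).
  by rewrite mulmxA.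
rewrite /stab_proj -scalemxAr mulmx_sumr -scalemxAl mulmx_suml; congr (_ *: _).
rewrite [RHS](reindex_inj (conjg_inj w)); apply: eq_big => u.
  rewrite !inE memJ_norm ?(fintype.subsetP (normG G)) //; case Gu : (u \in G) => //=.
  rewrite rGJ // !mulmxA vV.
  rewrite -!scalemxAl; apply/eqP/eqP => [->|E].
    by rewrite vw scalerA mulVf // scale1r.
  have := congr1 (fun x => c *: (x *m rG w^-1%g)) E.
  rewrite -scalemxAl (repr_mxK rG Gw) scalerA divff // scale1r => ->.
  by rewrite vV scalerA divff // scale1r.
by move=> /stabP[Gu _]; rewrite rGJ.
Qed.

Lemma dd_suml (I : finType) (P : pred I) (y : I -> 'rV[C]_n) f :
  dd v (\sum_(i | P i) y i) f = \sum_(i | P i) dd v (y i) f.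
Proof.
elim/big_rec2: _ => [|i a x _ <-]; last exact: ddD.
by rewrite -(scale0r 0) ddZ mul0r.
Qed.

(** For u in the stabiliser, an invariant has the same derivative at v along y and along
    [y *m rG u], hence along y and the average of these vectors. *)
Lemma dd_inv_stab_proj (y : 'rV[C]_n) f : inv f -> dd v (y *m (1%:M - stab_proj)) f = 0.
Proof.
move=> fi; rewrite mulmxBr mulmx1 ddD -scaleN1r ddZ mulN1r.
rewrite /stab_proj -scalemxAr mulmx_sumr ddZ dd_suml (eq_bigr (fun=> dd v y f)).
  rewrite sumr_const -[dd _ _ _ *+ _]mulr_natl mulrA mulVf ?mul1r ?subrr //; exact: stab_card.
by move=> u /stabP[Gu vu]; rewrite -{1}vu inv_dd.
Qed.

Lemma stab_proj_faithful : mx_faithful rG -> stab_proj = 1%:M ->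
  forall g, g \in G -> v *m rG g = v -> g = 1%g.
Proof.
move=> faith e1 g Gg vg; have sg : g \in stab by apply/stabP.
have g1 : rG g = 1%:M by rewrite -[rG g]mul1mx -e1 stab_projr.
have : g \in rker rG by apply/rkerP.
by rewrite (trivgP faith) inE => /eqP.
Qed.

End Stabiliser.

Lemma lsub_scalar (C : comNzRingType) n (c : C) e (f : {mpoly C[n]}) :
  f \is e.-homog -> lsub c%:M f = c ^+ e *: f.
Proof.
have cX i : lsub c%:M ('X_i : {mpoly C[n]}) = c *: 'X_i.
  rewrite lsubX (bigD1 i) //= mxE eqxx big1 ?addr0 // => j ji.
  by rewrite mxE eq_sym (negPf ji) scale0r.
move=> /dhomogP fe; rewrite [f]mpolyE linear_sum scaler_sumr big_seq [RHS]big_seq.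
apply: eq_bigr => m /fe mE; rewrite linearZ /= [RHS]scalerA mulrC -scalerA; congr (_ *: _).
rewrite [in LHS]mpolyXE_id rmorph_prod /= [in RHS]mpolyXE_id -mE /= mdegE -prodrXr.
rewrite -scaler_prod; apply: eq_bigr => i _.
by rewrite rmorphXn /= cX exprZn.
Qed.

Section Regular.
Variables (C : numClosedFieldType) (gT : finGroupType) (G : {group gT}) (n : nat).
Variable rG : mx_representation C G n.
Local Notation S := {mpoly C[n]}.
Local Notation inv := (inv rG).
Local Notation harm := (harm rG).
Local Notation dualG := (dual_rep rG).
Variables (d : nat) (z : C) (v : 'rV[C]_n).
Hypothesis z_prim : d.-primitive_root z.
Local Notation D := (1%:M - stab_proj rG v).

Let z_neq0 k : z ^+ k != 0.
Proof.
have d0 := prim_order_gt0 z_prim; rewrite expf_neq0 //.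
apply/eqP => z0; have := prim_expr_order z_prim.
by rewrite z0 expr0n gtn_eqF // => /eqP; rewrite eq_sym oner_eq0.
Qed.

(* A W-equivariant vector field, homogeneous of degree 1 mod d, that vanishes at v and
   whose derivative there is a multiple of the projection D along the fixed space of the
   stabiliser of v: the Euler field of the stabiliser, spread over the orbit of the line. *)
Lemma local_euler_field : exists F (N : nat),
  [/\ equivariant rG dualG F,
      forall e i, pihomog mdeg e (F i) != 0 -> e = 1 %[mod d],
      forall i, ev v (F i) = 0, (0 < N)%N
    & forall y i, dd v y (F i) = N%:R * (y *m D) 0 i].
Proof.
have d0 := prim_order_gt0 z_prim.
(* The orbit of v under W and the d-th roots of unity; h will be 1 at v and 0 at its other
   points. *)
pose pt (k : nat) w := z ^+ k *: (v *m rG w^-1%g).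
pose ws := [seq x <- [seq pt k w | k <- iota 0 d, w <- enum G] | x != v].
have [|h [hv hws]] := @interpolation _ _ v ws; first by rewrite mem_filter eqxx.
have h0 k w : (k < d)%N -> w \in G -> pt k w != v -> ev (pt k w) h = 0.
  move=> kd Gw ne; apply: hws; rewrite mem_filter ne /=.
  by apply/allpairsP; exists (k, w); rewrite mem_iota mem_enum.
(* Summing over the roots of unity keeps in H only the degrees divisible by d; squaring h makes the
   derivative vanish wherever h does. *)
pose H := \sum_(k < d) lsub (z ^+ k)%:M (h * h).
have evc c x f : ev x (lsub c%:M f) = ev (c *: x) f.
  by rewrite ev_lsub tr_scalar_mx mul_mx_scalar.
have ddc c x y f : dd x y (lsub c%:M f) = dd (c *: x) (c *: y) f.
  by rewrite dd_lsub tr_scalar_mx !mul_mx_scalar.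
have ptD k w : pt k w = v -> v *m rG w^-1%g *m D = 0.
  move=> ptv; have -> : v *m rG w^-1%g = (z ^+ k)^-1 *: v.
    by rewrite -[in RHS]ptv scalerA mulVf ?scale1r.
  by rewrite -scalemxAl mulmxBr mulmx1 v_stab_proj subrr scaler0.
(* The number of k < d for which z^k brings [v *m rG w^-1%g] back to v; it is also the value of H
   there. *)
pose Nw w := (\sum_(k < d) (pt k w == v))%N.
have evH w : w \in G -> ev (v *m rG w^-1%g) H = (Nw w)%:R.
  move=> Gw; rewrite rmorph_sum natr_sum; apply: eq_bigr => k _ /=.
  rewrite evc rmorphM -/(pt k w) /=; case: eqVneq => [->|ne]; first by rewrite hv mulr1.
  by rewrite h0 // mul0r.
(* Where [v *m rG w^-1%g *m D] is 0 the derivative of H is not controlled, but the linear forms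
   [L j] below vanish there. *)
have ddH w y : w \in G -> v *m rG w^-1%g *m D != 0 -> dd (v *m rG w^-1%g) y H = 0.
  move=> Gw ne; rewrite linear_sum big1 // => k _ /=; rewrite ddc ddM -/(pt k w).
  rewrite h0 ?mulr0 ?mul0r ?addr0 //; apply: contraNneq ne => ptv.
  by rewrite (ptD k).
have NwD w : w \in G -> v *m rG w^-1%g *m D != 0 -> Nw w = 0%N.
  move=> Gw ne; rewrite /Nw big1 // => k _; apply/eqP; rewrite eqb0.
  by apply: contra ne => /eqP ptv; rewrite (ptD k).
pose L j : S := \sum_i D i j *: 'X_i.
have evL x j : ev x (L j) = (x *m D) 0 j.
  rewrite rmorph_sum mxE; apply: eq_bigr => i _ /=.
  by rewrite evZ evX mulrC.
have ddL x y j : dd x y (L j) = (y *m D) 0 j.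
  rewrite linear_sum mxE; apply: eq_bigr => i _ /=.
  by rewrite linearZ /= ddX mulrC.
pose T j := H * L j.
exists (fun i => #|G|%:R *: average rG dualG T i), (\sum_(w in G) Nw w)%N; split.
- move=> g Gg i; rewrite actZ average_equiv // scaler_sumr.
  by apply: eq_bigr => j _; rewrite scalerA mulrC -scalerA.
- move=> e i; rewrite card_average; apply: contraTeq => e1; rewrite negbK.
  rewrite linear_sum big1 // => w _; rewrite linear_sum big1 // => j _ /=.
  rewrite linearZ /= pihomog_act.
  suff -> : pihomog mdeg e (T j) = 0 by rewrite -(scale0r 0) actZ !scale0r scaler0.
  have Lh : L j \is 1.-homog by apply: linform_homog.
  rewrite /T mulrC; case: e e1 => [|e] e1; first by rewrite (pihomogM_lt _ Lh).
  rewrite -[e.+1]add1n (pihomogM _ _ Lh); suff -> : pihomog mdeg e H = 0 by rewrite mulr0.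
  have ze : z ^+ e != 1.
    by rewrite -(prim_order_dvd z_prim); move: e1; rewrite eqn_mod_dvd // subn1.
  rewrite linear_sum; under eq_bigr => k _ do
    rewrite /= pihomog_lsub (lsub_scalar _ (pihomogP _ _ _)) exprAC.
  rewrite -scaler_suml (_ : \sum_(k < d) _ = 0) ?scale0r //; apply/eqP.
  rewrite -[_ == 0]orFb -(negPf ze) -subr_eq0 -mulf_eq0 -subrX1 exprAC.
  by rewrite (prim_expr_order z_prim) expr1n subrr.
- move=> i; rewrite card_average rmorph_sum big1 // => w Gw.
  rewrite rmorph_sum big1 // => j _ /=.
  rewrite evZ ev_act rmorphM /= evH // evL.
  have [->|ne] := eqVneq (v *m rG w^-1%g *m D) 0.
    by rewrite [(0 : 'rV[C]_n) 0 j]mxE !mulr0.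
  by rewrite NwD // mul0r mulr0.
- rewrite (bigD1 1%g) //= (leq_trans _ (leq_addr _ _)) // /Nw.
  rewrite (bigD1 (Ordinal d0)) //= /pt expr0 scale1r invg1 repr_mx1 mulmx1 eqxx.
  by rewrite leq_addr.
move=> y i; rewrite card_average natr_sum mulr_suml linear_sum; apply: eq_bigr => w Gw.
rewrite linear_sum.
(* Only the w that send v to some z^k v contribute. They commute with D, so each adds [Nw w] times
   [y *m D]. *)
have [N0|NN0] := eqVneq (Nw w) 0%N.
  rewrite N0 mul0r big1 // => j _ /=; rewrite linearZ /= dd_act ddM evL evH // N0.
  rewrite mul0r addr0; have [->|ne] := eqVneq (v *m rG w^-1%g *m D) 0.
    by rewrite [(0 : 'rV[C]_n) 0 j]mxE !mulr0.
  by rewrite ddH // mul0r mulr0.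
have /existsP[k /eqP ptv] : [exists k : 'I_d, pt k w == v].
  apply: contraR NN0 => /existsPn nv.
  by rewrite /Nw big1 // => k _; apply/eqP; rewrite eqb0.
have vD : v *m rG w^-1%g *m D = 0 by apply: (ptD k).
have vw : v *m rG w = z ^+ k *: v.
  by rewrite -[in LHS]ptv -scalemxAl (repr_mxKV rG Gw).
have DJ : rG w^-1%g *m D *m rG w = D.
  rewrite mulmxBr mulmxBl mulmx1 (stab_projJ Gw (z_neq0 k) vw).
  by rewrite -[rG w^-1%g]mul1mx (repr_mxKV rG Gw).
transitivity (\sum_j (Nw w)%:R * ((y *m rG w^-1%g *m D) 0 j * rG w j i)).
  apply: eq_bigr => j _; rewrite linearZ /= dd_act ddM evL evH // vD.
  by rewrite [(0 : 'rV_n) _ _]mxE mulr0 add0r ddL invgK mxE mulrC mulrA.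
rewrite -mulr_sumr; congr (_ * _); rewrite -[in RHS]DJ !mulmxA.
by rewrite [RHS]mxE.
Qed.

Hypothesis faithful : mx_faithful rG.
Hypothesis v_neq0 : v != 0.
Hypothesis ev_inv0 : forall e f, inv f -> f \is e.-homog -> ~~ (d %| e)%N -> ev v f = 0.
Hypothesis dual_deg : forall e p, equivariant rG dualG p -> (forall i, harm (p i)) ->
  (forall i, p i \is e.-homog) -> (exists i, p i != 0) -> (0 < e <= d)%N.
Hypothesis dual_deg1 : forall p, equivariant rG dualG p -> (forall i, harm (p i)) ->
  (forall i, p i \is 1.-homog) -> exists a, forall i, p i = a *: 'X_i.

Lemma regular_vector : forall g, g \in G -> v *m rG g = v -> g = 1%g.
Proof.
apply: stab_proj_faithful => //; apply/eqP; rewrite eq_sym -subr_eq0; apply/eqP.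
have [F [N [eF hF F0 N0 FD]]] := local_euler_field.
(* In an expansion over harmonic vector fields, A collects the values at v of the invariants that
   multiply the Euler field. *)
pose good (F : 'I_n -> S) := exists A, forall i,
  ev v (F i) = A * v 0 i /\ forall y : 'rV_n, dd v (y *m D) (F i) = A * (y *m D) 0 i.
have good0 : good (fun=> 0).
  by exists 0 => i; rewrite rmorph0 mul0r; split=> // y; rewrite linear0 mul0r.
have goodD F1 F2 : good F1 -> good F2 -> good (fun i => F1 i + F2 i).
  move=> [A1 h1] [A2 h2]; exists (A1 + A2) => i; have [e1 d1] := h1 i.
  have [e2 d2] := h2 i; rewrite rmorphD /= e1 e2 mulrDl; split=> // y.
  by rewrite linearD /= d1 d2 mulrDl.
have goodE e p : equivariant rG dualG p -> (forall i, p i \is e.-homog) ->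
    e = 1 %[mod d] -> good p.
  apply: (equivariant_ind (P := fun e p => e = 1 %[mod d] -> good p)).
    by move=> e' F1 F2 g1 g2 ed; apply: goodD; [apply: g1|apply: g2].
  move=> a e' c h ci ca eh hh he ed.
  have [[i hi]|h0] := EM (exists i, h i != 0); last first.
    rewrite (_ : (fun i => h i * c) = fun=> 0) //; apply/funext => i.
    have -> : h i = 0 by apply: contrapT => /eqP hi; apply: h0; exists i.
    by rewrite mul0r.
  have /andP[e'0 e'd] := dual_deg eh hh he (ex_intro _ i hi).
  have [e'1|e'1] := eqVneq e' 1%N.
    rewrite e'1 in he; have [A hE] := dual_deg1 eh hh he.
    exists (A * ev v c) => j; rewrite hE -scalerAl evZ rmorphM /= evX -mulrA.
    rewrite [v 0 j * _]mulrC; split=> // y.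
    by rewrite linearZ /= ddM ddX dd_inv_stab_proj // mulr0 addr0 -mulrA [_ * ev v c]mulrC.
  have c0 : ev v c = 0.
    (* If d divided the degree a of c, then e' would be 1 modulo d, which is excluded by 0 < e' <= d
       and e' != 1. *)
    apply: (ev_inv0 ci ca); apply: contra e'1 => /dvdnP[k ak].
    move/eqP: ed; rewrite ak addnC modnMDl eqn_mod_dvd // => /dvdn_leq H.
    case: e' e'0 e'd H {he} => [//|[//|e']] _ ed; rewrite subn1 /= => /(_ isT) H.
    by move: (leq_trans ed H); rewrite ltnn.
  exists 0 => j; rewrite rmorphM /= c0 mulr0 mul0r; split=> // y.
  by rewrite ddM c0 mulr0 add0r dd_inv_stab_proj // mulr0 mul0r.
have [A AP] : good F.
  pose M := (\max_i msize (F i))%N.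
  have -> : F = fun i => \sum_(e <- iota 0 M) pihomog mdeg e (F i).
    apply/funext => i; rewrite -[M]subn0 big_mkord -pihomog_partitionE //.
    exact: (leq_bigmax (F := fun i => msize (F i))).
  elim: (iota 0 M) => [|e s IHs].
    by under eq_fun do rewrite big_nil.
  under eq_fun do rewrite big_cons; apply: goodD => //.
  have [ed|ed] := EM (e = 1 %[mod d]).
    by apply: (goodE e) => // [|i]; [apply: equivariant_pihomog|apply: pihomogP].
  rewrite (_ : (fun i => _) = fun=> 0) //; apply/funext => i.
  by apply: contrapT => /eqP /hF.
have A0 : A = 0.
  have [i vi] : exists i, v 0 i != 0.
    apply/existsP; apply: contraR v_neq0 => /existsPn v0; apply/eqP/rowP => i.
    by rewrite mxE; apply/eqP/negbNE/v0.
  have [+ _] := AP i; rewrite F0 => /esym/eqP.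
  by rewrite mulf_eq0 (negPf vi) orbF => /eqP.
have D2 : D *m D = D.
  by rewrite mulmxBr mulmx1 mulmxBl mul1mx stab_proj_idem subrr subr0.
(* On the image of D the derivative of F at v is both 0 and N times the identity. *)
apply/row_matrixP => i; apply/rowP => j; have [_ /(_ (row i D))] := AP j.
rewrite A0 mul0r FD -mulmxA D2 -row_mul D2 => /eqP.
by rewrite mulf_eq0 pnatr_eq0 eqn0Ngt N0 /= => /eqP ->; rewrite !mxE.
Qed.

End Regular.

(** * Evaluation of harmonic equivariant maps at a free point *)

Section Evaluation.
Variables (C : numClosedFieldType) (gT : finGroupType) (G : {group gT}) (n : nat).
Variable rG : mx_representation C G n.
Local Notation S := {mpoly C[n]}.
Local Notation harm := (harm rG).
Variable v : 'rV[C]_n.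
Hypothesis v_free : forall g, g \in G -> v *m rG g = v -> g = 1%g.

Lemma equivariantZ m (rho : mx_representation C G m) c F :
  equivariant rG rho F -> equivariant rG rho (fun i => c *: F i).
Proof.
move=> eF g Gg i; rewrite actZ eF // scaler_sumr; apply: eq_bigr => j _.
by rewrite scalerA mulrC -scalerA.
Qed.

Lemma equivariantD m (rho : mx_representation C G m) F F' :
  equivariant rG rho F -> equivariant rG rho F' ->
  equivariant rG rho (fun i => F i + F' i).
Proof.
move=> eF eF' g Gg i; rewrite actD eF // eF' // -big_split.
by apply: eq_bigr => j _; rewrite scalerDr.
Qed.

Lemma equivariant0 m (rho : mx_representation C G m) : equivariant rG rho (fun=> 0).
Proof.
by move=> g Gg i; rewrite -(scale0r 0) actZ !scale0r big1 // => j _; rewrite scaler0.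
Qed.

(** When an equivariant map is expanded over harmonic ones, replacing each invariant coefficient by
    its value at v does not change the values at v. *)
Lemma harm_evaluation_surj m (rho : mx_representation C G m) (u : 'I_m -> C) :
  exists h, [/\ equivariant rG rho h, forall i, harm (h i) & forall i, ev v (h i) = u i].
Proof.
have [F eF Fu] := equivariant_value rho u v_free.
pose Q (F : 'I_m -> S) := exists h, [/\ equivariant rG rho h, forall i, harm (h i)
  & forall i, ev v (h i) = ev v (F i)].
suff [h [eh hh hF]] : Q F by exists h; split=> // i; rewrite hF.
have Q0 : Q (fun=> 0).
  by exists (fun=> 0); split=> // [|i]; [exact: equivariant0|exact: harmonic0].
have QD F1 F2 : Q F1 -> Q F2 -> Q (fun i => F1 i + F2 i).
  move=> [h1 [eh1 hh1 E1]] [h2 [eh2 hh2 E2]]; exists (fun i => h1 i + h2 i); split.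
  - exact: equivariantD.
  - by move=> i; rewrite -[h1 i]scale1r; apply: harmonic_lin.
  by move=> i; rewrite !rmorphD /= E1 E2.
have Qe e p : equivariant rG rho p -> (forall i, p i \is e.-homog) -> Q p.
  apply: (equivariant_ind (P := fun _ p => Q p)) => [_|d e' c h ci _ eh hh _]; first exact: QD.
  exists (fun i => ev v c *: h i); split.
  - exact: equivariantZ.
  - by move=> i; apply: harmonicZ.
  by move=> i; rewrite evZ rmorphM mulrC.
pose M := (\max_i msize (F i))%N.
have -> : F = fun i => \sum_(e <- iota 0 M) pihomog mdeg e (F i).
  apply/funext => i; rewrite -[M]subn0 big_mkord -pihomog_partitionE //.
  exact: (leq_bigmax (F := fun i => msize (F i))).
elim: (iota 0 M) => [|e s IHs]; first by under eq_fun do rewrite big_nil.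
under eq_fun do rewrite big_cons; apply: QD => //; apply: (Qe e) => [|i].
  exact: equivariant_pihomog.
exact: pihomogP.
Qed.

(** A count of dimensions: n maps span, and evaluation at v is onto a space of dimension n. *)
Lemma harm_evaluation_inj (rho : mx_representation C G n) (be : 'I_n -> 'I_n -> S) h :
    (forall h, equivariant rG rho h -> (forall i, harm (h i)) ->
      exists t : 'I_n -> C, forall i, h i = \sum_k t k *: be k i) ->
    equivariant rG rho h -> (forall i, harm (h i)) -> (forall i, ev v (h i) = 0) ->
  forall i, h i = 0.
Proof.
move=> span eh hh h0 i; pose E : 'M[C]_n := \matrix_(k, i) ev v (be k i).
have comb p (t : 'I_n -> C) : (forall i, p i = \sum_k t k *: be k i) ->
    \row_i ev v (p i) = (\row_k t k) *m E.
  move=> pE; apply/rowP => j; rewrite !mxE pE rmorph_sum; apply: eq_bigr => k _.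
  by rewrite /= evZ !mxE.
have Eunit : E \in unitmx.
  have H j : exists t : 'rV_n, t *m E = delta_mx 0 j.
    have [p [ep hp pu]] := harm_evaluation_surj rho (fun i => (i == j)%:R).
    have [t tE] := span p ep hp; exists (\row_k t k); rewrite -(comb _ _ tE).
    by apply/rowP => k; rewrite !mxE pu eqxx.
  have [T TE] := choice H; suff : (\matrix_j T j) *m E = 1%:M by case/mulmx1_unit.
  by apply/row_matrixP => j; rewrite row_mul rowK TE row1.
have [t tE] := span h eh hh; have tE0 := comb _ _ tE.
have t0 : \row_k t k = 0.
  rewrite -[LHS](mulmxK Eunit) -tE0 (_ : \row_i _ = 0) ?mul0mx //.
  by apply/rowP => j; rewrite !mxE h0.
rewrite tE big1 // => k _; have /rowP/(_ k) := t0.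
by rewrite !mxE => ->; rewrite scale0r.
Qed.

End Evaluation.

Section PairingDegree.
Variables (C : numClosedFieldType) (n d : nat).
Local Notation S := {mpoly C[n]}.

(** The components of s live in degrees 0 to d - 1 and those of p in degrees 1 to d, so the products
    live in degrees 1 to 2d - 1. *)
Lemma contraction_degrees (s p : 'I_n -> S) e :
    (forall a i, (d <= a)%N -> pihomog mdeg a (s i) = 0) ->
    (forall b i, (b == 0%N) || (d < b)%N -> pihomog mdeg b (p i) = 0) ->
    (e == 0%N) || (d.*2 <= e)%N ->
  pihomog mdeg e (\sum_i s i * p i) = 0.
Proof.
move=> s0 p0 ebad; rewrite linear_sum big1 // => i _.
rewrite {1}(pihomog_partitionE (leqnn (msize (s i)))).
rewrite {1}(pihomog_partitionE (leqnn (msize (p i)))).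
rewrite mulr_suml linear_sum big1 // => a _; rewrite mulr_sumr linear_sum big1 // => b _ /=.
have [da|ad] := leqP d a; first by rewrite s0 // mul0r linear0.
have [bb|] := boolP ((val b == 0%N) || (d < b)%N); first by rewrite p0 // mulr0 linear0.
rewrite negb_or -lt0n -leqNgt => /andP[b0 bd].
apply: (@pihomog_ne0 _ _ _ (a + b)%N); last by apply: dhomogM; apply: pihomogP.
apply: contraTneq ebad => <-; rewrite negb_or -lt0n -ltnNge addn_gt0 b0 orbT /=.
by rewrite -addnn -addSn leq_add.
Qed.

End PairingDegree.

Section Core.
Variables (C : numClosedFieldType) (gT : finGroupType) (G : {group gT}) (n : nat).
Variable rG : mx_representation C G n.
Local Notation S := {mpoly C[n]}.
Local Notation harm := (harm rG).
Local Notation dualG := (dual_rep rG).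

(** The duality statement in terms of polynomials alone. All degrees are polynomial degrees: maps
    from V lose one, whence e < d and the top degree [d.-1], and maps from V^* gain one, whence 0 <
    e <= d. The last clause identifies the projection p of a contraction with a dot product of
    values at v. *)
Theorem duality_evaluation (be phi : 'I_n -> 'I_n -> S) (d : nat) (bs : 'I_n -> S)
    (lam : 'rV[C]_n) :
    mx_faithful rG ->
    (forall k, equivariant rG rG (be k)) -> (forall k i, harm (be k i)) ->
    (forall h, equivariant rG rG h -> (forall i, harm (h i)) ->
      exists t : 'I_n -> C, forall i, h i = \sum_k t k *: be k i) ->
    (forall p, equivariant rG dualG p -> (forall i, harm (p i)) ->
      exists t : 'I_n -> C, forall i, p i = \sum_k t k *: phi k i) ->
    (forall e h, equivariant rG rG h -> (forall i, harm (h i)) ->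
      (forall i, h i \is e.-homog) -> (exists i, h i != 0) -> (e < d)%N) ->
    (forall e p, equivariant rG dualG p -> (forall i, harm (p i)) ->
      (forall i, p i \is e.-homog) -> (exists i, p i != 0) -> (0 < e <= d)%N) ->
    (forall p, equivariant rG dualG p -> (forall i, harm (p i)) ->
      (forall i, p i \is 1.-homog) -> exists a, forall i, p i = a *: 'X_i) ->
    (0 < d)%N ->
    equivariant rG rG bs -> (forall i, harm (bs i)) ->
    (forall i, bs i \is d.-1.-homog) -> (exists i, bs i != 0) ->
    (forall k i, pihomog mdeg d.-1 (be k i) = lam 0 k *: bs i) ->
  exists v : 'rV[C]_n,
  [/\ forall q, q \mPo basic_invariants be = 0 -> q = 0,
      (forall u : 'I_n -> C, exists h, [/\ equivariant rG rG h,
        forall i, harm (h i) & forall i, ev v (h i) = u i]) /\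
      (forall h, equivariant rG rG h -> (forall i, harm (h i)) ->
        (forall i, ev v (h i) = 0) -> forall i, h i = 0),
      (forall u : 'I_n -> C, exists p, [/\ equivariant rG dualG p,
        forall i, harm (p i) & forall i, ev v (p i) = u i]) /\
      (forall p, equivariant rG dualG p -> (forall i, harm (p i)) ->
        (forall i, ev v (p i) = 0) -> forall i, p i = 0)
    & forall s p, equivariant rG rG s -> (forall i, harm (s i)) ->
        equivariant rG dualG p -> (forall i, harm (p i)) ->
      exists2 q, \sum_i s i * p i = q \mPo basic_invariants be &
        \sum_k q@_U_(k)%MM * lam 0 k = \sum_i ev v (s i) * ev v (p i)].
Proof.
move=> faith be_equiv be_harm be_span phi_span degV dual_deg dual_deg1 d0.
move=> bs_equiv bs_harm bs_homog bs_neq0 be_top.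
have indep := alg_independent be_span faith.
have [v v_over] := lying_over be_equiv (inv_generated be_span) indep lam.
have [z zd] := prim_root_exists C d0.
(* By [top_component], [bs] is its own multiple by the value of its contraction at v; that value
   would be 0 at v = 0. *)
have v_neq0 : v != 0.
  apply/eqP => v0; have [i /eqP] := bs_neq0; apply.
  have := top_component be_span be_top v_over i bs_equiv bs_harm.
  rewrite pihomog_dE // => ->; rewrite rmorph_sum big1 ?scale0r // => j _.
  by rewrite rmorphM /= evX v0 mxE mulr0.
have ev0 := ev_inv_homog0 be_equiv be_harm be_span d0 bs_neq0 be_top v_over.
have v_free := regular_vector zd faith v_neq0 ev0 dual_deg dual_deg1.
exists v; split=> //.
- split=> [u|h eh hh]; first exact: harm_evaluation_surj.
  exact: harm_evaluation_inj be_span eh hh.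
- split=> [u|p ep hp]; first exact: harm_evaluation_surj.
  exact: harm_evaluation_inj phi_span ep hp.
move=> s p es hs ep hp; have fi := contraction_inv es ep.
have [q qE] := inv_generated be_span fi; exists q => //.
have <- : ev v (\sum_i s i * p i) = \sum_i ev v (s i) * ev v (p i).
  by rewrite rmorph_sum; apply: eq_bigr => i _; rewrite /= rmorphM.
apply/esym; apply: (ev_linear_part be_equiv be_harm be_span d0 bs_neq0 be_top v_over fi qE).
move=> e; apply: contraction_degrees => [a|b] i bad; apply: contrapT => /eqP nz.
  have := degV a _ (equivariant_pihomog a es) (fun i => harmonic_pihomog a (hs i))
    (fun i => pihomogP _ _ _) (ex_intro _ i nz).
  by rewrite ltnNge bad.
have := dual_deg b _ (equivariant_pihomog b ep) (fun i => harmonic_pihomog b (hp i))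
  (fun i => pihomogP _ _ _) (ex_intro _ i nz).
by case/andP => b0 bd; move: bad; rewrite eqn0Ngt b0 ltnNge bd.
Qed.

End Core.

(** A position in s amounts to a value together with a number of earlier occurrences; this labels
    the union of the bases of all graded pieces by the positions in the list of codegrees. *)
Lemma nth_count_mem (T : eqType) (x0 k : T) s j : (j < count_mem k s)%N ->
  exists i, [/\ (i < size s)%N, nth x0 s i = k & count_mem k (take i s) = j].
Proof.
elim: s j => //= x s IHs j; have [->|ne] := eqVneq x k.
  case: j => [_|j]; first by exists 0%N.
  rewrite add1n ltnS => /IHs[i [si ni ci]]; exists i.+1; split=> //=.
  by rewrite eqxx ci.
rewrite add0n => /IHs[i [si ni ci]]; exists i.+1; split=> //=.
by rewrite (negPf ne) ci.
Qed.

(** * Bases, perfect pairings and Schur's lemma *)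

Section LinearAlgebra.
Variable K : fieldType.

Lemma is_basis_span (M : lmodType K) (U : set M) m (b : 'I_m -> M) u :
  is_basis U b -> U u -> exists c : 'I_m -> K, u = \sum_i c i *: b i.
Proof. by move=> [_ span] /span[c [-> _]]; exists (c 0). Qed.

Lemma is_basis_free (M : lmodType K) (U : set M) m (b : 'I_m -> M) (c : 'I_m -> K) :
  is_basis U b -> U 0 -> \sum_i c i *: b i = 0 -> forall i, c i = 0.
Proof.
move=> [_ span] /span[c0 [_ uniq]] c_eq0 i.
have E1 : c0 = 0 by apply: uniq; rewrite big1 // => j _; rewrite mxE scale0r.
have E2 : c0 = \row_j c j.
  by apply: uniq; rewrite -[LHS]c_eq0; apply: eq_bigr => j _; rewrite mxE.
by have := congr1 (fun A : 'rV_m => A 0 i) E2; rewrite E1 !mxE => ->.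
Qed.

Lemma has_dim1 (M : lmodType K) (U : set M) (w : M) : w != 0 ->
  (forall u, U u <-> exists c, u = c *: w) -> has_dim U 1.
Proof.
move=> w0 Uw; exists (fun=> w); split=> [_|u /Uw[c ->]].
  by apply/Uw; exists 1; rewrite scale1r.
exists (\row_i c); split=> [|c']; rewrite big_ord1 ?mxE // => E.
apply/rowP => i; rewrite !ord1 !mxE; apply/eqP; rewrite -subr_eq0.
by have /eqP := E; rewrite -subr_eq0 -scalerBl scaler_eq0 (negPf w0) orbF.
Qed.

Section PerfectPairing.
Variables (M N L : lmodType K) (U : set M) (V : set N) (T : set L) (n : nat).
Variables (E1 : M -> 'rV[K]_n) (E2 : N -> 'rV[K]_n) (w : L) (B : M -> N -> L).
Hypothesis w_neq0 : w != 0.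
Hypothesis TP : forall t, T t <-> exists c, t = c *: w.
Hypothesis BE : forall x y, U x -> V y -> B x y = (\sum_i E1 x 0 i * E2 y 0 i) *: w.
Hypothesis U_lin : forall c x y, U x -> U y -> U (c *: x + y).
Hypothesis V_lin : forall c x y, V x -> V y -> V (c *: x + y).
Hypothesis E1_lin : forall c x y, U x -> U y -> E1 (c *: x + y) = c *: E1 x + E1 y.
Hypothesis E2_lin : forall c x y, V x -> V y -> E2 (c *: x + y) = c *: E2 x + E2 y.
Hypothesis E1_inj : forall x, U x -> E1 x = 0 -> x = 0.
Hypothesis E2_inj : forall x, V x -> E2 x = 0 -> x = 0.
Hypothesis E1_surj : forall r, exists2 x, U x & E1 x = r.
Hypothesis E2_surj : forall r, exists2 x, V x & E2 x = r.

Lemma pairing_linear_onr x : U x -> linear_on V T (B x).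
Proof.
move=> Ux; split=> [y Vy|c y y' Vy Vy'].
  by rewrite BE //; apply/TP; eexists.
rewrite !BE //; last exact: V_lin.
rewrite scalerA -scalerDl E2_lin // mulr_sumr -big_split /=; congr (_ *: _).
by apply: eq_bigr => i _; rewrite !mxE mulrDr mulrCA.
Qed.

(** The coordinates of x are prescribed by the coefficients of f, with respect to w, on the elements
    whose [E2] is a standard basis vector. *)
Lemma pairing_represents (f : N -> L) : linear_on V T f ->
  exists! x, U x /\ forall y, V y -> B x y = f y.
Proof.
move=> [fT f_lin].
have E1B x y : U x -> U y -> E1 x = E1 y -> x = y.
  move=> Ux Uy xy; apply/eqP; rewrite -subr_eq0 addrC -scaleN1r; apply/eqP/E1_inj.
    exact: U_lin.
  by rewrite E1_lin // xy scaleN1r addNr.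
have E2B x y : V x -> V y -> E2 x = E2 y -> x = y.
  move=> Vx Vy xy; apply/eqP; rewrite -subr_eq0 addrC -scaleN1r; apply/eqP/E2_inj.
    exact: V_lin.
  by rewrite E2_lin // xy scaleN1r addNr.
have V0 : V 0.
  by have [y Vy _] := E2_surj 0; have := V_lin (-1) Vy Vy; rewrite scaleN1r addNr.
have f0 : f 0 = 0.
  by have := f_lin (-1) 0 0 V0 V0; rewrite !scaleN1r !addNr.
have E20 : E2 0 = 0 by have := E2_lin (-1) V0 V0; rewrite !scaleN1r !addNr.
have H k : exists p : N * K, [/\ V p.1, E2 p.1 = delta_mx 0 k & f p.1 = p.2 *: w].
  have [y Vy Ey] := E2_surj (delta_mx 0 k).
  by have [c fc] := (TP _).1 (fT _ Vy); exists (y, c).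
have [p pP] := choice H.
have [x Ux Ex] := E1_surj (\row_k (p k).2).
have BxE y : V y -> B x y = f y.
  move=> Vy; pose g (s : seq 'I_n) := \sum_(k <- s) E2 y 0 k *: (p k).1.
  have gP s : [/\ V (g s), E2 (g s) = \sum_(k <- s) E2 y 0 k *: delta_mx 0 k
      & f (g s) = (\sum_(k <- s) E2 y 0 k * (p k).2) *: w].
    elim: s => [|k s [Vg Eg fg]]; first by rewrite /g !big_nil scale0r.
    have [Vk Ek fk] := pP k; rewrite /g !big_cons -/(g s); split.
    - exact: V_lin.
    - by rewrite E2_lin // Ek Eg.
    by rewrite f_lin // fk fg scalerA -scalerDl.
  have [Vg Eg fg] := gP (index_enum 'I_n); rewrite -(E2B _ _ Vg Vy) ?fg.
    rewrite BE // Eg -row_sum_delta Ex; congr (_ *: _); apply: eq_bigr => k _.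
    by rewrite !mxE mulrC.
  by rewrite Eg -row_sum_delta.
exists x; split=> // x' [Ux' Bx']; apply: E1B => //; apply/rowP => k.
have [Vk Ek fk] := pP k; have := Bx' _ Vk; rewrite -BxE // !BE // Ek.
have pick z : \sum_i E1 z 0 i * (delta_mx 0 k : 'rV[K]_n) 0 i = E1 z 0 k.
  rewrite (bigD1 k) //= mxE !eqxx mulr1 big1 ?addr0 // => j jk.
  by rewrite mxE (negPf jk) andbF mulr0.
rewrite !pick => /eqP; rewrite -subr_eq0 -scalerBl scaler_eq0 (negPf w_neq0) orbF.
by rewrite subr_eq0 => /eqP ->.
Qed.

End PerfectPairing.

Lemma perfect_pairing_coordinates (M N L : lmodType K) (U : set M) (V : set N)
    (T : set L) n (E1 : M -> 'rV[K]_n) (E2 : N -> 'rV[K]_n) (w : L) (B : M -> N -> L) :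
  w != 0 -> (forall t, T t <-> exists c, t = c *: w) ->
  (forall x y, U x -> V y -> B x y = (\sum_i E1 x 0 i * E2 y 0 i) *: w) ->
  (forall c x y, U x -> U y -> U (c *: x + y)) ->
  (forall c x y, V x -> V y -> V (c *: x + y)) ->
  (forall c x y, U x -> U y -> E1 (c *: x + y) = c *: E1 x + E1 y) ->
  (forall c x y, V x -> V y -> E2 (c *: x + y) = c *: E2 x + E2 y) ->
  (forall x, U x -> E1 x = 0 -> x = 0) -> (forall x, V x -> E2 x = 0 -> x = 0) ->
  (forall r, exists2 x, U x & E1 x = r) -> (forall r, exists2 x, V x & E2 x = r) ->
  perfect_pairing U V T B.
Proof.
move=> w0 TP BE Ul Vl E1l E2l E1i E2i E1s E2s.
have BE' y x : V y -> U x -> B x y = (\sum_i E2 y 0 i * E1 x 0 i) *: w.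
  by move=> Vy Ux; rewrite BE //; congr (_ *: _); apply: eq_bigr => i _; rewrite mulrC.
split.
- by move=> x Ux; exact: (pairing_linear_onr TP BE Vl E2l Ux).
- by move=> y Vy; exact: (pairing_linear_onr (B := fun y x => B x y) TP BE' Ul E1l Vy).
- by move=> f; exact: (pairing_represents w0 TP BE Ul Vl E1l E2l E1i E2i E1s E2s).
move=> f; exact: (pairing_represents (B := fun y x => B x y)
  w0 TP BE' Vl Ul E2l E1l E2i E1i E2s E1s).
Qed.

End LinearAlgebra.

(** For an eigenvalue a of A, the matrix [A - a%:M] commutes with W and is not invertible, hence is
    0. *)
Lemma schur_scalar (C : numClosedFieldType) (gT : finGroupType) (G : {group gT}) n
    (rG : mx_representation C G n) (A : 'M[C]_n) :
  mx_irreducible rG -> (forall g, g \in G -> A *m rG g = rG g *m A) ->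
  exists a, A = a%:M.
Proof.
move=> irr comm; have n0 : (0 < n)%N.
  case: irr => _ nz _; rewrite lt0n; apply: contra nz => /eqP n0.
  by apply/eqP/matrixP => i; have := ltn_ord i; rewrite {2}n0.
have /closed_rootP[a ra] : size (char_poly A) != 1%N.
  by rewrite size_char_poly eqSS -lt0n.
exists a; apply/eqP; rewrite -subr_eq0; apply: contraT => nz.
have : A - a%:M \in unitmx.
  apply: (mx_Schur irr) => //; apply/centgmxP => g Gg.
  by rewrite mulmxBl mulmxBr comm // scalar_mxC.
have : eigenvalue A a by rewrite eigenvalue_root_char.
case/eigenvalueP => u uA u0 /mulmxK /(_ u); rewrite /= mulmxBr uA mul_mx_scalar subrr.
by rewrite mul0mx => /esym/eqP; rewrite (negPf u0).
Qed.

(** * From harmonic polynomials to coinvariants *)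

Section Coinvariants.
Variables (R : realType) (gT : finGroupType) (G : {group gT}) (n : nat).
Local Notation C := (R[i])%C.
Variable rG : mx_representation C G n.
Local Notation S := {mpoly C[n]}.
Local Notation pi := (coinv_pi rG).
Local Notation harm := (harm rG).

Lemma coinv_piL c f g : pi (c *: f + g) = c *: pi f + pi g.
Proof. by rewrite coinv_piD -mul_mpolyC coinv_piM. Qed.

Lemma coinv_pi0 : pi 0 = 0.
Proof. by apply: (@addrI _ (pi 0)); rewrite -coinv_piD !addr0. Qed.

Lemma coinv_pi_eq f g : pi f = pi g <-> coinv_ideal_prop rG (f - g).
Proof.
split=> [fg|]; last first.
  by move=> h; apply/eqP; rewrite -(@Quotient.idealrBE _ (coinv_idealr rG)); apply/asboolP.
by apply/asboolP; rewrite -[asbool _]/(f - g \in coinv_idealr rG) Quotient.idealrBE; apply/eqP.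
Qed.

Lemma harm_pi_inj f g : harm f -> harm g -> pi f = pi g -> f = g.
Proof.
move=> hf hg /coinv_pi_eq fg; apply/eqP; rewrite -subr_eq0; apply/eqP.
apply: (@harmonic_inv_ideal _ _ _ _ rG) => //.
by rewrite addrC -scaleN1r; apply: harmonic_lin.
Qed.

Lemma harm_pi_surj_homog e f : f \is e.-homog ->
  exists h, [/\ harm h, h \is e.-homog & pi h = pi f].
Proof.
move=> fe; have [c hc] := harmonic_decomposition rG fe.
eexists; split; first exact: hc.
  rewrite rpredB // big_seq rpred_sum // => t; rewrite mixed_indexP => /andP[/eqP <- _].
  by rewrite rpredZ // mixed_homog.
apply/coinv_pi_eq; rewrite addrAC subrr add0r.
exists [seq (- c t *: 'X_[t.1], reynolds rG 'X_[t.2]) | t <- mixed_index n e]; split.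
  move=> x /mapP[t]; rewrite mixed_indexP => /andP[_ t2] ->; split.
    exact: reynolds_inv.
  have : reynolds rG 'X_[t.2] \is (mdeg t.2).-homog by apply: reynolds_homog; rewrite dhomogX.
  by move/dhomog_nemf_coeff; apply; rewrite /= mdeg0 eq_sym mdeg_eq0.
rewrite big_map -sumrN; apply: eq_bigr => t _ /=.
by rewrite -scalerAl scaleNr.
Qed.

Lemma harm_pi_surj a : exists h, harm h /\ pi h = a.
Proof.
have [f <-] : exists f, pi f = a by exists (coinv_repr a); exact: reprK.
rewrite (pihomog_partitionE (leqnn (msize f))).
elim/big_rec: _ => [|e x _ [h [hh hx]]]; first by exists 0; split=> //; exact: harmonic0.
have [k [hk _ kE]] := harm_pi_surj_homog (pihomogP mdeg e f).
exists (k + h); split; first by rewrite -[k]scale1r; apply: harmonic_lin.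
by rewrite !coinv_piD kE hx.
Qed.

Local Notation lift := (harmonic_lift (rG := rG)).

Lemma lift_spec a : harm (lift a) /\ pi (lift a) = a.
Proof.
have [h hP] := harm_pi_surj a.
exact: (xgetPex 0 (ex_intro (fun h => harmonic rG h /\ pi h = a) h hP)).
Qed.

Lemma lift_harm a : harm (lift a). Proof. by case: (lift_spec a). Qed.
Lemma liftK a : pi (lift a) = a. Proof. by case: (lift_spec a). Qed.

Lemma lift_pi h : harm h -> lift (pi h) = h.
Proof. by move=> hh; apply: harm_pi_inj => //; [exact: lift_harm|exact: liftK]. Qed.

Lemma lift_lin c a b : lift (c *: a + b) = c *: lift a + lift b.
Proof.
apply: harm_pi_inj; first exact: lift_harm.
  by apply: harmonic_lin; apply: lift_harm.
by rewrite coinv_piL !liftK.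
Qed.

Lemma pi_act g f : g \in G -> act_coinv g (pi f) = pi (actS rG g f).
Proof.
move=> Gg; apply/coinv_pi_eq.
have /coinv_pi_eq[s [sP E]] : pi (coinv_repr (pi f)) = pi f by exact: reprK.
exists [seq (actS rG g x.1, x.2) | x <- s]; split.
  by move=> x /mapP[y /sP[y1 y2] ->]; split.
rewrite -[X in X - _]/(act rG g _) -[X in _ - X]/(act rG g _).
rewrite -actB E act_sum big_map; apply: eq_big_seq => x /sP[xi _].
by rewrite actMr [act rG g x.2]xi.
Qed.

Lemma lift_act g a : g \in G -> lift (act_coinv g a) = act rG g (lift a).
Proof.
move=> Gg; rewrite -{1}(liftK a) pi_act // lift_pi //.
by apply: harmonic_act => //; apply: lift_harm.
Qed.

End Coinvariants.

(** * Equivariant linear maps, their coordinate tuples and their degrees *)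

Section LinearMaps.
Variables (K : fieldType) (L : lmodType K).

Lemma linear_fun0 (M : lmodType K) (s : M -> L) : linear s -> s 0 = 0.
Proof. by move=> ls; have := ls (-1) 0 0; rewrite !scaleN1r !addNr. Qed.

Lemma linear_rowE m (s : 'rV[K]_m -> L) x : linear s ->
  s x = \sum_i x 0 i *: s (delta_mx 0 i).
Proof.
move=> ls; rewrite {1}[x]row_sum_delta; elim: (index_enum _) => [|i r IHr].
  by rewrite !big_nil linear_fun0.
by rewrite !big_cons ls IHr.
Qed.

Lemma sum_row_linear m (h : 'I_m -> L) : linear (fun x : 'rV[K]_m => \sum_i x 0 i *: h i).
Proof.
move=> c x y; rewrite scaler_sumr -big_split; apply: eq_bigr => i _ /=.
by rewrite !mxE scalerDl scalerA.
Qed.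

Lemma sum_row_delta m (h : 'I_m -> L) i :
  \sum_j (delta_mx 0 i : 'rV[K]_m) 0 j *: h j = h i.
Proof.
rewrite (bigD1 i) //= mxE !eqxx scale1r big1 ?addr0 // => j ji.
by rewrite mxE (negPf ji) andbF scale0r.
Qed.

Lemma has_dim0 (U : set L) u : has_dim U 0 -> U u -> u = 0.
Proof. by move=> [b bb] Uu; have [c ->] := is_basis_span bb Uu; rewrite big_ord0. Qed.

Lemma has_dim_gt0 (U : set L) m : U 0 -> (0 < m)%N -> has_dim U m ->
  exists u, U u /\ u != 0.
Proof.
move=> U0; case: m => // m _ [b bb]; exists (b ord0); split; first exact: bb.1.
apply/eqP => b0; have := is_basis_free (c := fun i => (i == ord0)%:R) bb U0.
rewrite (bigD1 ord0) //= b0 scaler0 add0r big1 => [|i /negPf ->]; last by rewrite scale0r.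
by move=> /(_ erefl ord0) /eqP; rewrite oner_eq0.
Qed.

Lemma has_dim_le1 (U : set L) m t : U 0 -> has_dim U m ->
  (forall u, U u -> exists c, u = c *: t) -> (m <= 1)%N.
Proof.
move=> U0 [b bb] Ut; case: m b bb => [//|[//|m]] b bb.
have [c0 E0] := Ut _ (bb.1 ord0); have [c1 E1] := Ut _ (bb.1 (lift ord0 ord0)).
have free (x0 x1 : K) : x0 * c0 + x1 * c1 = 0 -> x0 = 0 /\ x1 = 0.
  move=> x01; have := is_basis_free (c := fun i => if i == ord0 then x0 else
     if i == lift ord0 ord0 then x1 else 0) bb U0.
  rewrite (bigD1 ord0) // (bigD1 (lift ord0 ord0)) //= E0 E1 big1 ?addr0.
    rewrite !scalerA -scalerDl x01 scale0r => /(_ erefl) F.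
    by split; [have := F ord0|have := F (lift ord0 ord0)].
  by move=> i /andP[/negPf -> /negPf ->]; rewrite scale0r.
have [c10 _] : c1 = 0 /\ - c0 = 0 by apply: free; rewrite mulrC mulNr subrr.
have [_ /eqP] : 0 = 0 :> K /\ 1 = 0 :> K by apply: free; rewrite c10 mul0r mulr0 addr0.
by rewrite oner_eq0.
Qed.

End LinearMaps.

Section EquivariantMaps.
Variables (C : numClosedFieldType) (gT : finGroupType) (G : {group gT}) (n : nat).
Variable rG : mx_representation C G n.
Local Notation S := {mpoly C[n]}.
Local Notation harm := (harm rG).
Variables (m : nat) (rho : mx_representation C G m).

(** The common form of [HomV_H] and, up to transposing column vectors, [HomVdual_H]. *)
Definition homH (s : 'rV[C]_m -> S) : Prop :=
  [/\ linear s, forall x, harm (s x)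
    & forall g, g \in G -> forall x, s (x *m rho g) = act rG g (s x)].

Definition linear_ext (h : 'I_m -> S) (x : 'rV[C]_m) : S := \sum_i x 0 i *: h i.

Lemma homH_equiv s : homH s -> equivariant rG rho (fun i => s (delta_mx 0 i)).
Proof.
move=> [ls _ es] g Gg i; rewrite -es // linear_rowE //; apply: eq_bigr => j _.
by rewrite -rowE mxE.
Qed.

Lemma homH_harm s i : homH s -> harm (s (delta_mx 0 i)).
Proof. by case. Qed.

Lemma homH_linear_ext h : equivariant rG rho h -> (forall i, harm (h i)) ->
  homH (linear_ext h).
Proof.
move=> eh hh; split=> [|x|g Gg x]; first exact: sum_row_linear.
  by apply: harmonic_sum => i _; apply: harmonicZ.
rewrite /linear_ext act_sum.
under [RHS]eq_bigr => i _ do rewrite actZ eh // scaler_sumr.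
rewrite exchange_big; apply: eq_bigr => j _ /=.
rewrite mxE scaler_suml; apply: eq_bigr => i _.
by rewrite scalerA.
Qed.

Lemma homHE s x : homH s -> s x = linear_ext (fun i => s (delta_mx 0 i)) x.
Proof. by case=> ls _ _; apply: linear_rowE. Qed.

Lemma homH_lin c s s' : homH s -> homH s' -> homH (fun x => c *: s x + s' x).
Proof.
move=> [ls hs es] [ls' hs' es']; split=> [a x y|x|g Gg x].
- by rewrite ls ls' !scalerDr !scalerA addrACA mulrC.
- exact: harmonic_lin.
by rewrite es // es' // actD actZ.
Qed.

Lemma homH_pihomog e s : homH s -> homH (fun x => pihomog mdeg e (s x)).
Proof.
move=> [ls hs es]; split=> [a x y|x|g Gg x].
- by rewrite ls linearP.
- exact: harmonic_pihomog.
by rewrite es // pihomog_act.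
Qed.

Lemma linear_ext_homog e h x : (forall i, h i \is e.-homog) -> linear_ext h x \is e.-homog.
Proof. by move=> he; apply: rpred_sum => i _; apply: rpredZ. Qed.

End EquivariantMaps.

Section DualDegreeOne.
Variables (C : numClosedFieldType) (gT : finGroupType) (G : {group gT}) (n : nat).
Variable rG : mx_representation C G n.
Local Notation S := {mpoly C[n]}.

(** The coefficient matrix of p commutes with the dual representation, so its transpose is scalar by
    Schur's lemma. *)
Lemma dual_equivariant_linear (p : 'I_n -> S) : mx_irreducible rG ->
    equivariant rG (dual_rep rG) p -> (forall i, p i \is 1.-homog) ->
  exists a, forall i, p i = a *: 'X_i.
Proof.
move=> irr ep p1; pose A : 'M[C]_n := \matrix_(i, j) (p i)@_U_(j)%MM.
have pE i : p i = \sum_j A i j *: 'X_j.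
  by rewrite {1}(homog1E (p1 i)); apply: eq_bigr => j _; rewrite mxE.
have coefX (c : 'I_n -> C) j : (\sum_k c k *: ('X_k : S))@_U_(j)%MM = c j.
  rewrite raddf_sum (bigD1 j) //= mcoeffZ mcoeffX eqxx mulr1 big1 ?addr0 // => k kj.
  by rewrite mcoeffZ mcoeffX eq_mnm1 (negPf kj) mulr0.
have comm g : g \in G -> A *m dual_rep rG g = dual_rep rG g *m A.
  move=> Gg; apply/matrixP => i j; have := ep g Gg i.
  rewrite pE act_sum; under eq_bigr => k _ do rewrite actZ actX scaler_sumr.
  rewrite exchange_big /=; under eq_bigr => k _.
    under eq_bigr => l _ do rewrite scalerA.
    rewrite -scaler_suml; over.
  under [X in _ = X -> _]eq_bigr => k _ do rewrite pE scaler_sumr.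
  rewrite [X in _ = X -> _]exchange_big /=.
  under [X in _ = X -> _]eq_bigr => k _.
    under eq_bigr => l _ do rewrite scalerA.
    rewrite -scaler_suml; over.
  by move/(congr1 (mcoeff U_(j)%MM)); rewrite !coefX !mxE.
have [a Aa] : exists a, A^T = a%:M.
  apply: (schur_scalar irr) => g Gg; have := comm g^-1%g.
  rewrite groupV => /(_ Gg) /(congr1 trmx); rewrite !trmx_mul /= trmxK invgK.
  by move=> ->.
exists a => i; rewrite pE -[A]trmxK Aa tr_scalar_mx (bigD1 i) //= mxE eqxx.
by rewrite big1 ?addr0 // => j ji; rewrite mxE eq_sym (negPf ji) scale0r.
Qed.

End DualDegreeOne.

Section Transfer.
Variables (R : realType) (gT : finGroupType) (G : {group gT}) (n : nat).
Local Notation C := (R[i])%C.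
Variable rG : mx_representation C G n.
Local Notation pi := (coinv_pi rG).
Local Notation lift := (harmonic_lift (rG := rG)).

Lemma HomV_HE s : HomV_H rG s <-> homH rG rG s.
Proof. by []. Qed.

Lemma linear_trmx (L : lmodType C) (p : 'cV[C]_n -> L) :
  linear p <-> linear (fun x : 'rV[C]_n => p x^T).
Proof.
split=> lp c x y; first by rewrite linearP lp.
by have := lp c x^T y^T; rewrite -[c *: _ + _ in LHS]trmxK linearP /= !trmxK.
Qed.

Lemma dual_act_trmx g x : dual_act rG g x^T = (x *m dual_rep rG g)^T.
Proof. by rewrite trmx_mul trmxK. Qed.

Lemma HomVdual_HE p : HomVdual_H rG p <-> homH rG (dual_rep rG) (fun x => p x^T).
Proof.
split=> [[lp hp ep]|[lp hp ep]]; split=> [|x|g Gg x]; try exact/linear_trmx.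
- exact: hp.
- by rewrite -dual_act_trmx ep.
- by have := hp x^T; rewrite trmxK.
by have := ep g Gg x^T; rewrite -dual_act_trmx trmxK.
Qed.

Lemma lift_homA m (rho : mx_representation C G m) (s : 'rV[C]_m -> coinv rG) :
    linear s -> (forall g, g \in G -> forall x, s (x *m rho g) = act_coinv g (s x)) ->
  homH rG rho (fun x => lift (s x)).
Proof.
move=> ls es; split=> [c x y|x|g Gg x]; first by rewrite ls lift_lin.
  exact: lift_harm.
by rewrite es // lift_act.
Qed.

Lemma pi_homH_linear m (rho : mx_representation C G m) s : homH rG rho s ->
  linear (fun x => pi (s x)).
Proof. by move=> [ls _ _] c x y; rewrite ls coinv_piL. Qed.

Lemma pi_homH_act m (rho : mx_representation C G m) s : homH rG rho s ->
  forall g, g \in G -> forall x, pi (s (x *m rho g)) = act_coinv g (pi (s x)).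
Proof. by move=> [_ _ es] g Gg x; rewrite (es g Gg x); apply/esym/pi_act. Qed.

Lemma HomV_A_lift s : HomV_A rG s -> homH rG rG (fun x => lift (s x)).
Proof. by case=> ls es; apply: lift_homA. Qed.

Lemma HomV_A_pi s : homH rG rG s -> HomV_A rG (fun x => pi (s x)).
Proof. by move=> hs; split; [exact: pi_homH_linear hs|exact: pi_homH_act hs]. Qed.

Lemma HomVdual_A_lift p : HomVdual_A rG p ->
  homH rG (dual_rep rG) (fun x => lift (p x^T)).
Proof.
case=> lp ep; apply: (lift_homA (s := fun x => p x^T)); first exact/linear_trmx.
by move=> g Gg x; rewrite -dual_act_trmx ep.
Qed.

Lemma HomVdual_A_pi p : homH rG (dual_rep rG) p ->
  HomVdual_A rG (fun l => pi (p l^T)).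
Proof.
move=> hp; split.
  apply/linear_trmx; have := pi_homH_linear hp.
  by under [X in _ -> linear X]eq_fun do rewrite trmxK.
move=> g Gg l; rewrite -{1}[l]trmxK dual_act_trmx trmxK.
exact: (pi_homH_act hp).
Qed.

Lemma lift_homog e a : coinv_deg (rG := rG) e%:Z a -> lift a \is e.-homog.
Proof.
case=> f /= fe <-; have [h [hh he <-]] := harm_pi_surj_homog rG fe.
by rewrite lift_pi.
Qed.

End Transfer.

Lemma last_ge (s : seq int) k : sorted <=%O s -> k \in s -> (k <= last 0 s)%O.
Proof.
case: s => // x s; rewrite /= => ss ks.
elim: s x k ss ks => [|y s IHs] x k /=.
  by move=> _; rewrite inE => /eqP ->.
case/andP=> xy ys; rewrite in_cons => /orP[/eqP ->|]; last exact: IHs.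
by apply: le_trans xy _; apply: IHs => //; apply: mem_head.
Qed.

Section Degrees.
Variables (R : realType) (gT : finGroupType) (G : {group gT}) (n : nat).
Local Notation C := (R[i])%C.
Variable rG : mx_representation C G n.
Local Notation S := {mpoly C[n]}.
Local Notation harm := (harm rG).
Local Notation dualG := (dual_rep rG).

Lemma S_deg0 k : S_deg k (0 : S).
Proof. by case: k => // e; apply: rpred0. Qed.

Lemma homH0 m (rho : mx_representation C G m) : homH rG rho (fun=> 0).
Proof.
split=> [c x y|x|g Gg x]; first by rewrite scaler0 addr0.
  exact: harmonic0.
by rewrite -(scale0r 0) actZ !scale0r.
Qed.

Lemma HomV_H_deg0 k : HomV_H_deg rG k 0.
Proof. by split; [exact: (homH0 rG)|move=> x; exact: S_deg0]. Qed.

Lemma HomVdual_H_deg0 k : HomVdual_H_deg rG k 0.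
Proof. by split; [exact/HomVdual_HE/homH0|move=> x; exact: S_deg0]. Qed.

Lemma linear_ext_HomV e h : equivariant rG rG h -> (forall i, harm (h i)) ->
  (forall i, h i \is e.-homog) -> HomV_H_deg rG e.+1%:Z (linear_ext h).
Proof.
move=> eh hh he; split; first exact: homH_linear_ext.
move=> x; have -> : e.+1%:Z - 1 = e%:Z by lia.
exact: linear_ext_homog.
Qed.

Lemma linear_ext_HomVdual e p : equivariant rG dualG p -> (forall i, harm (p i)) ->
  (forall i, p i \is e.-homog) ->
  HomVdual_H_deg rG (e%:Z - 1) (fun l => linear_ext p l^T).
Proof.
move=> ep hp he; split.
  have := homH_linear_ext ep hp => H; apply/HomVdual_HE.
  by under [X in homH _ _ X]eq_fun do rewrite trmxK.
by move=> l /=; rewrite subrK; apply: linear_ext_homog.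
Qed.

Lemma HomV_H_deg_gt0 k s : HomV_H_deg rG k s -> s != 0 -> 0 < k.
Proof.
move=> [_ sk] s0; rewrite ltNge; apply: contra s0 => k0; apply/eqP/funext => x.
have := sk x; rewrite /S_deg /=; case E : (k - 1) => [e|e] //; lia.
Qed.

Variables ds cs : n.-tuple int.
Hypothesis irr : mx_irreducible rG.
Hypothesis hdual : duality_group rG ds cs.

(** With D the highest degree, the codegrees are the D - k for k a degree: the bounds 0 < k <= D on
    degrees become 0 <= k < D on codegrees, and D is as frequent among the degrees as 0 among the
    codegrees. *)
Lemma duality_group_degrees : exists d : nat,
  [/\ (0 < d)%N, highest_degree ds = d%:Z,
      (forall k s, HomV_H_deg rG k s -> s != 0 -> k <= d%:Z),
      (forall k p, HomVdual_H_deg rG k p -> p != 0 -> 0 <= k < d%:Z)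
    & has_dim (HomV_H_deg rG d%:Z) 1].
Proof.
have n0 : (0 < n)%N.
  case: irr => _ nz _; rewrite lt0n; apply: contra nz => /eqP n0.
  by apply/eqP/matrixP => i; have := ltn_ord i; rewrite {2}n0.
case: hdual => -[ds_sort ds_dim] [_ cs_dim] dual.
set D := highest_degree ds in dual *.
have D_in : D \in ds.
  suff : last 0 (tval ds) \in tval ds by [].
  have := size_tuple ds; case: (tval ds) => [|x s _]; last exact: (mem_last x s).
  by move=> E; rewrite -E in n0.
have D_max k : k \in ds -> k <= D by apply: last_ge.
have ds_gt0 k : k \in ds -> 0 < k.
  move=> kds; have [|s [sk s0]] := has_dim_gt0 (HomV_H_deg0 k) _ (ds_dim k).
    by rewrite -has_count has_pred1.
  exact: HomV_H_deg_gt0 sk s0.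
have cs_ds : tval cs = [seq D - k | k <- ds].
  have -> : [seq D - k | k <- ds] = tval [tuple of map (fun k => D - k) ds] by [].
  congr tval; apply: eq_from_tnth => i; rewrite tnth_map -(dual i).
  by rewrite addrC addKr.
have D0 := ds_gt0 D D_in.
exists `|D|%N; have DE : D = `|D|%N%:Z by lia.
rewrite -DE; split=> //; first by lia.
- move=> k s sk s0; apply: D_max; apply: contraT => kds; case/eqP: s0.
  apply: (has_dim0 _ sk); have := ds_dim k.
  by have /count_memPn -> := kds.
- move=> k p pk p0; have : k \in tval cs.
    apply: contraT => kcs; case/eqP: p0; apply: (has_dim0 _ pk).
    by have := cs_dim k; have /count_memPn -> := kcs.
  rewrite cs_ds => /mapP[k' k'ds ->]; have := D_max _ k'ds.
  have := ds_gt0 _ k'ds; lia.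
have cE : count_mem 0 cs = count_mem D ds.
  rewrite [count _ _](congr1 (count_mem 0) cs_ds) count_map.
  by apply: eq_count => k /=; rewrite subr_eq0 eq_sym.
suff E : count_mem D ds = 1%N by have := ds_dim D; rewrite E.
apply/eqP; rewrite eqn_leq -has_count has_pred1 D_in andbT -cE.
(* The Euler field: in codegree 0 the images are linear forms, and every such map is a multiple of
   t. *)
pose t (l : 'cV[C]_n) : S := linear_ext (fun i => 'X_i) l^T.
apply: (has_dim_le1 (t := t) (HomVdual_H_deg0 0) (cs_dim 0)) => p [/HomVdual_HE hp p1].
have [|a pE] := @dual_equivariant_linear _ _ _ _ rG _ irr (homH_equiv hp).
  by move=> i; have := p1 (delta_mx 0 i)^T.
exists a; apply/funext => l; transitivity (a *: t l); last by [].
rewrite -{1}[l]trmxK [LHS](homHE l^T hp) /t /linear_ext scaler_sumr.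
by apply: eq_bigr => i _; rewrite pE !scalerA mulrC.
Qed.

End Degrees.

Section DualSpan.
Variables (R : realType) (gT : finGroupType) (G : {group gT}) (n : nat).
Local Notation C := (R[i])%C.
Variable rG : mx_representation C G n.
Local Notation S := {mpoly C[n]}.
Local Notation harm := (harm rG).
Local Notation dualG := (dual_rep rG).

(** The bases of the graded pieces are put together along [cs]: the k-th tuple is taken from the
    piece of the k-th codegree, at the index given by the number of earlier occurrences of that
    codegree. *)
Lemma dual_span (cs : n.-tuple int) : is_codegrees rG cs ->
  exists phi : 'I_n -> 'I_n -> S, forall p, equivariant rG dualG p ->
    (forall i, harm (p i)) ->
  exists t : 'I_n -> C, forall i, p i = \sum_k t k *: phi k i.
Proof.
case=> _ cs_dim.
have H k : exists b : nat -> 'I_n -> S, forall u, HomVdual_H_deg rG k u ->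
    exists c : nat -> C, forall i,
      u (delta_mx i 0) = \sum_(j < count_mem k cs) c j *: b j i.
  have [b bb] := cs_dim k.
  (* The length of the basis depends on k, so it is indexed by all natural numbers, with 0 beyond
     its end. *)
  exists (fun j i => if insub j is Some j' then b j' (delta_mx i 0) else 0) => u.
  move=> /(is_basis_span bb)[c uE].
  exists (fun j => if insub j is Some j' then c j' else 0) => i.
  by rewrite uE fct_sumE; apply: eq_bigr => j _; rewrite valK.
have [B BP] := choice H.
pose phi (k i : 'I_n) := B (tnth cs k) (count_mem (tnth cs k) (take k cs)) i.
exists phi => p ep hp.
pose spanned (p : 'I_n -> S) :=
  exists t : 'I_n -> C, forall i, p i = \sum_k t k *: phi k i.
have sp0 : spanned (fun=> 0).
  by exists (fun=> 0) => i; rewrite big1 // => k _; rewrite scale0r.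
have spL c p1 p2 : spanned p1 -> spanned p2 -> spanned (fun i => c *: p1 i + p2 i).
  move=> [t1 E1] [t2 E2]; exists (fun k => c * t1 k + t2 k) => i.
  rewrite E1 E2 scaler_sumr -big_split; apply: eq_bigr => k _ /=.
  by rewrite scalerDl scalerA.
have spphi k : spanned (phi k).
  exists (fun j => (j == k)%:R) => i; rewrite (bigD1 k) //= eqxx scale1r.
  by rewrite big1 ?addr0 // => j /negPf ->; rewrite scale0r.
have sp_homog e q : equivariant rG dualG q -> (forall i, harm (q i)) ->
    (forall i, q i \is e.-homog) -> spanned q.
  move=> eq hq qe; have [c cE] := BP _ _ (linear_ext_HomVdual eq hq qe).
  have -> : q = fun i => \sum_(j < count_mem (e%:Z - 1) cs) c j *: B (e%:Z - 1) j i.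
    by apply/funext => i; rewrite -cE trmx_delta [RHS]sum_row_delta.
  have sB (j : 'I_(count_mem (e%:Z - 1) cs)) : spanned (B (e%:Z - 1) j).
    have [i [si ni ci]] := nth_count_mem 0 (ltn_ord j).
    rewrite size_tuple in si; have := spphi (Ordinal si).
    by rewrite /phi (tnth_nth 0) /= ni ci.
  elim: (index_enum _) => [|j s IHs]; first by under eq_fun do rewrite big_nil.
  by under eq_fun do rewrite big_cons; apply: spL.
pose M := (\max_i msize (p i))%N.
have -> : p = fun i => \sum_(e <- iota 0 M) pihomog mdeg e (p i).
  apply/funext => i; rewrite -[M]subn0 big_mkord -pihomog_partitionE //.
  exact: (leq_bigmax (F := fun i => msize (p i))).
suff : spanned (fun i => \sum_(e <- iota 0 M) pihomog mdeg e (p i)) by [].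
elim: (iota 0 M) => [|e s IHs]; first by under eq_fun do rewrite big_nil.
have -> : (fun i => \sum_(e <- e :: s) pihomog mdeg e (p i)) =
    fun i => 1 *: pihomog mdeg e (p i) + \sum_(e <- s) pihomog mdeg e (p i).
  by apply/funext => i; rewrite big_cons scale1r.
apply: spL IHs; apply: (sp_homog e) => [|i|i].
- exact: equivariant_pihomog.
- exact: harmonic_pihomog.
exact: pihomogP.
Qed.

Lemma HomV_A_lin c s s' : HomV_A rG s -> HomV_A rG s' -> HomV_A rG (c *: s + s').
Proof.
move=> /HomV_A_lift hs /HomV_A_lift hs'.
have -> : c *: s + s' = fun x => coinv_pi rG (c *: harmonic_lift (s x) + harmonic_lift (s' x)).
  by apply/funext => x; rewrite coinv_piL !liftK.
exact: HomV_A_pi (homH_lin c hs hs').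
Qed.

Lemma HomVdual_A_lin c p p' :
  HomVdual_A rG p -> HomVdual_A rG p' -> HomVdual_A rG (c *: p + p').
Proof.
move=> /HomVdual_A_lift hp /HomVdual_A_lift hp'.
have := HomVdual_A_pi (homH_lin c hp hp').
suff <- : c *: p + p' =
    fun l => coinv_pi rG (c *: harmonic_lift (p l^T^T) + harmonic_lift (p' l^T^T)) by [].
by apply/funext => l; rewrite coinv_piL !liftK trmxK.
Qed.

End DualSpan.

Theorem theorem1 (R : realType) (gT : finGroupType) (G : {group gT}) (n : nat)
    (rG : mx_representation (R[i])%C G n)
    (hW : reflection_group rG) (hirr : mx_irreducible rG)
    (ds cs : n.-tuple int) (hdual : duality_group rG ds cs)
    (b : 'I_n -> ('rV[(R[i])%C]_n -> {mpoly (R[i])%C[n]}))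
    (hb : is_basis (HomV_H rG) b) :
  has_dim (HomV_A_deg rG (highest_degree ds)) 1 /\
  perfect_pairing (HomV_A rG) (HomVdual_A rG) (HomV_A_deg rG (highest_degree ds))
    (duality_pairing rG b (highest_degree ds)).
Proof.
have [d [d0 -> maxV degD [bb bbP]]] := duality_group_degrees hirr hdual.
have [_ cs_deg _] := hdual; have [phi phi_span] := dual_span cs_deg.
pose bst := bb ord0; have [bst_deg _] := bbP.
have bstH : homH rG rG bst by case: (bst_deg ord0).
have bst_homog x : bst x \is d.-1.-homog.
  have [_ /(_ x)] := bst_deg ord0; have -> : d%:Z - 1 = d.-1%:Z by lia.
  by [].
have bst_span u : HomV_H_deg rG d%:Z u -> exists c, forall x, u x = c *: bst x.
  by move=> /(is_basis_span bbP)[c ->]; exists (c ord0) => x; rewrite big_ord1.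
have bst_neq0 : exists i, bst (delta_mx 0 i) != 0.
  apply: contrapT => nz; have bst0 x : bst x = 0.
    rewrite (homHE x bstH) /linear_ext big1 // => i _.
    by have [->|bi] := eqVneq (bst (delta_mx 0 i)) 0; [rewrite scaler0|case: nz; exists i].
  have free := is_basis_free (c := fun=> 1) bbP (HomV_H_deg0 rG d%:Z).
  suff /free/(_ ord0)/eqP : \sum_(i < 1) 1 *: bb i = 0 by rewrite oner_eq0.
  by rewrite big_ord1 scale1r; apply/funext.
have bH k : homH rG rG (b k) by apply: hb.1.
have be_span h : equivariant rG rG h -> (forall i, harm rG (h i)) ->
    exists t : 'I_n -> R[i]%C, forall i, h i = \sum_k t k *: b k (delta_mx 0 i).
  move=> eh hh; have [t tE] := is_basis_span hb (homH_linear_ext eh hh).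
  by exists t => i; rewrite -[LHS](sum_row_delta h) -[LHS]/(linear_ext _ _) tE fct_sumE.
(* The component of [b k] in polynomial degree d - 1 lies in the one dimensional top piece spanned
   by [bst]; the coefficients form lam. *)
have lamH k : exists c, forall x, pihomog mdeg d.-1 (b k x) = c *: bst x.
  apply: (bst_span (fun x => pihomog mdeg d.-1 (b k x))); split.
    by apply/HomV_HE; exact: (homH_pihomog d.-1 (bH k)).
  move=> x; have -> : d%:Z - 1 = d.-1%:Z by lia.
  exact: pihomogP.
have [lam lamP] := choice lamH.
have linear_ext_neq0 (h : 'I_n -> {mpoly R[i]%C[n]}) :
    (exists i, h i != 0) -> linear_ext h != 0.
  move=> [i hi]; apply: contraNneq hi => h0.
  by rewrite -(sum_row_delta h) -/(linear_ext _ _) h0.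
have [| | |v [indep [evs evi] [evs' evi'] core]] :=
  @duality_evaluation _ _ _ _ rG (fun k i => b k (delta_mx 0 i)) phi d
    (fun i => bst (delta_mx 0 i)) (\row_k lam k) hW.1
    (fun k => homH_equiv (bH k)) (fun k i => homH_harm i (bH k)) be_span phi_span
    _ _ (fun p ep hp p1 => dual_equivariant_linear hirr ep p1) d0
    (homH_equiv bstH) (fun i => homH_harm i bstH) (fun i => bst_homog _) bst_neq0 _.
- move=> e h eh hh he /linear_ext_neq0 hn.
  have := maxV _ _ (linear_ext_HomV eh hh he) hn; lia.
- move=> e p ep hp pe pn.
  have pn' : (fun l : 'cV[R[i]%C]_n => linear_ext p l^T) != 0.
    move/linear_ext_neq0: (pn); apply: contraNneq => p0; apply/eqP/funext => x.
    by rewrite -[x]trmxK [LHS](congr1 (@^~ x^T) p0).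
  have := degD _ _ (linear_ext_HomVdual ep hp pe) pn'; lia.
- by move=> k i; rewrite lamP mxE.
pose pi := coinv_pi rG; pose lift := harmonic_lift (rG := rG).
pose w : 'rV_n -> coinv rG := fun x => pi (bst x).
(* Coordinates on the two Hom spaces: the values at v of the harmonic lifts of the images of the
   standard basis. *)
pose E1 (s : 'rV[R[i]%C]_n -> coinv rG) : 'rV[R[i]%C]_n :=
  \row_i ev v (lift (s (delta_mx 0 i))).
pose E2 (p : 'cV[R[i]%C]_n -> coinv rG) : 'rV[R[i]%C]_n :=
  \row_i ev v (lift (p (delta_mx i 0))).
have w_neq0 : w != 0.
  have [i bi] := bst_neq0; apply: contraNneq bi => w0; apply/eqP.
  apply: (@harm_pi_inj _ _ _ _ rG); [exact: (homH_harm i bstH)|exact: harmonic0|].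
  by rewrite coinv_pi0; exact: (congr1 (@^~ (delta_mx 0 i)) w0).
have dE : d%:Z - 1 = d.-1%:Z by lia.
have TP t : HomV_A_deg rG d%:Z t <-> exists c, t = c *: w.
  split=> [[tA td]|[c ->]].
    have [|c cE] := bst_span (fun x => lift (t x)).
      split; first exact/HomV_HE/HomV_A_lift.
      by move=> x; rewrite dE; apply: lift_homog; have := td x; rewrite dE.
    exists c; apply/funext => x; rewrite -[LHS]liftK -/lift cE.
    by rewrite -[c *: bst x]addr0 coinv_piL coinv_pi0 addr0.
  have E : c *: w = fun x => pi (c *: bst x + 0).
    by apply/funext => x; rewrite /pi coinv_piL coinv_pi0 addr0.
  split; first by rewrite E; apply: (HomV_A_pi (homH_lin c bstH (homH0 _ _))).
  move=> x; rewrite E dE; exists (c *: bst x + 0) => //=.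
  by rewrite addr0; apply: rpredZ; apply: bst_homog.
split; first exact: has_dim1 w_neq0 TP.
apply: (perfect_pairing_coordinates (E1 := E1) (E2 := E2) w_neq0 TP).
- move=> s p sA pA; apply/funext => x.
  have hs := HomV_A_lift sA; have hp := HomVdual_A_lift pA.
  have p_equiv := homH_equiv hp; have p_harm i := homH_harm i hp.
  have [q qE qlam] := core _ _ (homH_equiv hs) (fun i => homH_harm i hs) p_equiv p_harm.
  have trd (i : 'I_n) : (delta_mx 0 i : 'rV[R[i]%C]_n)^T = delta_mx i 0.
    by rewrite trmx_delta.
  rewrite /duality_pairing; set f := \sum_i _.
  have cstE q' : cst_map b q' = q' \mPo basic_invariants (fun k i => b k (delta_mx 0 i)).
    apply: (congr1 (fun t => comp_mpoly t q')); apply: eq_mktuple => k.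
    by apply: eq_bigr => i _; rewrite mulrC.
  have fE : cst_map b q = f.
    by rewrite cstE -qE; apply: eq_bigr => i _; rewrite trd.
  (* [cst_inv] picks some preimage of f; the independence of the basic invariants forces it to be
     q. *)
  have qf : cst_inv b f = q.
    have invE : cst_map b (cst_inv b f) = f.
      by apply: (xgetPex 0 (P := [set q | cst_map b q = f]%classic)); exists q.
    apply/eqP; rewrite -subr_eq0; apply/eqP/indep; rewrite comp_mpolyB -!cstE.
    by rewrite invE fE subrr.
  have -> : duality_proj b d%:Z f x = (\sum_k q@_U_(k)%MM * lam k) *: bst x.
    rewrite /duality_proj qf dE /S_proj /sym1_proj fct_sumE linear_sum scaler_suml /=.
    by apply: eq_bigr => k _; rewrite linearZ /= lamP scalerA.
  rewrite -[_ *: bst x]addr0 coinv_piL coinv_pi0 addr0.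
  apply: (congr1 (GRing.scale^~ _)).
  have -> : \sum_k q@_U_(k)%MM * lam k = \sum_k q@_U_(k)%MM * (\row_k lam k) 0 k.
    by apply: eq_bigr => k _; rewrite mxE.
  by rewrite qlam; apply: eq_bigr => i _; rewrite !mxE trd.
- exact: HomV_A_lin.
- exact: HomVdual_A_lin.
- move=> c x y _ _; apply/rowP => i.
  by rewrite !mxE [lift _]lift_lin rmorphD /= evZ.
- move=> c x y _ _; apply/rowP => i.
  by rewrite !mxE [lift _]lift_lin rmorphD /= evZ.
- move=> s /HomV_A_lift hs s0; apply/funext => x; rewrite -[LHS]liftK (homHE x hs).
  rewrite /linear_ext big1 ?coinv_pi0 // => i _.
  rewrite (evi _ (homH_equiv hs) (fun i => homH_harm i hs)) ?scaler0 // => j.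
  by have /rowP/(_ j) := s0; rewrite !mxE.
- move=> p /HomVdual_A_lift hp p0; apply/funext => x.
  rewrite -[LHS]liftK -[x]trmxK (homHE x^T hp).
  rewrite /linear_ext big1 ?coinv_pi0 // => i _.
  rewrite (evi' _ (homH_equiv hp) (fun i => homH_harm i hp)) ?scaler0 // => j.
  by have /rowP/(_ j) := p0; rewrite !mxE trmx_delta.
- move=> r; have [h [eh hh hE]] := evs (r 0).
  exists (fun x => pi (linear_ext h x)); first exact: HomV_A_pi (homH_linear_ext eh hh).
  apply/rowP => i; rewrite mxE /lift lift_pi; last exact: homH_harm (homH_linear_ext eh hh).
  by rewrite [linear_ext _ _]sum_row_delta hE.
move=> r; have [h [eh hh hE]] := evs' (r 0).
exists (fun l => pi (linear_ext h l^T)); first exact: HomVdual_A_pi (homH_linear_ext eh hh).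
apply/rowP => i; rewrite mxE /lift trmx_delta lift_pi.
  by rewrite [linear_ext _ _]sum_row_delta hE.
exact: homH_harm (homH_linear_ext eh hh).
Qed.
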